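(* Let $$\mathcal{M}=\{\operatorname{Coker}\alpha(b,c,d,\epsilon),\ \operatorname{Coker}\beta(b,c,d,\epsilon)\mid b,c,d,\epsilon\in K,\ b^3=c^3=d^3=-1,\ \epsilon^3=1,\ \epsilon\neq 1\}$$ and $$\mathcal{N}=\{\operatorname{Coker}\eta(a,b,c,\epsilon),\ \operatorname{Coker}\vartheta(a,b,c)\mid \epsilon\in K,\ \epsilon^3=1,\ \epsilon\ne 1,\ (a,b,c)\text{ a permutation of the three cubic roots of }-1\text{ in }K\}.$$ These families of rank one, three generated, graded MCM $R_4$-modules have the following properties (two members of the families are called different if they are given by different matrices): (i) Every three generated, rank one, non-free, graded MCM $R_4$-module is isomorphic to a module of $\mathcal{M}\cup\mathcal{N}$. (ii) If $M=\operatorname{Coker}\alpha(b,c,d,\epsilon)$ (respectively $M=\operatorname{Coker}\beta(b,c,d,\epsilon)$) belongs to $\mathcal{M}$ and $N\in\mathcal{M}$ is different from $M$, then $N\simeq M$ if and only if $N=\operatorname{Coker}\alpha(b\epsilon,c\epsilon,d\epsilon,\epsilon^2)$ (respectively $N=\operatorname{Coker}\beta(b\epsilon,c\epsilon,d\epsilon,\epsilon^2)$). (iii) Any two different modules of $\mathcal{N}$ are not isomorphic. (iv) No module of $\mathcal{N}$ is isomorphic to a module of $\mathcal{M}$.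
   Context: $K$ is an algebraically closed field of characteristic $0$, $S=K[Y_1,Y_2,Y_3,Y_4]$ with the standard grading, $f_4=Y_1^3+Y_2^3+Y_3^3+Y_4^3$, $R_4=S/(f_4)$. MCM means (finitely generated) maximal Cohen-Macaulay. ''Three generated'' means that the minimal number of generators is $3$. Isomorphisms are isomorphisms of $R_4$-modules (degree shifts of the grading are disregarded). For a $3\times 3$ matrix $\varphi$ over $S$ with $\det\varphi=f_4$ (so that $\varphi$ and its adjoint form a matrix factorization of $f_4$; all matrices below have this property), $\operatorname{Coker}\varphi$ is the cokernel of $\varphi:S^3\to S^3$; it is annihilated by $f_4$ and hence an $R_4$-module. For $b,c,d,\epsilon\in K$ with $b^3=c^3=d^3=-1$, $\epsilon^3=1$, $\epsilon\neq1$, let $a\in K$ be defined by $bcd=\epsilon a$ (so $a^3=-1$) and set $$\alpha(b,c,d,\epsilon)=\begin{pmatrix} 0 & Y_1-aY_4 & Y_2-bY_3\\ Y_1-cY_2 & -b^2Y_3-abc^2\epsilon^2Y_4 & b^2c^2Y_3-abc\epsilon^2Y_4\\ Y_3-dY_4 & c^2Y_2+bc^2Y_3+acY_4 & -Y_1-cY_2-aY_4\end{pmatrix},$$ and let $\beta(b,c,d,\epsilon)=\alpha(b,c,d,\epsilon)^t$ be its transpose. For $(a,b,c)$ a permutation (ordering) of the three distinct cubic roots of $-1$ in $K$ and $\epsilon\in K$ with $\epsilon^3=1$, $\epsilon\ne1$, set $$\eta(a,b,c,\epsilon)=\begin{pmatrix} 0 & Y_1+Y_2 & Y_3-aY_4\\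 Y_1+\epsilon Y_2 & -Y_3+cY_4 & 0\\ Y_3-bY_4 & 0 & -Y_1-\epsilon^2Y_2\end{pmatrix},$$ $$\vartheta(a,b,c)=\begin{pmatrix} 0 & Y_1+Y_3 & Y_2-aY_4\\ Y_1-a^2bY_3 & -Y_2+cY_4 & 0\\ Y_2-bY_4 & 0 & -Y_1+ab^2Y_3\end{pmatrix}.$$ *)

(* Defs.v *)
From HB Require Import structures.
From mathcomp Require Import all_boot all_order all_algebra ring_quotient.
From mathcomp Require Import mpoly boolp.

Set Implicit Arguments.
Unset Strict Implicit.
Unset Printing Implicit Defensive.

Import GRing.Theory.
Local Open Scope ring_scope.
Local Open Scope quotient_scope.

Section CommutativeAlgebra.

Variable R : comNzRingType.

(* dim R = n, the length of a longest chain P_0 < ... < P_n of primes. *)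
Definition prime_chain (n : nat) (P : nat -> prime_idealr R) : Prop :=
  forall i, (i < n)%N ->
    (forall x, x \in P i -> x \in P i.+1) /\
    (exists2 x, x \in P i.+1 & x \notin P i).

Definition has_krull_dim (n : nat) : Prop :=
  (exists P, prime_chain n P) /\ (forall k P, prime_chain k P -> (k <= n)%N).

Variable M : lmodType R.

Definition generates (n : nat) (x : 'I_n -> M) : Prop :=
  forall m, exists c : 'I_n -> R, m = \sum_(i < n) c i *: x i.

Definition lin_indep (n : nat) (x : 'I_n -> M) : Prop :=
  forall c : 'I_n -> R, \sum_(i < n) c i *: x i = 0 -> forall i, c i = 0.

Definition fin_gen : Prop := exists n (x : 'I_n -> M), generates x.

Definition min_nb_gens (n : nat) : Prop :=
  (exists x : 'I_n -> M, generates x) /\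
  (forall k (x : 'I_k -> M), generates x -> (n <= k)%N).

(* Freeness of a finitely generated module: the basis is taken finite. *)
Definition fin_free : Prop :=
  exists n (x : 'I_n -> M), generates x /\ lin_indep x.

(* The rank, for R an integral domain: the largest number of linearly         *)
(* independent elements, i.e., the dimension of Frac(R) (x) M over Frac(R).    *)
Definition has_rank (r : nat) : Prop :=
  (exists x : 'I_r -> M, lin_indep x) /\
  (forall k (x : 'I_k -> M), lin_indep x -> (k <= r)%N).

(* m \in (s_0, ..., s_(n-1)) M *)
Definition in_ideal_mul (s : seq R) (m : M) : Prop :=
  exists u : 'I_(size s) -> M, m = \sum_(i < size s) s`_i *: u i.

(* s is M-regular: each s_i is a nonzerodivisor on M / (s_0, ..., s_(i-1)) M, *)
(* and M / (s) M is nonzero.                                                  *)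
Definition regular_seq (s : seq R) : Prop :=
  (forall i, (i < size s)%N -> forall m : M,
     in_ideal_mul (take i s) (s`_i *: m) -> in_ideal_mul (take i s) m) /\
  (exists m : M, ~ in_ideal_mul s m).

Definition regular_seq_in (J : R -> Prop) (s : seq R) : Prop :=
  (forall x, x \in s -> J x) /\ regular_seq s.

(* depth_J M = n, the largest length of an M-regular sequence in J. *)
Definition has_depth (J : R -> Prop) (n : nat) : Prop :=
  (exists2 s, regular_seq_in J s & size s = n) /\
  (forall s, regular_seq_in J s -> (size s <= n)%N).

End CommutativeAlgebra.

Definition lmod_isom (R : comNzRingType) (M N : lmodType R) : Prop :=
  exists f : {linear M -> N}, bijective f.

Section Fermat.

Variable K : fieldType.

Definition S4 : comNzRingType := {mpoly K[4]}.

Definition Y1 : {mpoly K[4]} := 'X_(@Ordinal 4 0 isT).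
Definition Y2 : {mpoly K[4]} := 'X_(@Ordinal 4 1 isT).
Definition Y3 : {mpoly K[4]} := 'X_(@Ordinal 4 2 isT).
Definition Y4 : {mpoly K[4]} := 'X_(@Ordinal 4 3 isT).

Definition f4 : {mpoly K[4]} := Y1 ^+ 3 + Y2 ^+ 3 + Y3 ^+ 3 + Y4 ^+ 3.

Definition f4_ideal : {pred S4} := [pred p | `[< exists q, p = q * f4 >]].

Lemma f4_ideal_closed : idealr_closed f4_ideal.
Proof.
split.
- by apply/asboolP; exists 0; rewrite mul0r.
- apply/asboolP=> -[q /(congr1 (mmap idfun (fun _ => 0)))].
  rewrite rmorph1 rmorphM /f4 !rmorphD !rmorphXn /= !mmapX !mmap1U.
  by rewrite !expr0n /= !addr0 mulr0 => /eqP; rewrite oner_eq0.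
- move=> p u v /asboolP[q ->] /asboolP[r ->]; apply/asboolP.
  by exists (p * q + r); rewrite mulrDl mulrA.
Qed.

HB.instance Definition _ := isIdealr.Build S4 f4_ideal f4_ideal_closed.

Definition R4 : comNzRingType := {ideal_quot f4_ideal}.

Definition R4_pi (p : S4) : R4 := \pi_({ideal_quot f4_ideal}) p.

Lemma R4_piE (p q : S4) : R4_pi p = R4_pi q <-> exists s, p - q = s * f4.
Proof.
rewrite /R4_pi; split=> [/eqP|[s pq]].
  by rewrite -Quotient.idealrBE => /asboolP.
by apply/eqP; rewrite -Quotient.idealrBE; apply/asboolP; exists s.
Qed.

Lemma R4_piK r : R4_pi (repr r) = r. Proof. exact: reprK. Qed.
Lemma R4_piD p q : R4_pi (p + q) = R4_pi p + R4_pi q.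
Proof. exact: Quotient.pi_add. Qed.
Lemma R4_piM p q : R4_pi (p * q) = R4_pi p * R4_pi q.
Proof. exact: Quotient.pi_mul. Qed.
Lemma R4_pi1 : R4_pi 1 = 1.
Proof. by rewrite /R4_pi !piE. Qed.

Definition R4_homog (d : nat) (r : R4) : Prop :=
  exists2 p : {mpoly K[4]}, p \is d.-homog & r = R4_pi p.

(* The homogeneous maximal ideal (Y1, Y2, Y3, Y4) of R4. *)
Definition R4_irrelevant (r : R4) : Prop :=
  exists c : 'I_4 -> R4, r = \sum_(i < 4) c i * R4_pi 'X_i.

(* M is the direct sum of the additive subgroups G i, for i an integer, and   *)
(* multiplication by a form of degree d maps G i into G (d + i).              *)
Record is_grading (M : lmodType R4) (G : int -> M -> Prop) : Prop := IsGrading {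
  grading0 : forall i, G i 0;
  gradingB : forall i x y, G i x -> G i y -> G i (x - y);
  gradingZ : forall d i r x, R4_homog d r -> G i x -> G (d%:Z + i) (r *: x);
  grading_sum : forall m, exists (s : seq int) (x : int -> M),
    (forall i, G i (x i)) /\ m = \sum_(i <- s) x i;
  grading_direct : forall (s : seq int) (x : int -> M), uniq s ->
    (forall i, G i (x i)) -> \sum_(i <- s) x i = 0 ->
    forall i, i \in s -> x i = 0
}.

Definition is_graded (M : lmodType R4) : Prop :=
  exists G : int -> M -> Prop, is_grading G.

(* For graded modules over the standard graded ring R4, the depth is taken    *)
(* with respect to the homogeneous maximal ideal.                             *)
Definition is_MCM (M : lmodType R4) : Prop :=
  fin_gen M /\ exists2 n, has_krull_dim R4 n & has_depth M R4_irrelevant n.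

Record detmx := DetMx {
  detmx_val :> 'M[S4]_3;
  detmxP : \det detmx_val = f4
}.

Section Cokernel.

Variable phi : detmx.

(* phi acts on column vectors, so its image is spanned by its columns. *)
Definition im_mx : {pred 'cV[S4]_3} :=
  [pred v | `[< exists w, v = phi *m w >]].

Lemma im_mx_zmod_closed : zmod_closed im_mx.
Proof.
split; first by apply/asboolP; exists 0; rewrite mulmx0.
move=> _ _ /asboolP[u ->] /asboolP[v ->].
by apply/asboolP; exists (u - v); rewrite mulmxBr.
Qed.

HB.instance Definition _ :=
  GRing.isZmodClosed.Build 'cV[S4]_3 im_mx im_mx_zmod_closed.

Definition coker : Type := Quotient.quot im_mx.

HB.instance Definition _ := GRing.Zmodule.on coker.

Definition coker_pi (v : 'cV[S4]_3) : coker := \pi_(Quotient.quot im_mx) v.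

(* The class of p in R4 acts on the class of v as p *: v; this does not       *)
(* depend on p since f4 = \det phi annihilates the cokernel.                  *)
Definition coker_scale (r : R4) (m : coker) : coker :=
  coker_pi ((repr r : S4) *: (repr m : 'cV[S4]_3)).

Lemma coker_piE u v : coker_pi u = coker_pi v <-> im_mx (u - v).
Proof.
rewrite /coker_pi; split=> [/eqP|uv]; first by rewrite -Quotient.idealrBE.
by apply/eqP; rewrite -Quotient.idealrBE.
Qed.

Lemma coker_piK m : coker_pi (repr m) = m. Proof. exact: reprK. Qed.

Lemma coker_piD u v : coker_pi (u + v) = coker_pi u + coker_pi v.
Proof. exact: Quotient.pi_add. Qed.

Lemma im_mxD u v : im_mx u -> im_mx v -> im_mx (u + v).
Proof.
by move=> /asboolP[x ->] /asboolP[y ->]; apply/asboolP; exists (x + y); rewrite mulmxDr.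
Qed.

Lemma im_mxZ (p : S4) u : im_mx u -> im_mx (p *: u).
Proof.
by move=> /asboolP[x ->]; apply/asboolP; exists (p *: x); rewrite -scalemxAr.
Qed.

Lemma im_mx_f4 u : im_mx ((f4 : S4) *: u).
Proof.
apply/asboolP; exists (\adj phi *m u).
by rewrite mulmxA mul_mx_adj mul_scalar_mx detmxP.
Qed.

Lemma coker_scaleE p v : coker_scale (R4_pi p) (coker_pi v) = coker_pi (p *: v).
Proof.
apply/coker_piE; set q := repr _; set w := repr _.
have /R4_piE[s qp] : R4_pi q = R4_pi p by exact: reprK.
have wv : im_mx (w - v) by apply/coker_piE; exact: coker_piK.
have -> : q *: w - p *: v = q *: (w - v) + f4 *: (s *: v).
  by rewrite scalerA mulrC -qp scalerBr scalerBl addrA subrK.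
by apply: im_mxD; [exact: im_mxZ | exact: im_mx_f4].
Qed.

Lemma coker_scaleA a b m :
  coker_scale a (coker_scale b m) = coker_scale (a * b) m.
Proof.
rewrite -[a]R4_piK -[b]R4_piK -[m]coker_piK.
by rewrite -R4_piM !coker_scaleE scalerA.
Qed.

Lemma coker_scale1 : left_id 1 coker_scale.
Proof. by move=> m; rewrite -[m]coker_piK -R4_pi1 coker_scaleE scale1r. Qed.

Lemma coker_scaleDr : right_distributive coker_scale +%R.
Proof.
move=> a m n; rewrite -[a]R4_piK -[m]coker_piK -[n]coker_piK.
by rewrite -coker_piD !coker_scaleE scalerDr coker_piD.
Qed.

Lemma coker_scaleDl m : {morph coker_scale^~ m : a b / a + b}.
Proof.
move=> a b; rewrite -[a]R4_piK -[b]R4_piK -[m]coker_piK.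
by rewrite -R4_piD !coker_scaleE scalerDl coker_piD.
Qed.

HB.instance Definition _ := GRing.Zmodule_isLmodule.Build R4 coker
  coker_scaleA coker_scale1 coker_scaleDr coker_scaleDl.

Definition Coker : lmodType R4 := coker.

End Cokernel.

Definition mx3 (rows : seq (seq {mpoly K[4]})) : 'M[S4]_3 :=
  \matrix_(i < 3, j < 3) (nth [::] rows i)`_j.

Definition alpha (b c d e : K) : 'M[S4]_3 :=
  let a := b * c * d / e in
  mx3 [:: [:: 0; Y1 - a *: Y4; Y2 - b *: Y3];
          [:: Y1 - c *: Y2;
              - (b ^+ 2 *: Y3) - (a * b * c ^+ 2 * e ^+ 2) *: Y4;
              (b ^+ 2 * c ^+ 2) *: Y3 - (a * b * c * e ^+ 2) *: Y4];
          [:: Y3 - d *: Y4;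
              c ^+ 2 *: Y2 + (b * c ^+ 2) *: Y3 + (a * c) *: Y4;
              - Y1 - c *: Y2 - a *: Y4]].

Definition beta (b c d e : K) : 'M[S4]_3 := (alpha b c d e)^T.

Definition eta (a b c e : K) : 'M[S4]_3 :=
  mx3 [:: [:: 0; Y1 + Y2; Y3 - a *: Y4];
          [:: Y1 + e *: Y2; - Y3 + c *: Y4; 0];
          [:: Y3 - b *: Y4; 0; - Y1 - e ^+ 2 *: Y2]].

Definition vartheta (a b c : K) : 'M[S4]_3 :=
  mx3 [:: [:: 0; Y1 + Y3; Y2 - a *: Y4];
          [:: Y1 - (a ^+ 2 * b) *: Y3; - Y2 + c *: Y4; 0];
          [:: Y2 - b *: Y4; 0; - Y1 + (a * b ^+ 2) *: Y3]].

Definition M_params (b c d e : K) : Prop :=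
  [/\ b ^+ 3 = -1, c ^+ 3 = -1, d ^+ 3 = -1, e ^+ 3 = 1 & e <> 1].

(* a, b, c are the three distinct cubic roots of -1, in some order. *)
Definition cubic_roots (a b c : K) : Prop :=
  [/\ a ^+ 3 = -1, b ^+ 3 = -1, c ^+ 3 = -1 & uniq [:: a; b; c]].

Definition calM (phi : 'M[S4]_3) : Prop :=
  exists b c d e, M_params b c d e /\
    (phi = alpha b c d e \/ phi = beta b c d e).

Definition calN (phi : 'M[S4]_3) : Prop :=
  (exists a b c e, [/\ cubic_roots a b c, e ^+ 3 = 1, e <> 1
                     & phi = eta a b c e]) \/
  (exists a b c, cubic_roots a b c /\ phi = vartheta a b c).

End Fermat.

(* Main.v *)
From HB Require Import structures.
Require Import Defs.
From mathcomp Require Import all_boot all_order all_algebra ring_quotient.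
From mathcomp Require Import mpoly boolp ring zify ssrZ.

Set Implicit Arguments.
Unset Strict Implicit.
Unset Printing Implicit Defensive.

Import GRing.Theory.
Local Open Scope ring_scope.

(** Let A = K[Y1, Y2, Y3], a polynomial subring of R4 over which R4 is free with basis
    1, y4, y4^2. The argument reduces the classification of modules to that of
    determinantal representations of the Fermat cubic surface, and the latter to the
    geometry of the 27 lines on that surface.

    From modules to matrices. On a graded MCM module M the first Koszul homology of
    Y1, Y2, Y3 vanishes, so a minimal homogeneous generating family of M over A is
    free (MCM_min_hgens_free). If M has rank one and needs three generators over R4
    this family has three elements, all of the same degree, and y4 acts on it by a 3 x
    3 matrix T of linear forms; hence M is the cokernel of Y4 - T, whose determinant
    is f4 (MCM_linear_coker). Conversely the cokernel of a matrix of linear forms with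
    determinant f4 is graded, MCM, of rank one, and needs three generators. Comparing
    degree zero parts, two such cokernels are isomorphic exactly when P phi = psi Q
    with P and Q invertible over K (lin_equiv_isom, isom_lin_equiv).

    From matrices to lines. Write phi as a family of constant matrices Phi, with value
    Phi(y) at a point y. There are nonzero u and v with u Phi(y) v = 0 for all y
    (exists_orth): on a line of the surface the family is a singular pencil, hence of
    a special shape. For such u and v, the points y with Phi(y) v = 0 contain a line,
    and so do those with u Phi(y) = 0; both lines lie on the surface, so they are
    among the 27 lines, and smoothness of the surface makes them disjoint (orth_skew).
    A basis of K^4 adapted to the two lines brings Phi to a normal form that depends,
    up to equivalence, on the two lines only (contracts_unique).

    Finite verification. All entries of the 126 matrices and all 27 lines have
    coordinates in Z[w], w a primitive cubic root of unity, so the rest is a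
    computation with pairs of integers. Every ordered pair of disjoint lines arises
    from one of the 126 matrices (lines_coveredP); this proves (i). The set of lines
    contracted by column vectors is invariant under isomorphism, and distinct matrices
    have distinct sets unless they are an alpha or a beta and its twist
    (codes_separatedP); this gives the non-isomorphisms. A matrix and its twist share
    a pair of disjoint lines (twists_matchP), hence are equivalent. *)

(** * Algebraic dependence of polynomials *)

(** Gaussian elimination without division, as the entries lie in a domain: a row with
    nonzero last entry is used to clear the last column. *)
Lemma idomain_rows_dependent (D : idomainType) n (a : 'I_n.+1 -> 'I_n -> D) :
  exists2 c : 'I_n.+1 -> D, exists i, c i != 0 &
    forall j, \sum_i c i * a i j = 0.
Proof.
elim: n a => [|n IHn] a.
  by exists (fun=> 1) => [|[]//]; exists ord0; rewrite oner_eq0.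
case: (pselect (exists i, a i ord_max != 0)) => [[i0 ai0]|all0]; last first.
  have [c [i ci] cP] := IHn (fun i j => a (lift ord_max i) (lift ord_max j)).
  exists (fun k => if unlift ord_max k is Some k' then c k' else 0).
    by exists (lift ord_max i); rewrite liftK.
  move=> j; rewrite (bigD1_ord ord_max) //= unlift_none mul0r add0r.
  case: (unliftP ord_max j) => [j' ->|->].
    by rewrite -[RHS](cP j'); apply: eq_bigr => k _; rewrite liftK.
  rewrite big1 // => k _; have [->|ak] := eqVneq (a (lift ord_max k) ord_max) 0.
    by rewrite mulr0.
  by case: all0; exists (lift ord_max k).
have [c [i ci] cP] := IHn (fun i j =>
  a i0 ord_max * a (lift i0 i) (lift ord_max j) -
  a (lift i0 i) ord_max * a i0 (lift ord_max j)).
exists (fun k => if unlift i0 k is Some k' then a i0 ord_max * c k'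
                 else - \sum_k c k * a (lift i0 k) ord_max).
  by exists (lift i0 i); rewrite liftK mulf_neq0.
move=> j; rewrite (bigD1_ord i0) //= unlift_none.
under [X in _ + X]eq_bigr do rewrite liftK.
case: (unliftP ord_max j) => [j' ->|->]; last first.
  rewrite mulNr mulr_suml addrC; apply/eqP; rewrite subr_eq0; apply/eqP.
  by apply: eq_bigr => k _; ring.
rewrite -[RHS](cP j') mulNr mulr_suml -sumrN -big_split /=.
by apply: eq_bigr => k _; ring.
Qed.

(** The lowest term, in the shape used to build the identities of collapse. *)
Lemma poly_low_coef (R : nzRingType) (p : {poly R}) : p != 0 ->
  exists m c q, c != 0 /\ p = 'X^m * (c%:P + q * 'X).
Proof.
elim/poly_ind: p => [|p c IHp]; first by rewrite eqxx.
have [->|c0 _] := eqVneq c 0; last first.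
  by exists 0, c, p; rewrite expr0 mul1r addrC.
rewrite polyC0 addr0; have [->|/IHp [m [d [q [d0 ->]]]] _] := eqVneq p 0.
  by rewrite mul0r eqxx.
exists m.+1, d, q; split=> //. by rewrite commr_polyX exprS -mulrA.
Qed.

Lemma ord_maxW n (P : 'I_n.+1 -> Prop) :
  P ord_max -> (forall i : 'I_n, P (widen_ord (leqnSn n) i)) -> forall i, P i.
Proof.
move=> Pmax Pw i; case: (unliftP ord_max i) => [j ->|->] //.
suff -> : lift ord_max j = widen_ord (leqnSn n) j by [].
by apply/val_inj; rewrite /= /bump leqNgt ltn_ord.
Qed.

Lemma mnm_rcons_max n (m : 'X_{1..n}) k : [multinom rcons m k] ord_max = k.
Proof. by rewrite multinomE (tnth_nth 0%N) nth_rcons size_tuple /= ltnn eqxx. Qed.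

Lemma mnm_rcons_widen n (m : 'X_{1..n}) k i :
  [multinom rcons m k] (widen_ord (leqnSn n) i) = m i.
Proof.
by rewrite multinomE (tnth_nth 0%N) nth_rcons size_tuple /= ltn_ord [RHS]multinomE (tnth_nth 0%N).
Qed.

(** muni views a polynomial in n + 1 variables as a univariate one whose variable is
    the last one. *)
Lemma coef_muni (R : nzRingType) n (p : {mpoly R[n.+1]}) k m :
  ((muni p)`_k)@_m = p@_[multinom rcons m k].
Proof.
rewrite [p in RHS]mpolyE muniE coef_sum !raddf_sum; apply: eq_bigr => /= e _.
rewrite coefZ coefXn mulr_natr mcoeffMn !mcoeffZ !mcoeffX -mulrnAr; congr (_ * _).
rewrite -mulrnA mulnb; congr (nat_of_bool _)%:R; apply/andP/eqP.
  case=> /eqP<- /eqP->; apply/mnmP; apply: ord_maxW => [|i].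
    by rewrite mnm_rcons_max.
  by rewrite mnm_rcons_widen mnmE.
move=> ->; split; last by rewrite mnm_rcons_max.
by apply/eqP/mnmP => i; rewrite mnmE mnm_rcons_widen.
Qed.

Lemma muni_inj (R : nzRingType) n : injective (@muni n R).
Proof.
move=> p q pq; apply/mpolyP => m.
have -> : m = [multinom rcons [multinom m (widen_ord (leqnSn n) i) | i < n] (m ord_max)].
  apply/mnmP; apply: ord_maxW => [|i]; first by rewrite mnm_rcons_max.
  by rewrite mnm_rcons_widen mnmE.
by rewrite -!coef_muni pq.
Qed.

(** The shape of an identity x1^m1 (x2^m2 (... (c + a_k x_k) ...) + a1 x1) = r with c
    satisfying ok. In Lombardi's description, a ring has dimension less than k when
    every sequence of k elements satisfies such an identity with r = 0 and c a unit.
    The identity passes from a chain of primes, and from a regular sequence, to its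
    last step, and so bounds both the Krull dimension and the depth. *)
Fixpoint collapse (R : comNzRingType) (ok : R -> Prop) (s : seq R) (r : R) : Prop :=
  if s is x :: s' then
    exists m a r', collapse ok s' r' /\ r = x ^+ m * (r' + a * x)
  else ok r.

Lemma mmap_muni (R S : comNzRingType) n (f : {rmorphism R -> S}) (h : 'I_n.+1 -> S)
    (p : {mpoly R[n.+1]}) :
  mmap f h p =
  (map_poly (mmap f (fun i => h (widen_ord (leqnSn n) i))) (muni p)).[h ord_max].
Proof.
rewrite muniE {1}/mmap rmorph_sum horner_sum; apply: eq_bigr => /= m _.
rewrite -!mul_polyC !rmorphM /= !map_polyC /= map_polyXn.
rewrite hornerM hornerC hornerXn mmapZ mmapX /mmap1 big_ord_recr /= mulrA.
by congr (_ * _ * _); apply: eq_bigr => i _; rewrite mnmE.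
Qed.

(** A polynomial relation between the elements of s yields a collapse identity: take
    the lowest power of each variable in turn. The sequence is reversed because muni
    singles out the last variable. *)
Lemma collapse_mmap (K S : comNzRingType) (f : {rmorphism K -> S}) (s : seq S)
    (Q : {mpoly K[size s]}) : Q != 0 ->
  collapse (fun r => exists2 c, c != 0 & r = f c) s
    (mmap f (fun i => (rev s)`_i) Q).
Proof.
elim: s Q => [|x s IHs] Q /= Q0.
  exists Q@_0.
    apply: contraNneq Q0 => Q0; apply/eqP/mpolyP => m.
    by rewrite mcoeff0; have -> : m = 0%MM by apply/mnmP; case.
  rewrite -[Q in LHS]mpolyKC mmapC; congr (f _).
have U0 : muni Q != 0 by apply: contraNneq Q0 => U0; apply/eqP/muni_inj; rewrite U0 muni0.
have [m [c [q [c0 Uq]]]] := poly_low_coef U0.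
exists m.
set h := fun i => (rev (x :: s))`_i.
set g := mmap f (fun i : 'I_(size s) => h (widen_ord (leqnSn _) i)).
exists (map_poly g q).[x], (mmap f (fun i => (rev s)`_i) c).
split; first exact: IHs.
have hx : (rev (x :: s))`_(size s) = x by rewrite rev_cons nth_rcons size_rev ltnn eqxx.
rewrite mmap_muni Uq.
rewrite rmorphM rmorphD rmorphM /= map_polyXn map_polyX map_polyC /=.
rewrite !hornerE /= -/h -/g /= hx; congr (_ * (_ + _)).
rewrite /mmap; apply: eq_bigr => e _; congr (_ * _); apply: eq_bigr => i _.
by rewrite /h /= rev_cons nth_rcons size_rev ltn_ord.
Qed.

Lemma msizeM_leD (R : nzRingType) n (p q : {mpoly R[n]}) d e :
  (msize p <= d.+1 -> msize q <= e.+1 -> msize (p * q) <= (d + e).+1)%N.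
Proof.
move=> pd qe; rewrite msizeE; apply/bigmax_leqP_seq => m /msuppM_le /allpairsP[[a b] /= [pa qb ->]] _.
rewrite mdegD ltnS leq_add // -ltnS.
  by apply: leq_trans pd; apply: msize_mdeg_lt.
by apply: leq_trans qe; apply: msize_mdeg_lt.
Qed.

Lemma msize_prod_exp_le (R : comNzRingType) n (I : finType) (x : I -> {mpoly R[n]})
    (e : I -> nat) D :
  (forall i, msize (x i) <= D.+1)%N ->
  (msize (\prod_i x i ^+ e i) <= (\sum_i e i * D).+1)%N.
Proof.
move=> xD; elim/big_ind2: _ => [|p d q f|i _]; first by rewrite msize1.
  exact: msizeM_leD.
elim: (e i) => [|k IHk]; first by rewrite msize1.
by rewrite exprS mulSn; apply: msizeM_leD.
Qed.

(** Counting: the monomials in x with exponents below N outnumber the monomials that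
    can occur in them, once N is large compared with the degrees of the x i. *)
Lemma mpoly_alg_dependent (K : fieldType) n (x : 'I_n.+1 -> {mpoly K[n]}) :
  exists2 Q : {mpoly K[n.+1]}, Q != 0 & mmap (@mpolyC n K) x Q = 0.
Proof.
(* D bounds the degrees; the N^(n+1) products of powers of the x i with exponents
   below N involve only monomials with exponents below E, of which there are E^n. *)
pose D := (\max_i msize (x i))%N.
pose N := ((n.+1 * D).+1 ^ n).+1.
pose E := (n.+1 * (N * D)).+1.
pose I := {ffun 'I_n.+1 -> 'I_N}; pose J := {ffun 'I_n -> 'I_E}.
have ltJI : (#|J| < #|I|)%N.
  rewrite !card_ffun !card_ord.
  apply: (@leq_ltn_trans ((N * (n.+1 * D).+1) ^ n)).
    have [n0|n0] := posnP n; first by rewrite [X in (_ ^ X)%N]n0 [X in (_ <= _ ^ X)%N]n0.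
    rewrite leq_exp2r //.
    by rewrite mulnS /E mulnCA; apply: (leq_add (ltn0Sn _) (leqnn _)).
  by rewrite expnMn expnSr ltn_pmul2l ?expn_gt0 // ltnS.
pose xm (e : I) := \prod_i x i ^+ e i.
have xm0 e m : (E <= mdeg m)%N -> (xm e)@_m = 0.
  move=> Em; apply/memN_msupp_eq0/msize_mdeg_ge; apply: leq_trans Em.
  apply: leq_trans (msize_prod_exp_le (fun i => e i) (D := D) _) _.
    by move=> i; apply/leqW/leq_bigmax.
  rewrite ltnS -[n.+1 in leqRHS]card_ord -sum_nat_const; apply: leq_sum => i _.
  by rewrite leq_mul2r ltnW ?orbT.
pose B := \matrix_(a < #|I|, b < #|J|)
  (xm (enum_val a))@_[multinom (enum_val b i : nat) | i < n].
have /rowV0Pn[r /sub_kermxP rB r0] : kermx B != 0.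
  rewrite kermx_eq0 /row_free neq_ltn; apply/orP; left.
  exact: leq_ltn_trans (rank_leq_col _) ltJI.
pose em (e : I) : 'X_{1..n.+1} := [multinom (e i : nat) | i < n.+1].
have em_inj : injective em.
  move=> e e' /mnmP ee; apply/ffunP => i; apply/val_inj.
  by have := ee i; rewrite !mnmE.
exists (\sum_a r 0 a *: 'X_[em (enum_val a)]).
  have [a ra] : exists a, r 0 a != 0.
    by case/rV0Pn: r0 => a ra; exists a.
  apply: contraNneq ra => /(congr1 (mcoeff (em (enum_val a)))).
  rewrite mcoeff0 raddf_sum (bigD1 a) //= mcoeffZ mcoeffX eqxx mulr1 big1 ?addr0.
    by move=> ->.
  move=> b ba; rewrite mcoeffZ mcoeffX (inj_eq em_inj) (inj_eq enum_val_inj).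
  by rewrite (negbTE ba) mulr0.
rewrite rmorph_sum /=.
have -> : \sum_a mmap (@mpolyC n K) x (r 0 a *: 'X_[em (enum_val a)]) =
          \sum_a r 0 a *: xm (enum_val a).
  apply: eq_bigr => a _; rewrite mmapZ mul_mpolyC mmapX; congr (_ *: _).
  by apply: eq_bigr => i _; rewrite mnmE.
apply/mpolyP => m; rewrite mcoeff0 raddf_sum /=.
have [/xm0 m_big|m_small] := leqP E (mdeg m).
  by rewrite big1 // => a _; rewrite mcoeffZ m_big mulr0.
have mE i : (m i < E)%N.
  by apply: leq_ltn_trans m_small; rewrite mdegE (bigD1 i) //= leq_addr.
pose b : J := [ffun i => Ordinal (mE i)].
have /rowP /(_ (enum_rank b)) := rB; rewrite mxE [RHS]mxE => rBb; rewrite -[RHS]rBb.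
apply: eq_bigr => a _; rewrite mcoeffZ mxE enum_rankK; congr (_ * _@__).
by apply/mnmP => i; rewrite mnmE ffunE.
Qed.

(** * Adjoining a cube root to a polynomial ring *)

Lemma mpoly_ring_ind (R : nzRingType) n (P : {mpoly R[n]} -> Prop) :
    (forall c, P c%:MP) -> (forall i, P 'X_i) ->
    (forall p q, P p -> P q -> P (p + q)) ->
    (forall p q, P p -> P q -> P (p * q)) ->
  forall p, P p.
Proof.
move=> PC PX PD PM p.
have P1 : P 1 by rewrite -mpolyC1.
have P0 : P 0 by rewrite -(mpolyC0 n R).
rewrite [p]mpolyE; apply: (big_ind P) => // m _.
rewrite -mul_mpolyC; apply: (PM) => //.
rewrite mpolyXE_id; apply: (big_ind P) => // i _.
by elim: (m i) => // k IHk; rewrite exprS; apply: PM.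
Qed.

Lemma muniX_max (R : nzRingType) n : muni 'X_ord_max = 'X :> {poly {mpoly R[n]}}.
Proof.
rewrite muniE msuppX big_seq1 mcoeffX eqxx scale1r -[RHS]scale1r.
rewrite mnm1E eqxx expr1; congr (_ *: _); rewrite -mpolyX0; congr 'X_[_].
by apply/mnmP => i; rewrite mnmE mnm1E mnm0E -val_eqE /= gtn_eqF.
Qed.

Lemma muni_mwiden (R : comNzRingType) n (p : {mpoly R[n]}) : muni (mwiden p) = p%:P.
Proof.
elim/mpoly_ring_ind: p => [c|i|p q IHp IHq|p q IHp IHq].
- by rewrite mwidenC muniC.
- rewrite mwidenX mnmwiden1 muniE msuppX big_seq1 mcoeffX eqxx scale1r.
  rewrite mnm1E -val_eqE /= ltn_eqF // expr0 -mul_polyC mulr1.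
  congr ('X_[_])%:P; apply/mnmP => j.
  by rewrite mnmE !mnm1E -!val_eqE.
- by rewrite mwidenD muniD IHp IHq polyCD.
- by rewrite mwidenM muniM IHp IHq polyCM.
Qed.

Section CubicExtension.
Variables (D : comNzRingType) (g : D).

(** The norm of a + b y + c y^2 over D, where y^3 = g. *)
Definition cubic_norm (a b c : D) := a ^+ 3 + b ^+ 3 * g + c ^+ 3 * g ^+ 2 - 3 * a * b * c * g.

End CubicExtension.

(** Nonzero elements of the extension by a cube root of g have nonzero norm; in
    particular this extension is a domain when D is one. *)
Definition norm_inj (D : comNzRingType) (g : D) :=
  forall a b c : D, cubic_norm g a b c = 0 -> [/\ a = 0, b = 0 & c = 0].

Definition divides (D : comNzRingType) (a b : D) := exists c, b = c * a.

Definition prime_elt (D : comNzRingType) (p : D) :=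
  forall a b, divides p (a * b) -> divides p a \/ divides p b.

Lemma prime_elt_cube (D : comNzRingType) (p a b : D) :
  prime_elt p -> ~ divides p b -> divides p (a ^+ 3 * b) -> divides p a.
Proof.
by move=> pp nb /pp[|//]; rewrite !exprS mulr1 => /pp[//|/pp[]].
Qed.

(** Infinite descent, as for Eisenstein polynomials: a zero of the norm form has all
    its coordinates divisible by p, and dividing by p gives a smaller zero. The
    function mu measures size. *)
Lemma eisenstein_norm_inj (D : idomainType) (p h : D) (mu : D -> nat) :
    p != 0 -> prime_elt p -> ~ divides p h ->
    (forall b : D, b != 0 -> (mu b < mu (b * p)%R)%N) ->
  norm_inj (p * h).
Proof.
move=> p0 pp nh mup a b c.
have cancel_p x : p * x = 0 -> x = 0.
  by move/eqP; rewrite mulf_eq0 (negbTE p0) => /eqP.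
have [n] := ubnP (mu a + mu b + mu c)%N; elim: n a b c => // n IHn a b c.
move=> le_n N0.
have nh2 : ~ divides p (h ^+ 2) by rewrite expr2 => /pp[].
have [a' Ea] : divides p a.
  apply: (@prime_elt_cube _ p a 1) => //.
    by move=> [x x1]; apply: nh; exists (h * x); rewrite -mulrA -x1 mulr1.
  exists (- (b ^+ 3 * h + c ^+ 3 * p * h ^+ 2 - 3 * a * b * c * h)).
  by rewrite -[LHS]subr0 -N0 /cubic_norm; ring.
have [b' Eb] : divides p b.
  apply: (prime_elt_cube pp nh).
  exists (- (p * a' ^+ 3 + c ^+ 3 * h ^+ 2 - 3 * a' * b * c * h)).
  apply/eqP; rewrite -subr_eq0; apply/eqP/cancel_p.
  by rewrite -[RHS]N0 Ea /cubic_norm; ring.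
have [c' Ec] : divides p c.
  apply: (prime_elt_cube pp nh2).
  exists (- (a' ^+ 3 + p * b' ^+ 3 * h - 3 * a' * b' * c * h)).
  apply/eqP; rewrite -subr_eq0; apply/eqP/cancel_p/cancel_p.
  by rewrite -[RHS]N0 Ea Eb /cubic_norm; ring.
have N0' : cubic_norm (p * h) a' b' c' = 0.
  do 3 apply: (cancel_p).
  by rewrite -[RHS]N0 Ea Eb Ec /cubic_norm; ring.
have mu_le x : (mu x <= mu (x * p)%R)%N.
  by have [->|/mup/ltnW//] := eqVneq x 0; rewrite mul0r.
have [[-> -> ->]|nz] := pselect ([/\ a = 0, b = 0 & c = 0]); first by [].
suff [a0 b0 c0] : [/\ a' = 0, b' = 0 & c' = 0] by rewrite Ea Eb Ec a0 b0 c0 !mul0r.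
apply: IHn => //; rewrite -ltnS; apply: leq_trans le_n; rewrite ltnS Ea Eb Ec.
have [a0|/mup lta] := eqVneq a' 0; last first.
  by rewrite -addSn -addSn !leq_add.
have [b0|/mup ltb] := eqVneq b' 0; last first.
  by rewrite -addSn -addnS !leq_add.
have [c0|/mup ltc] := eqVneq c' 0; last first.
  by rewrite -addnS !leq_add.
by case: nz; rewrite Ea Eb Ec a0 b0 c0 !mul0r.
Qed.

Lemma cubic_add_id (R : comNzRingType) (p q a b c a' b' c' y f : R) :
  p * f + (a + b * y + c * y ^+ 2) + (q * f + (a' + b' * y + c' * y ^+ 2)) =
  (p + q) * f + (a + a' + (b + b') * y + (c + c') * y ^+ 2).
Proof. by ring. Qed.

(** Multiplication modulo y^3 = g, with the multiple of y^3 - g made explicit. *)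
Lemma cubic_mul_id (R : comNzRingType) (p q a b c a' b' c' y g : R) :
  let f := y ^+ 3 - g in
  let t := a + b * y + c * y ^+ 2 in let t' := a' + b' * y + c' * y ^+ 2 in
  (p * f + t) * (q * f + t') =
  (p * (q * f + t') + t * q + (c * c' * y + b * c' + c * b')) * f +
  (a * a' + (b * c' + c * b') * g + (a * b' + b * a' + c * c' * g) * y +
   (a * c' + b * b' + c * a') * y ^+ 2).
Proof. by move=> f t t'; rewrite /t /t' /f; ring. Qed.

(** The product of the two other conjugates of a + b y + c y^2. *)
Lemma norm_cofactor_id (R : comNzRingType) (a b c y g : R) :
  (a + b * y + c * y ^+ 2) *
  (a ^+ 2 - g * b * c + (g * c ^+ 2 - a * b) * y + (b ^+ 2 - a * c) * y ^+ 2) =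
  (b * (b ^+ 2 - a * c) + c * (g * c ^+ 2 - a * b) + c * (b ^+ 2 - a * c) * y) *
  (y ^+ 3 - g) + cubic_norm g a b c.
Proof. by rewrite /cubic_norm; ring. Qed.

(** If p q is a multiple of f = y^3 - g, then so is the norm of the remainder of p
    times the remainder of q. *)
Lemma norm_prime_id (R : comNzRingType) (p q s p' q' r f t t' u n : R) :
  p = p' * f + t -> q = q' * f + t' -> p * q = s * f -> t * u = r * f + n ->
  n * t' = (u * (s - p * q' - p' * t') - r * t') * f.
Proof.
move=> Ep Eq Epq Er.
have -> : n = t * u - r * f by rewrite Er; ring.
have -> : t = p - p' * f by rewrite Ep; ring.
have -> : (u * (s - p * q' - p' * t') - r * t') * f =
  u * (s * f - p * (q' * f) - p' * f * t') - r * f * t' by ring.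
by rewrite -Epq Eq; ring.
Qed.

Lemma mwiden_cubic_norm (R : comNzRingType) n (g a b c : {mpoly R[n]}) :
  mwiden (cubic_norm g a b c) =
  cubic_norm (mwiden g) (mwiden a) (mwiden b) (mwiden c).
Proof.
by rewrite /cubic_norm rmorphB !rmorphD !rmorphM rmorph_nat.
Qed.

Lemma poly_trinom_eq0 (D : idomainType) (a b c g : D) (q : {poly D}) :
  a%:P + b%:P * 'X + c%:P * 'X^2 = q * ('X^3 - g%:P) -> [/\ a = 0, b = 0 & c = 0].
Proof.
have coefs j : (a%:P + b%:P * 'X + c%:P * 'X^2)`_j = [:: a; b; c]`_j.
  rewrite !coefD coefMX coefCM coefXn !coefC.
  case: j => [|[|[|j]]] /=; rewrite ?(mulr0, mulr1, addr0, add0r) //.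
  by rewrite nth_nil.
have [->|q0 E] := eqVneq q 0.
  rewrite mul0r => E; split; [have := coefs 0 | have := coefs 1 | have := coefs 2%N];
  by rewrite E coef0.
have : (size (q * ('X^3 - g%:P))%R <= 3)%N.
  by rewrite -E; apply/leq_sizeP => -[|[|[|j]]] // _; rewrite coefs /= nth_nil.
rewrite size_Mmonic ?monicXnsubC // size_XnsubC // addnS /=.
by rewrite -[X in (_ <= X)%N]add0n leq_add2r leqn0 size_poly_eq0 (negbTE q0).
Qed.

Section MonicCubic.
Variables (K : fieldType) (n : nat) (g : {mpoly K[n]}).
Let Y : {mpoly K[n.+1]} := 'X_ord_max.

Definition cubic : {mpoly K[n.+1]} := 'X_ord_max ^+ 3 - mwiden g.

Definition trinom (a b c : {mpoly K[n]}) : {mpoly K[n.+1]} :=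
  mwiden a + mwiden b * 'X_ord_max + mwiden c * 'X_ord_max ^+ 2.

Lemma mpoly_cubic_div p : exists q a b c, p = q * cubic + trinom a b c.
Proof.
elim/mpoly_ring_ind: p => [c|i|p q [p' [a [b [c Ep]]]] [q' [a' [b' [c' Eq]]]]|p q].
- by exists 0, c%:MP, 0, 0; rewrite /trinom mwidenC !mwiden0 !mul0r add0r !addr0.
- elim/ord_maxW: i => [|i].
    by exists 0, 0, 1, 0; rewrite /trinom mwiden1 !mwiden0 !mul0r !add0r addr0 mul1r.
  exists 0, 'X_i, 0, 0.
  by rewrite /trinom mwidenX mnmwiden1 !mwiden0 !mul0r !addr0 add0r.
- exists (p' + q'), (a + a'), (b + b'), (c + c').
  by rewrite Ep Eq /trinom !mwidenD cubic_add_id.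
move=> [p' [a [b [c Ep]]]] [q' [a' [b' [c' Eq]]]].
exists (p' * (q' * cubic + trinom a' b' c') + trinom a b c * q' +
  (mwiden c * mwiden c' * 'X_ord_max + mwiden b * mwiden c' + mwiden c * mwiden b')).
exists (a * a' + (b * c' + c * b') * g), (a * b' + b * a' + c * c' * g).
exists (a * c' + b * b' + c * a').
by rewrite Ep Eq /trinom /cubic !(mwidenD, mwidenM) cubic_mul_id.
Qed.

Lemma muni_cubic : muni cubic = 'X^3 - g%:P.
Proof. by rewrite muniB rmorphXn /= muniX_max muni_mwiden. Qed.

Lemma muni_trinom a b c : muni (trinom a b c) = a%:P + b%:P * 'X + c%:P * 'X^2.
Proof.
by rewrite /trinom !muniD !muniM muniX_max !muni_mwiden.
Qed.

Lemma cubic_neq0 : cubic != 0.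
Proof.
apply/eqP => /(congr1 (@muni _ _)); rewrite muni_cubic muni0.
by move/(congr1 (fun p : {poly _} => size p)); rewrite size_XnsubC // size_poly0.
Qed.

Lemma trinom_cubic_eq0 a b c : divides cubic (trinom a b c) ->
  [/\ a = 0, b = 0 & c = 0].
Proof.
move=> [q /(congr1 (@muni _ _))]; rewrite muni_trinom muniM muni_cubic.
exact: poly_trinom_eq0.
Qed.

Definition norm_cofactor a b c :=
  trinom (a ^+ 2 - g * b * c) (g * c ^+ 2 - a * b) (b ^+ 2 - a * c).

Lemma trinomM_cofactor a b c : exists q,
  trinom a b c * norm_cofactor a b c = q * cubic + mwiden (cubic_norm g a b c).
Proof.
exists (mwiden b * (mwiden b ^+ 2 - mwiden a * mwiden c)
   + mwiden c * (mwiden g * mwiden c ^+ 2 - mwiden a * mwiden b)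
   + mwiden c * (mwiden b ^+ 2 - mwiden a * mwiden c) * 'X_ord_max).
rewrite mwiden_cubic_norm -norm_cofactor_id; congr (_ * _).
have sq x : mwiden (x ^+ 2) = mwiden x ^+ 2 :> {mpoly K[n.+1]} by exact: rmorphXn.
by rewrite /norm_cofactor /trinom !mwidenB !sq !mwidenM.
Qed.

Lemma mwidenM_trinom d a b c :
  mwiden d * trinom a b c = trinom (d * a) (d * b) (d * c).
Proof. by rewrite /trinom !mwidenM !mulrDr !mulrA. Qed.

(** Multiplying by the cofactor replaces the remainder of the first factor by its
    norm, a nonzero element of the base ring; so the remainder of the second factor
    vanishes. *)
Lemma norm_inj_prime : norm_inj g -> prime_elt cubic.
Proof.
move=> g_inj p q [s Epq].
have [p' [a [b [c Ep]]]] := mpoly_cubic_div p.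
have [q' [a' [b' [c' Eq]]]] := mpoly_cubic_div q.
have [N0|N0] := eqVneq (cubic_norm g a b c) 0.
  have [a0 b0 c0] := g_inj _ _ _ N0; left; exists p'.
  by rewrite Ep a0 b0 c0 /trinom !mwiden0 !mul0r !addr0.
right; exists q'; have [r Er] := trinomM_cofactor a b c.
suff [a0 b0 c0] : [/\ a' = 0, b' = 0 & c' = 0].
  by rewrite Eq a0 b0 c0 /trinom !mwiden0 !mul0r !addr0.
set N := cubic_norm _ _ _ _ in N0 Er.
have [] := @trinom_cubic_eq0 (N * a') (N * b') (N * c').
  rewrite -mwidenM_trinom.
  exists (norm_cofactor a b c * (s - p * q' - p' * trinom a' b' c') - r * trinom a' b' c').
  apply: (norm_prime_id Ep Eq Epq Er).
move=> /eqP; rewrite mulf_eq0 (negbTE N0) => /eqP-> /eqP; rewrite mulf_eq0 (negbTE N0).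
by move=> /eqP-> /eqP; rewrite mulf_eq0 (negbTE N0) => /eqP->.
Qed.

End MonicCubic.

(** * The Fermat cubics are prime *)

Section Fermat.
Variables (K : fieldType).
Hypothesis charK : [pchar K] =i pred0.

Lemma natK_neq0 m : (m.+1%:R : K) != 0.
Proof. by rewrite (proj1 (pcharf0P _) charK). Qed.

(** The binary and ternary forms whose cube roots are adjoined successively: Y3^3 =
    g2 defines the Fermat curve, Y4^3 = g3 the Fermat surface. *)
Definition g2 : {mpoly K[2]} := - ('X_ord0 ^+ 3 + 'X_ord_max ^+ 3).
Definition g3 : {mpoly K[3]} :=
  - ('X_(@Ordinal 3 0 isT) ^+ 3 + 'X_(@Ordinal 3 1 isT) ^+ 3 + 'X_(@Ordinal 3 2 isT) ^+ 3).

Lemma cubic_g2 : cubic g2 = - g3.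
Proof.
rewrite /cubic /g2 /g3 !opprK mwidenN opprK mwidenD !rmorphXn /= !mwidenX !mnmwiden1.
rewrite addrC; congr (_ ^+ 3 + _ ^+ 3 + _ ^+ 3); congr 'X__; exact/val_inj.
Qed.

Lemma cubic_g3 : cubic g3 = f4 K.
Proof.
rewrite /cubic /g3 /f4 /Y1 /Y2 /Y3 /Y4 mwidenN opprK !mwidenD !rmorphXn /= !mwidenX !mnmwiden1.
rewrite addrC; congr (_ ^+ 3 + _ ^+ 3 + _ ^+ 3 + _ ^+ 3); congr 'X__; exact/val_inj.
Qed.

Lemma comp_mpolyM n k (s : n.-tuple {mpoly K[k]}) p q :
  (p * q) \mPo s = (p \mPo s) * (q \mPo s).
Proof. exact: rmorphM. Qed.

Lemma mpoly_subst_divides n (p : {mpoly K[n]}) (s : n.-tuple {mpoly K[n]}) q :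
  (forall i, divides p ('X_i - tnth s i)) -> divides p (q - (q \mPo s)).
Proof.
move=> sP; elim/mpoly_ring_ind: q => [c|i|a b [x Ea] [y Eb]|a b [x Ea] [y Eb]].
- by exists 0; rewrite comp_mpolyC subrr mul0r.
- by rewrite comp_mpolyXU -tnth_nth.
- by exists (x + y); rewrite comp_mpolyD mulrDl -Ea -Eb opprD addrACA.
exists (x * b + (a \mPo s) * y); rewrite comp_mpolyM mulrDl -mulrA [b * p]mulrC.
by rewrite mulrA -Ea -[_ * y * p]mulrA -Eb; ring.
Qed.

Definition lin2 : {mpoly K[2]} := 'X_ord0 + 'X_ord_max.

(** The quotient by Y1 + Y2 is a polynomial ring, reached by substituting - Y1 for
    Y2. *)
Lemma lin2_prime : prime_elt lin2.
Proof.
pose s : 2.-tuple {mpoly K[2]} := [tuple 'X_ord0; - 'X_ord0].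
have sP i : divides lin2 ('X_i - tnth s i).
  elim/ord_maxW: i => [|i]; first by exists 1; rewrite mul1r opprK addrC.
  exists 0; rewrite mul0r (tnth_nth 0) /= ord1; apply/eqP; rewrite subr_eq0 /=.
  by apply/eqP; congr 'X__; apply/val_inj.
have slin2 : lin2 \mPo s = 0 by rewrite comp_mpolyD !comp_mpolyXU /= subrr.
move=> a b [q Eab].
have : (a \mPo s) * (b \mPo s) = 0 by rewrite -comp_mpolyM Eab comp_mpolyM slin2 mulr0.
move/eqP; rewrite mulf_eq0 => /orP[]/eqP E0; [left|right].
  by have := mpoly_subst_divides a sP; rewrite E0 subr0.
by have := mpoly_subst_divides b sP; rewrite E0 subr0.
Qed.

Lemma msize_mul_lt n (b p : {mpoly K[n]}) : (1 < msize p)%N -> b != 0 ->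
  (msize b < msize (b * p)%R)%N.
Proof.
move=> p1 b0; rewrite msizeM //; last by apply: contraTneq p1 => ->; rewrite msize0.
by move: p1; case: (msize p) => [|[|k]] // _; rewrite !addnS /= ltnS leq_addr.
Qed.

Lemma lin2_neq0 : lin2 != 0.
Proof.
apply/eqP => /(congr1 (mcoeff U_(ord0)%MM)); rewrite mcoeffD !mcoeffXU mcoeff0 /=.
by move/eqP; rewrite addr0 oner_eq0.
Qed.

Lemma msize_lin2 : (1 < msize lin2)%N.
Proof.
rewrite ltnNge; apply/negP => /msize1_polyC => E.
move: (congr1 (mcoeff U_(ord0)%MM) E); rewrite mcoeffD !mcoeffXU mcoeffC /=.
have -> : (U_(ord0)%MM == 0%MM :> 'X_{1..2}) = false.
  by apply/eqP => /mnmP /(_ ord0); rewrite mnm1E mnm0E.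
by rewrite mulr0 addr0 => /eqP; rewrite oner_eq0.
Qed.

Definition quo2 : {mpoly K[2]} := - ('X_ord0 ^+ 2 - 'X_ord0 * 'X_ord_max + 'X_ord_max ^+ 2).

Lemma lin2_ndvd_quo2 : ~ divides lin2 quo2.
Proof.
move=> [q] /(congr1 (meval (fun i : 'I_2 => if i == ord0 then 1 else -1))).
rewrite mevalM mevalN mevalD mevalB !rmorphXn !mevalM /= mevalD !mevalXU /= subrr mulr0.
have -> : - (1 ^+ 2 - 1 * -1 + (-1) ^+ 2) = - 3%:R :> K by ring.
by move/eqP; rewrite oppr_eq0 (negbTE (natK_neq0 2)).
Qed.

(** Eisenstein at the prime Y1 + Y2, which divides g2 exactly once because 3 is
    invertible. *)
Lemma norm_inj_g2 : norm_inj g2.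
Proof.
have -> : g2 = lin2 * quo2 by rewrite /g2 /lin2 /quo2; ring.
apply: (eisenstein_norm_inj (mu := fun p => msize p) lin2_neq0 lin2_prime lin2_ndvd_quo2).
by move=> b; apply/msize_mul_lt/msize_lin2.
Qed.

(** Eisenstein at the prime cubic g2, which equals - g3. *)
Lemma norm_inj_g3 : norm_inj g3.
Proof.
have -> : g3 = cubic g2 * -1 by rewrite cubic_g2 mulrN1 opprK.
have p_pr := norm_inj_prime norm_inj_g2.
apply: (eisenstein_norm_inj (mu := fun p => msize p) (cubic_neq0 g2) p_pr).
  move=> [q Eq]; have [] := @trinom_cubic_eq0 _ _ g2 (-1) 0 0.
    by exists q; rewrite -Eq /trinom mwidenN mwiden1 !mwiden0 !mul0r !addr0.
  by move/eqP; rewrite oppr_eq0 oner_eq0.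
move=> b; apply: msize_mul_lt; rewrite ltnNge; apply/negP => /msize1_polyC E.
have : muni (cubic g2) = muni ((cubic g2)@_0)%:MP by rewrite -E.
rewrite muni_cubic muniC => /(congr1 (fun p : {poly _} => size p)).
by rewrite size_XnsubC // size_polyC; case: (_ == _).
Qed.

Lemma f4_prime : prime_elt (f4 K).
Proof. by rewrite -cubic_g3; apply/norm_inj_prime/norm_inj_g3. Qed.

End Fermat.

(** * The hypersurface ring over the polynomials in three variables *)

Section R4pi.
Variable K : fieldType.

Lemma R4_pi_zmod_morphism : zmod_morphism (@R4_pi K).
Proof.
by move=> p q; apply: (addIr (R4_pi q)); rewrite -R4_piD !subrK.
Qed.
HB.instance Definition _ :=
  GRing.isZmodMorphism.Build (S4 K) (R4 K) (@R4_pi K) R4_pi_zmod_morphism.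

Lemma R4_pi_monoid_morphism : monoid_morphism (@R4_pi K).
Proof. by split; [exact: R4_pi1 | exact: R4_piM]. Qed.
HB.instance Definition _ :=
  GRing.isMonoidMorphism.Build (S4 K) (R4 K) (@R4_pi K) R4_pi_monoid_morphism.

Definition emb3 (a : {mpoly K[3]}) : R4 K := R4_pi (mwiden a).

HB.instance Definition _ := GRing.RMorphism.copy emb3 (@R4_pi K \o @mwiden 3 K).

Definition y4 : R4 K := R4_pi (Y4 K).

Lemma R4_pi_eq0 (p : {mpoly K[4]}) : R4_pi p = 0 <-> divides (f4 K) p.
Proof.
rewrite -(rmorph0 (@R4_pi K)) R4_piE; split=> -[q pq]; exists q.
  by rewrite -pq subr0.
by rewrite [RHS]/= -pq subr0.
Qed.
End R4pi.

Section R4basis.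
Variable K : fieldType.
Hypothesis charK : [pchar K] =i pred0.

Lemma Y4E : Y4 K = 'X_ord_max.
Proof. by congr 'X__; apply/val_inj. Qed.

Lemma R4_pi_trinom (a b c : {mpoly K[3]}) :
  R4_pi (trinom a b c) = emb3 a + emb3 b * y4 K + emb3 c * y4 K ^+ 2.
Proof. by rewrite /trinom !R4_piD !R4_piM /y4 Y4E. Qed.

Lemma R4_span (r : R4 K) : exists a b c,
  r = emb3 a + emb3 b * y4 K + emb3 c * y4 K ^+ 2.
Proof.
have [q [a [b [c E]]]] := mpoly_cubic_div (g3 K) (repr r).
exists a, b, c; rewrite -R4_pi_trinom -[LHS]R4_piK; apply/R4_piE.
by exists q; rewrite E cubic_g3 addrK.
Qed.

Lemma y4_cube : y4 K ^+ 3 = emb3 (g3 K).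
Proof.
rewrite /y4 /emb3 -[LHS](rmorphXn (@R4_pi K)) Y4E; apply/R4_piE; exists 1.
by rewrite mul1r -cubic_g3.
Qed.

(** Denominators of the fraction field of R4 can be taken in K[Y1, Y2, Y3]. *)
Lemma R4_norm (r : R4 K) : r != 0 ->
  exists r' a, a != 0 /\ r * r' = emb3 a.
Proof.
have [a [b [c ->]]] := R4_span r => abc0.
have [q Eq] := trinomM_cofactor (g3 K) a b c.
exists (R4_pi (norm_cofactor (g3 K) a b c)), (cubic_norm (g3 K) a b c); split.
  apply: contraNneq abc0 => /(norm_inj_g3 charK)[-> -> ->].
  by rewrite !rmorph0 !mul0r !addr0.
rewrite -R4_pi_trinom -R4_piM Eq cubic_g3 rmorphD rmorphM /=.
have -> : R4_pi (f4 K) = 0 by apply/R4_pi_eq0; exists 1; rewrite mul1r.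
by rewrite mulr0 add0r.
Qed.

Lemma R4_mulf_eq0 (r s : R4 K) : r * s = 0 -> r = 0 \/ s = 0.
Proof.
rewrite -[r]R4_piK -[s]R4_piK -R4_piM !R4_pi_eq0; exact: f4_prime.
Qed.

End R4basis.

(** * Krull dimension of the hypersurface ring *)

Lemma collapse_rmorph (R S : comNzRingType) (f : {rmorphism R -> S})
    (ok : R -> Prop) (ok' : S -> Prop) s r :
  (forall x, ok x -> ok' (f x)) -> collapse ok s r -> collapse ok' (map f s) (f r).
Proof.
move=> okf; elim: s r => [|x s IHs] r /=; first exact: okf.
move=> [m [a [r' [/IHs cr' ->]]]]; exists m, (f a), (f r'); split=> //.
by rewrite rmorphM rmorphD rmorphM rmorphXn.
Qed.

(** Packs a predicate as a prime ideal, so that primes can be given as kernels of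
    substitutions. *)
Lemma exists_prime_idealr (R : comNzRingType) (S : {pred R}) :
    idealr_closed S -> prime_idealr_closed S ->
  exists P : prime_idealr R, forall x, (x \in P) = (x \in S).
Proof.
move=> Sid Spr.
pose i := isIdealr.Build R S Sid.
pose p := isPrimeIdealrClosed.Build R S Spr.
by exists (HB.pack_for (prime_idealr R) S i p).
Qed.

Lemma comp_mpoly_subst (K : fieldType) n k l (s : n.-tuple {mpoly K[k]})
    (s' : n.-tuple {mpoly K[l]}) (t : k.-tuple {mpoly K[l]}) p :
  (forall i, tnth s' i = tnth s i \mPo t) -> p \mPo s' = (p \mPo s) \mPo t.
Proof.
move=> st; elim/mpoly_ring_ind: p => [c|i|p q IHp IHq|p q IHp IHq].
- by rewrite !comp_mpolyC.
- by rewrite !comp_mpolyXU -!tnth_nth.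
- by rewrite !comp_mpolyD IHp IHq.
- by rewrite !comp_mpolyM IHp IHq.
Qed.

Section R4dim.
Variable K : fieldType.
Hypothesis charK : [pchar K] =i pred0.

Definition R4_nz_scalar (r : R4 K) := exists2 c : K, c != 0 & r = R4_pi c%:MP.

(** Five elements of K[Y1, ..., Y4], namely f4 and four others, are algebraically
    dependent; a power of f4 can be cancelled from the resulting identity, which is
    then read modulo f4. *)
Lemma R4_collapse (x0 x1 x2 x3 : R4 K) :
  collapse R4_nz_scalar [:: x0; x1; x2; x3] 0.
Proof.
pose s : seq {mpoly K[4]} := [:: repr x0; repr x1; repr x2; repr x3].
pose s5 : seq {mpoly K[4]} := f4 K :: s.
have [Q Q0 EQ] := @mpoly_alg_dependent K 4 (fun i => (rev s5)`_i).
have := @collapse_mmap K {mpoly K[4]} (@mpolyC 4 K) s5 Q Q0.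
rewrite EQ => -[m [a [r' [cr']]]].
have f0 : f4 K != 0 by rewrite -(cubic_g3 K) cubic_neq0.
move=> /esym/eqP; rewrite mulf_eq0 expf_eq0 (negbTE f0) andbF orFb addr_eq0 => /eqP Er'.
have -> : 0 = R4_pi r' by apply/esym/R4_pi_eq0; exists (- a); rewrite mulNr.
have -> : [:: x0; x1; x2; x3] = map (@R4_pi K) s by rewrite /= !R4_piK.
have okf (x : S4 K) : (exists2 c : K, c != 0 & x = c%:MP) -> R4_nz_scalar (R4_pi x).
  by move=> [c c0 ->]; exists c.
exact: (@collapse_rmorph (S4 K) (R4 K) (@R4_pi K) _ _ s r' okf cr').
Qed.

(** At each step x_i is outside P_i and inside P_(i+1), so it can be cancelled modulo
    P_i and then dropped modulo P_(i+1). *)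
Lemma prime_chain_collapse (ok : R4 K -> Prop) s r (P : nat -> prime_idealr (R4 K)) :
    prime_chain (size s) P ->
    (forall i, (i < size s)%N -> s`_i \in P i.+1 /\ s`_i \notin P i) ->
    collapse ok s r -> r \in P 0 ->
  exists2 c, ok c & c \in P (size s).
Proof.
elim: s r P => [|x s IHs] r P chP sP /=; first by move=> okr rP; exists r.
move=> [m [a [r' [cr' ->]]]].
have [/= xP1 xP0] := sP 0 isT.
have cancel_x k z : x ^+ k * z \in P 0 -> z \in P 0.
  elim: k => [|k IHk]; first by rewrite mul1r.
  by rewrite exprS -mulrA prime_idealrM (negbTE xP0) => /IHk.
move=> /cancel_x /(proj1 (chP 0 isT)) r'P1.
apply: (IHs r' (fun i => P i.+1)) => //.
- by move=> i lti; apply: (chP i.+1).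
- by move=> i lti; apply: (sP i.+1).
by rewrite -(addrK (a * x) r') rpredB // idealMr.
Qed.

Lemma krull_dim_le3 k P : @prime_chain (R4 K) k P -> (k <= 3)%N.
Proof.
move=> chP; rewrite leqNgt; apply/negP => k4.
have ex i : exists x, (i < 4)%N -> x \in P i.+1 /\ x \notin P i.
  (* Beyond the fourth step the value is arbitrary. *)
  have [i4|] := ltnP i 4; last by exists 0.
  have [_ [x xP xN]] := chP i (leq_trans i4 k4).
  by exists x.
have [x xP] := choice ex.
have [] := @prime_chain_collapse R4_nz_scalar [:: x 0; x 1; x 2%N; x 3%N] 0 P.
- by move=> i i4; apply: chP; apply: leq_trans k4.
- by move=> [|[|[|[|i]]]] // _; apply: xP.
- exact: R4_collapse.
- exact: rpred0.
move=> c [u u0 ->] uP.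
have : (R4_pi (u^-1)%:MP * R4_pi u%:MP) \in P 4 by rewrite idealMr.
rewrite -R4_piM -mpolyCM mulVf // R4_pi1.
by rewrite idealr1.
Qed.

Section Substitution.
Variable s : 4.-tuple {mpoly K[4]}.
Hypothesis s_f4 : f4 K \mPo s = 0.

Definition R4_subst_ker : {pred R4 K} := [pred r | (repr r : {mpoly K[4]}) \mPo s == 0].

Lemma R4_subst_kerE (p : {mpoly K[4]}) : (R4_pi p \in R4_subst_ker) = (p \mPo s == 0).
Proof.
rewrite inE; have /R4_piE[q Eq] := R4_piK (R4_pi p).
rewrite -[repr _](subrK p) [X in X + p]Eq comp_mpolyD comp_mpolyM.
by rewrite s_f4 mulr0 add0r.
Qed.

(** The ideal of a subvariety that is parametrized by polynomials. *)
Lemma R4_subst_prime : exists P : prime_idealr (R4 K),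
  forall p : {mpoly K[4]}, (R4_pi p \in P) = (p \mPo s == 0).
Proof.
have [||P PE] := @exists_prime_idealr (R4 K) R4_subst_ker.
- split; first by rewrite -(rmorph0 (@R4_pi K)) R4_subst_kerE comp_mpoly0.
    by rewrite -R4_pi1 R4_subst_kerE comp_mpoly1 oner_eq0.
  move=> a u v; rewrite -[a]R4_piK -[u]R4_piK -[v]R4_piK -R4_piM -R4_piD !R4_subst_kerE.
  by rewrite comp_mpolyD comp_mpolyM => /eqP-> /eqP->; rewrite mulr0 addr0.
- move=> u v; rewrite -[u]R4_piK -[v]R4_piK -R4_piM !R4_subst_kerE comp_mpolyM.
  by rewrite mulf_eq0.
by exists P => p; rewrite PE R4_subst_kerE.
Qed.
End Substitution.

Lemma R4_zero_prime : exists P : prime_idealr (R4 K), forall r, (r \in P) = (r == 0).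
Proof.
apply: (@exists_prime_idealr (R4 K) [pred r | r == 0]).
  split; rewrite ?inE ?oner_eq0 // => a u v; rewrite !inE => /eqP-> /eqP->.
  by rewrite mulr0 addr0.
move=> u v; rewrite !inE => /eqP /(R4_mulf_eq0 charK)[->|->]; by rewrite eqxx ?orbT.
Qed.

(** A chain of length three: zero, the line Y1 + Y2 = Y3 + Y4 = 0 of the surface, one
    of its points, and the irrelevant ideal. *)
Lemma R4_krull_dim : has_krull_dim (R4 K) 3.
Proof.
split; last exact: krull_dim_le3.
pose X0 : {mpoly K[4]} := 'X_ord0.
pose X2 : {mpoly K[4]} := 'X_(@Ordinal 4 2 isT).
have f4s s : (f4 K) \mPo s = s`_0 ^+ 3 + s`_1 ^+ 3 + s`_2 ^+ 3 + s`_3 ^+ 3.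
  by rewrite /f4 !comp_mpolyD !exprS !expr0 !mulr1 !comp_mpolyM !comp_mpolyXU.
have [P0 P0E] := R4_zero_prime.
have [|P1 P1E] := @R4_subst_prime [tuple X0; - X0; X2; - X2].
  by rewrite f4s /=; ring.
have [|P2 P2E] := @R4_subst_prime [tuple X0; - X0; 0; 0].
  by rewrite f4s /=; ring.
have [|P3 P3E] := @R4_subst_prime [tuple 0; 0; 0; 0].
  by rewrite f4s /=; ring.
have subP (P Q : prime_idealr (R4 K)) (s s' t : 4.-tuple {mpoly K[4]}) :
    (forall p : {mpoly K[4]}, (R4_pi p \in P) = (p \mPo s == 0)) ->
    (forall p : {mpoly K[4]}, (R4_pi p \in Q) = (p \mPo s' == 0)) ->
    (forall i, tnth s' i = tnth s i \mPo t) -> forall x, x \in P -> x \in Q.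
  move=> PE QE st x; rewrite -[x]R4_piK PE QE => /eqP E.
  by rewrite (comp_mpoly_subst _ st) E comp_mpoly0.
exists (fun i => nth P0 [:: P0; P1; P2; P3] i) => -[|[|[|i]]] //= _.
- split=> [x|]; first by rewrite P0E => /eqP->; exact: rpred0.
  exists (R4_pi (X0 + 'X_(@Ordinal 4 1 isT))).
    by rewrite P1E comp_mpolyD !comp_mpolyXU /= subrr.
  rewrite P0E; apply/eqP => /R4_pi_eq0 [q].
  move=> /(congr1 (meval (fun i : 'I_4 => if i == ord0 then 1 else
     if i == 2%N :> nat then -1 else 0))).
  rewrite mevalM /f4 !mevalD !rmorphXn /= !mevalXU /=.
  rewrite !expr0n /= expr1n !addr0 -signr_odd /= expr1 subrr mulr0.
  by move/eqP; rewrite oner_eq0.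
- split.
    apply: (subP _ _ _ _ [tuple X0; 0; 0; 0] P1E P2E) => i.
    rewrite !(tnth_nth 0); case: i => -[|[|[|[|//]]]] _ /=;
    by rewrite ?comp_mpolyN ?comp_mpolyXU /= ?oppr0.
  exists (R4_pi X2).
    by rewrite P2E !comp_mpolyXU.
  by rewrite P1E comp_mpolyXU -msize_poly_eq0 msizeX.
split.
  apply: (subP _ _ _ _ [tuple 0; 0; 0; 0] P2E P3E) => i.
  rewrite !(tnth_nth 0); case: i => -[|[|[|[|//]]]] _ /=;
  by rewrite ?comp_mpolyN ?comp_mpolyXU ?comp_mpoly0 /= ?oppr0.
exists (R4_pi X0).
  by rewrite P3E !comp_mpolyXU.
by rewrite P2E comp_mpolyXU -msize_poly_eq0 msizeX.
Qed.

End R4dim.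

(** * Regular sequences *)

Section IdealMul.
Variables (R : comNzRingType) (M : lmodType R).
Implicit Types (s : seq R) (m n : M).

Lemma in_ideal_mul0 s : in_ideal_mul s (0 : M).
Proof. by exists (fun=> 0); rewrite big1 // => i _; rewrite scaler0. Qed.

Lemma in_ideal_mulZ s r m : in_ideal_mul s m -> in_ideal_mul s (r *: m).
Proof.
move=> [u ->]; exists (fun i => r *: u i); rewrite scaler_sumr.
by apply: eq_bigr => i _; rewrite !scalerA mulrC.
Qed.

Lemma in_ideal_mul_nil m : in_ideal_mul [::] m <-> m = 0.
Proof. by split=> [[u ->]|->]; [rewrite big_ord0 | exact: in_ideal_mul0]. Qed.

(** The ideal (s, x) M is handled through its last generator, so that statements on
    regular sequences are proved by induction. *)
Lemma in_ideal_mul_rcons s x m :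
  in_ideal_mul (rcons s x) m <-> exists n u, in_ideal_mul s n /\ m = n + x *: u.
Proof.
split.
  move=> [u Em]; move: u Em; rewrite size_rcons => u ->.
  rewrite big_ord_recr /= nth_rcons ltnn eqxx.
  eexists; exists (u ord_max); split; last by congr (_ + _).
  exists (fun i => u (widen_ord (leqnSn _) i)); apply: eq_bigr => i _.
  by rewrite nth_rcons /= ltn_ord.
move=> [n [u [[v ->] ->]]].
suff : exists w : 'I_(size s).+1 -> M, \sum_(i < size s) s`_i *: v i + x *: u =
    \sum_(i < (size s).+1) (rcons s x)`_i *: w i.
  by rewrite /in_ideal_mul size_rcons.
exists (fun i => if unlift ord_max i is Some j then v j else u).
rewrite big_ord_recr /= unlift_none nth_rcons ltnn eqxx; congr (_ + _).
apply: eq_bigr => i _; rewrite nth_rcons /= ltn_ord.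
have -> : widen_ord (leqnSn (size s)) i = lift ord_max i.
  by apply/val_inj; rewrite /= /bump leqNgt ltn_ord.
by rewrite liftK.
Qed.

Lemma in_ideal_mul_catl s t m : in_ideal_mul s m -> in_ideal_mul (s ++ t) m.
Proof.
elim/last_ind: t => [|t x IHt] ms; first by rewrite cats0.
rewrite -rcons_cat; apply/in_ideal_mul_rcons; exists m, 0.
by rewrite scaler0 addr0; split=> //; apply: IHt.
Qed.

Lemma in_ideal_mul_takeS s i m : (i < size s)%N ->
  in_ideal_mul (take i.+1 s) m <->
  exists n u, in_ideal_mul (take i s) n /\ m = n + s`_i *: u.
Proof. by move=> i_s; rewrite (take_nth 0) // in_ideal_mul_rcons. Qed.

(** The analogue for regular sequences of prime_chain_collapse: an element of the
    sequence can be cancelled modulo its predecessors. *)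
Lemma regular_seq_collapse (ok : R -> Prop) s k (t : seq R) r m :
    regular_seq M s -> (k + size t <= size s)%N ->
    (forall i, (i < size t)%N -> t`_i = s`_(k + i)) ->
    collapse ok t r -> in_ideal_mul (take k s) (r *: m) ->
  exists2 c, ok c & in_ideal_mul (take (k + size t) s) (c *: m).
Proof.
move=> [reg_s _].
elim: t k r => [|x t IHt] k r; first by rewrite addn0 => _ _ okr; exists r.
rewrite /= addnS => kt ts [a [b [r' [cr' ->]]]].
have k_s : (k < size s)%N by apply: leq_ltn_trans kt; apply: leq_addr.
have xE : x = s`_k by rewrite -[k]addn0 -ts.
have cancel_x z : in_ideal_mul (take k s) ((x ^+ a * z) *: m) ->
    in_ideal_mul (take k s) (z *: m).
  elim: a => [|a IHa]; first by rewrite mul1r.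
  by rewrite exprS -mulrA -scalerA {1}xE => /(reg_s _ k_s)/IHa.
move=> /cancel_x km; rewrite -addSn; apply: (IHt _ r'); rewrite ?addSn //.
  by move=> i it; rewrite addSn -addnS -ts.
apply/in_ideal_mul_takeS => //; exists ((r' + b * x) *: m), (- b *: m); split=> //.
by rewrite scalerDl scalerA -xE mulrN scaleNr [x * b]mulrC addrK.
Qed.

End IdealMul.

Lemma ord3_ind (P : 'I_3 -> Prop) :
    P (@Ordinal 3 0 isT) -> P (@Ordinal 3 1 isT) -> P (@Ordinal 3 2 isT) ->
  forall i, P i.
Proof.
move=> P0 P1 P2 [[|[|[|//]]] lti].
- by have -> : Ordinal lti = @Ordinal 3 0 isT by apply/val_inj.
- by have -> : Ordinal lti = @Ordinal 3 1 isT by apply/val_inj.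
- by have -> : Ordinal lti = @Ordinal 3 2 isT by apply/val_inj.
Qed.

(** * Koszul homology of three elements *)

Section Koszul.
Variables (R : comNzRingType) (M : lmodType R) (y : 'I_3 -> R) (s1 s2 s3 : R).
Definition N1 (m : M) := exists u, m = s1 *: u.
Definition N2 (m : M) := exists n u, N1 n /\ m = n + s2 *: u.

Definition cube_in (x : R) := exists r : 'I_3 -> R, x ^+ 3 = \sum_j r j * y j.
Hypotheses (s1y : cube_in s1) (s2y : cube_in s2) (s3y : cube_in s3).
Hypotheses (reg1 : forall m : M, s1 *: m = 0 -> m = 0)
           (reg2 : forall m, N1 (s2 *: m) -> N1 m)
           (reg3 : forall m, N2 (s3 *: m) -> N2 m).

Let N1_0 : N1 0. Proof. by exists 0; rewrite scaler0. Qed.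
Let N1D m n : N1 m -> N1 n -> N1 (m + n).
Proof. by move=> [u ->] [v ->]; exists (u + v); rewrite scalerDr. Qed.
Let N1Z r m : N1 m -> N1 (r *: m).
Proof. by move=> [u ->]; exists (r *: u); rewrite !scalerA mulrC. Qed.
Let N1_sum (I : finType) (F : I -> M) : (forall i, N1 (F i)) -> N1 (\sum_i F i).
Proof. by move=> NF; apply: (big_ind N1). Qed.
Let N2_0 : N2 0. Proof. by exists 0, 0; rewrite scaler0 addr0. Qed.
Let N2D m n : N2 m -> N2 n -> N2 (m + n).
Proof.
move=> [u [v [Nu ->]]] [u' [v' [Nu' ->]]]; exists (u + u'), (v + v').
by split; [exact: N1D | rewrite scalerDr addrACA].
Qed.
Let N2Z r m : N2 m -> N2 (r *: m).
Proof.
move=> [u [v [Nu ->]]]; exists (r *: u), (r *: v); split; first exact: N1Z.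
by rewrite scalerDr !scalerA mulrC.
Qed.

(** H3 of M / (s1, s2) M vanishes: an element killed by all y_j is killed by a power
    of s3. *)
Lemma koszul_H3 m : (forall j, N2 (y j *: m)) -> N2 m.
Proof.
move=> ym; have : N2 (s3 ^+ 3 *: m).
  have [r ->] := s3y; rewrite scaler_suml; apply: (big_ind N2) => // j _.
  by rewrite -scalerA; apply: N2Z.
by rewrite !exprS mulr1 -!scalerA => /reg3/reg3/reg3.
Qed.

(** H2 of M / s1 M vanishes. Since s2^3 lies in (y), it annihilates the Koszul
    homology of M / s1 M, and by koszul_H3 a cycle is a boundary as soon as its
    multiple by s2 is one. *)
Lemma koszul_H2 (u : 'I_3 -> M) :
    (forall i j, N1 (y i *: u j - y j *: u i)) ->
  exists m, forall i, N1 (u i - y i *: m).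
Proof.
move=> uP.
have inj (v : 'I_3 -> M) : (exists m, forall i, N1 (s2 *: v i - y i *: m)) ->
    exists m, forall i, N1 (v i - y i *: m).
  move=> [m mP]; have [n [m' [Nn Em]]] : N2 m.
    apply: koszul_H3 => j; exists (- (s2 *: v j - y j *: m)), (v j); split.
      by rewrite -scaleN1r; apply: N1Z.
    by rewrite opprB subrK.
  exists m' => i; apply: reg2.
  have -> : s2 *: (v i - y i *: m') = s2 *: v i - y i *: m + y i *: n.
    rewrite scalerBr Em [y i *: (_ + _)]scalerDr opprD addrA [RHS]addrAC subrK.
    by rewrite !scalerA mulrC.
  by apply: N1D => //; apply: N1Z.
apply/inj/inj/inj; have [r Er] := s2y; exists (\sum_j r j *: u j) => i.
rewrite !scalerA -expr2 -exprSr Er scaler_suml scaler_sumr -sumrB.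
apply: N1_sum => j; rewrite -scalerA [y i *: _]scalerA [y i * _]mulrC -scalerA -scalerBr.
exact: N1Z.
Qed.

Let o0 := @Ordinal 3 0 isT.
Let o1 := @Ordinal 3 1 isT.
Let o2 := @Ordinal 3 2 isT.

(** u is the cross product of y and w. *)
Definition koszul_boundary (u : 'I_3 -> M) := exists w : 'I_3 -> M,
  [/\ u o0 = y o1 *: w o2 - y o2 *: w o1,
      u o1 = y o2 *: w o0 - y o0 *: w o2
    & u o2 = y o0 *: w o1 - y o1 *: w o0].

Let boundary_inj (v : 'I_3 -> M) :
  koszul_boundary (fun i => s1 *: v i) -> koszul_boundary v.
Proof.
move=> [w [w0 w1 w2]]; have [m mP] : exists m, forall i, N1 (w i - y i *: m).
  apply: koszul_H2.
  have N1s a b : N1 (a - b) -> N1 (b - a).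
    by move=> /(N1Z (-1)); rewrite scaleN1r opprB.
  have n0 : N1 (y o1 *: w o2 - y o2 *: w o1) by rewrite -w0; exists (v o0).
  have n1 : N1 (y o2 *: w o0 - y o0 *: w o2) by rewrite -w1; exists (v o1).
  have n2 : N1 (y o0 *: w o1 - y o1 *: w o0) by rewrite -w2; exists (v o2).
  by apply: ord3_ind; apply: ord3_ind; rewrite ?subrr //; apply: N1s.
have [w' w'P] := choice mP.
have wE k : w k = y k *: m + s1 *: w' k by rewrite -w'P addrC subrK.
have s1_inj (a b : M) : s1 *: a = s1 *: b -> a = b.
  by move=> ab; apply/subr0_eq/reg1; rewrite scalerBr ab subrr.
have cross_shift a b p q :
    a *: (b *: m + s1 *: q) - b *: (a *: m + s1 *: p) = s1 *: (a *: q - b *: p).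
  rewrite !scalerDr !scalerA [b * a]mulrC opprD addrACA subrr add0r.
  by rewrite scalerN !scalerA ![s1 * _]mulrC.
by exists w'; split; apply: s1_inj; rewrite ?w0 ?w1 ?w2 !wE cross_shift.
Qed.

(** The same descent once more: s1^3 annihilates the homology because it lies in (y),
    and s1 can be cancelled by koszul_H2. *)
Lemma koszul_H1 (u : 'I_3 -> M) : \sum_i y i *: u i = 0 -> koszul_boundary u.
Proof.
rewrite !big_ord_recl big_ord0 addr0.
have -> : lift ord0 (lift ord0 ord0) = o2 :> 'I_3 by apply/val_inj.
have -> : lift ord0 ord0 = o1 :> 'I_3 by apply/val_inj.
have -> : ord0 = o0 :> 'I_3 by apply/val_inj.
move=> uP.
have [r Er] := s1y; do 3 apply: boundary_inj.
have bd j : koszul_boundary (fun i => y j *: u i).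
  elim/ord3_ind: j.
  - exists (fun i => if i == o1 then u o2 else if i == o2 then - u o1 else 0); split=> /=.
    + by rewrite scalerN; apply/eqP; rewrite -subr_eq0 opprD !opprK uP.
    + by rewrite scaler0 scalerN opprK add0r.
    + by rewrite scaler0 subr0.
  - exists (fun i => if i == o2 then u o0 else if i == o0 then - u o2 else 0); split=> /=.
    + by rewrite scaler0 subr0.
    + rewrite scalerN; apply/eqP; rewrite -subr_eq0 opprD !opprK.
      by rewrite addrA addrC uP.
    + by rewrite scaler0 scalerN opprK add0r.
  - exists (fun i => if i == o0 then u o1 else if i == o1 then - u o0 else 0); split=> /=.
    + by rewrite scaler0 scalerN opprK add0r.
    + by rewrite scaler0 subr0.
    + rewrite scalerN; apply/eqP; rewrite -subr_eq0 opprD !opprK.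
      by rewrite addrC -addrA uP.
have [w wP] := choice bd.
exists (fun k => \sum_j r j *: w j k).
have Es (a : M) : s1 *: (s1 *: (s1 *: a)) = \sum_j r j *: (y j *: a).
  rewrite !scalerA -expr2 -exprSr Er scaler_suml.
  by apply: eq_bigr => j _; rewrite scalerA.
have Ec a b k l : a *: (\sum_j r j *: w j k) - b *: (\sum_j r j *: w j l) =
    \sum_j r j *: (a *: w j k - b *: w j l).
  rewrite !scaler_sumr -sumrB; apply: eq_bigr => j _.
  by rewrite scalerBr !scalerA ![r j * _]mulrC.
by split; rewrite Es Ec; apply: eq_bigr => j _; case: (wP j) => *; congr (_ *: _).
Qed.
End Koszul.

(** * Depth of modules over the hypersurface ring *)

Section R4depth.
Variable K : fieldType.
Hypothesis charK : [pchar K] =i pred0.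
Variable M : lmodType (R4 K).

(** By R4_collapse a nonzero constant would belong to the ideal of four elements. *)
Lemma R4_regular_size_le3 (s : seq (R4 K)) : regular_seq M s -> (size s <= 3)%N.
Proof.
move=> reg_s; rewrite leqNgt; apply/negP => s4.
have [m mN] := reg_s.2; apply: mN.
have [||||c [u u0 ->] cm] := @regular_seq_collapse (R4 K) M (@R4_nz_scalar K) s 0
  [:: s`_0; s`_1; s`_2; s`_3] 0 m reg_s => //.
- by case=> [|[|[|[|i]]]].
- exact: R4_collapse.
- by rewrite take0 scale0r; apply: in_ideal_mul0.
rewrite -[s](cat_take_drop 4); apply: in_ideal_mul_catl.
have -> : m = R4_pi (u^-1)%:MP *: (R4_pi u%:MP *: m).
  by rewrite scalerA -R4_piM -mpolyCM mulVf // R4_pi1 scale1r.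
exact: in_ideal_mulZ.
Qed.

(** The images of Y1, Y2, Y3: a system of parameters of R4, but not a generating
    family of its irrelevant ideal. *)
Definition yv (i : 'I_3) : R4 K := emb3 'X_i.

Lemma emb3_g3 : emb3 (g3 K) = - \sum_j yv j ^+ 3.
Proof.
rewrite /g3 rmorphN !rmorphD !rmorphXn /= !big_ord_recl big_ord0 addr0 addrA.
congr (- (_ ^+ 3 + _ ^+ 3 + _ ^+ 3)); congr (emb3 'X__); exact/val_inj.
Qed.

Lemma cube_sum_split (R : comNzRingType) (a b : R) :
  (a + b) ^+ 3 = (a ^+ 2 + 3 * a * b + 3 * b ^+ 2) * a + b ^+ 3.
Proof. by ring. Qed.

(** Modulo Y1, Y2, Y3 the irrelevant ideal is generated by y4, and y4^3 = g3 lies in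
    (Y1, Y2, Y3). *)
Lemma irrelevant_cube (x : R4 K) : R4_irrelevant x -> cube_in yv x.
Proof.
move=> [c ->]; rewrite big_ord_recr /=.
have -> : R4_pi 'X_ord_max = y4 K by rewrite /y4 Y4E.
set a := \sum_(i < 3) _; set d := c ord_max.
have [B EB] : exists B, (a + d * y4 K) ^+ 3 = B * a + (d * y4 K) ^+ 3.
  by eexists; exact: cube_sum_split.
exists (fun j => B * c (widen_ord (leqnSn 3) j) - d ^+ 3 * yv j ^+ 2).
rewrite EB exprMn y4_cube emb3_g3 mulrN /a !mulr_sumr -sumrB.
apply: eq_bigr => j _; rewrite mulrBl -[B * _ * _]mulrA -[d ^+ 3 * _ * _]mulrA [yv j ^+ 3]exprSr.
congr (_ * (_ * _) - _); by rewrite /yv /emb3 mwidenX mnmwiden1.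
Qed.

(** Depth three is witnessed by an arbitrary regular sequence; koszul_H1 transfers
    its effect to Y1, Y2, Y3. *)
Lemma MCM_koszul : is_MCM M -> forall u : 'I_3 -> M,
  \sum_i yv i *: u i = 0 -> koszul_boundary yv u.
Proof.
move=> [_ [n Kn [[s [sJ reg_s] sn] _]]].
have n3 : (3 <= n)%N by have [[P chP] _] := R4_krull_dim charK; apply: (Kn.2 _ _ chP).
rewrite -sn in n3.
have s_cube i : (i < 3)%N -> cube_in yv s`_i.
  by move=> i3; apply/irrelevant_cube/sJ/mem_nth/(leq_trans i3).
have N1E m : N1 s`_0 m <-> in_ideal_mul (take 1 s) m.
  rewrite in_ideal_mul_takeS ?(leq_trans _ n3) // take0; split=> [[u ->]|[v [u [v0 ->]]]].
    by exists 0, u; rewrite add0r; split=> //; apply: in_ideal_mul0.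
  by exists u; rewrite (proj1 (in_ideal_mul_nil _) v0) add0r.
have N2E m : N2 s`_0 s`_1 m <-> in_ideal_mul (take 2 s) m.
  rewrite in_ideal_mul_takeS ?(leq_trans _ n3) //.
  by split=> -[v [u [/N1E v0 ->]]]; exists v, u.
have [reg _] := reg_s.
apply: (@koszul_H1 _ _ _ s`_0 s`_1 s`_2); try exact: s_cube.
- move=> m m0; apply/in_ideal_mul_nil; rewrite -(take0 s).
  by apply: reg; rewrite ?(leq_trans _ n3) // take0; apply/in_ideal_mul_nil.
- by move=> m /N1E; move/(reg 1 (leq_trans (isT : 2 <= 3)%N n3)) /N1E.
- by move=> m /N2E; move/(reg 2%N n3) /N2E.
Qed.
End R4depth.

(** * Homogeneous components *)

Section HomogComponent.
Variables (K : fieldType) (n : nat).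
Implicit Types (p q : {mpoly K[n]}) (z : int).

(** Degrees are integers, as for gradings, so that the components of negative degree
    are zero. *)
Definition hcomp z p : {mpoly K[n]} :=
  if z is Posz d then pihomog mdeg d p else 0.

Lemma mcoeff_hcomp z p m : (hcomp z p)@_m = if z == (mdeg m)%:Z then p@_m else 0.
Proof.
case: z => [d|d] /=; last by rewrite mcoeff0.
rewrite pihomogE raddf_sum /= eqz_nat eq_sym.
have -> : \sum_(e <- msupp p | mdeg e == d) (p@_e *: 'X_[e])@_m =
          \sum_(e <- msupp p | mdeg e == d) (if e == m then p@_e else 0).
  apply: eq_bigr => e _; rewrite mcoeffZ mcoeffX.
  by case: eqP => _; rewrite ?mulr1 ?mulr0.
rewrite big_mkcond /=; have [mp|mp] := boolP (m \in msupp p).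
  rewrite (bigD1_seq m) ?msupp_uniq //= eqxx big1 ?addr0 // => e /negbTE->.
  by rewrite if_same.
rewrite (memN_msupp_eq0 mp) if_same big1_seq // => e /andP[_ ep].
by case: (eqVneq e m) => [em|]; rewrite ?if_same // -em ep in mp *.
Qed.

Lemma hcompD z p q : hcomp z (p + q) = hcomp z p + hcomp z q.
Proof.
by apply/mpolyP => m; rewrite mcoeffD !mcoeff_hcomp mcoeffD; case: ifP => _; rewrite ?addr0.
Qed.

Lemma hcomp0 z : hcomp z 0 = 0.
Proof. by apply/mpolyP => m; rewrite mcoeff_hcomp mcoeff0 if_same. Qed.

Lemma hcomp_homog d p : hcomp d%:Z p \is d.-homog.
Proof. exact: pihomogP. Qed.

Lemma hcomp_id d p : p \is d.-homog -> hcomp d%:Z p = p.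
Proof. exact: pihomog_dE. Qed.

Lemma hcomp_sum_id (s : seq int) p : uniq s ->
  (forall m, m \in msupp p -> (mdeg m)%:Z \in s) -> \sum_(z <- s) hcomp z p = p.
Proof.
move=> us sP; apply/mpolyP => m; rewrite raddf_sum /=.
under eq_bigr do rewrite mcoeff_hcomp.
have [mp|/memN_msupp_eq0 ->] := boolP (m \in msupp p); last first.
  by rewrite big1 // => z _; rewrite if_same.
rewrite (bigD1_seq (mdeg m)%:Z) ?sP //= eqxx big1 ?addr0 // => z zm.
by rewrite (negbTE zm).
Qed.

Lemma hcomp_mul_homog d z p q : p \is d.-homog -> hcomp (d%:Z + z) (p * q) = p * hcomp z q.
Proof.
move=> hp; pose s := undup (z :: [seq (mdeg m)%:Z | m <- msupp q]).
have qE : q = \sum_(e <- s) hcomp e q.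
  rewrite hcomp_sum_id ?undup_uniq // => m mq.
  by rewrite mem_undup inE; apply/orP; right; apply: map_f.
have homM e : hcomp (d%:Z + z) (p * hcomp e q) = if e == z then p * hcomp z q else 0.
  case: e => [e|e] /=; last first.
    rewrite mulr0 hcomp0; case: eqP => // <- /=.
    by rewrite mulr0.
  have he : p * hcomp e%:Z q \is (d + e).-homog by rewrite dhomogM ?hcomp_homog.
  have [<-|ez] := eqVneq; first by rewrite -PoszD hcomp_id.
  apply/mpolyP => m; rewrite mcoeff_hcomp mcoeff0; case: eqP => // zm.
  apply: dhomog_nemf_coeff he _; apply: contra_neq ez => /= dm.
  by apply: (addrI d%:Z); rewrite zm dm PoszD.
rewrite {1}qE mulr_sumr (big_morph _ (hcompD _) (hcomp0 _)).
under eq_bigr do rewrite homM.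
rewrite (bigD1_seq z) ?undup_uniq //=; last by rewrite mem_undup inE eqxx.
by rewrite eqxx big1 ?addr0 // => e /negbTE->.
Qed.

End HomogComponent.

Lemma mwiden_homog (K : fieldType) n d (p : {mpoly K[n]}) :
  p \is d.-homog -> mwiden p \is d.-homog.
Proof.
move=> hp; rewrite [p]mpolyE raddf_sum /=; apply: rpred_sum => m _.
rewrite mwidenZ mwidenX; have [->|pm] := eqVneq p@_m 0; first by rewrite scale0r rpred0.
apply: rpredZ; rewrite dhomogX /= mdegE big_ord_recr /= mnmwiden_ordmax addn0.
have <- : mdeg m = d by apply: (dhomog_mf hp); rewrite mcoeff_msupp.
by rewrite mdegE; apply/eqP/eq_bigr => i _; rewrite mnmwiden_widen.
Qed.

(** The maximal ideal of the origin is generated by the variables. *)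
Lemma mpoly_const_split (K : fieldType) n (p : {mpoly K[n]}) :
  exists g : 'I_n -> {mpoly K[n]}, p = (p@_0)%:MP + \sum_j 'X_j * g j.
Proof.
suff [c [g E]] : exists c (g : 'I_n -> {mpoly K[n]}), p = c%:MP + \sum_j 'X_j * g j.
  exists g; rewrite {1}E; congr (_%:MP + _); rewrite E mcoeffD mcoeffC eqxx mulr1.
  rewrite raddf_sum /= big1 ?addr0 // => j _; apply/memN_msupp_eq0.
  rewrite mulrC (perm_mem (msuppMX _ _)); apply/mapP => -[m _ /mnmP /(_ j)].
  by rewrite mnm0E mnmDE mnm1E eqxx.
elim/mpoly_ring_ind: p => [c|i|p q [c [g ->]] [d [h ->]]|p q [c [g Ep]] [d [h Eq]]].
- by exists c, (fun=> 0); rewrite big1 ?addr0 // => j _; rewrite mulr0.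
- exists 0, (fun j => if j == i then 1 else 0); rewrite mpolyC0 add0r (bigD1 i) //= eqxx mulr1.
  by rewrite big1 ?addr0 // => j /negbTE->; rewrite mulr0.
- exists (c + d), (fun j => g j + h j); rewrite mpolyCD addrACA -big_split /=.
  by congr (_ + _); apply: eq_bigr => j _; rewrite mulrDr.
exists (c * d), (fun j => g j * q + c%:MP * h j).
rewrite {1}Ep mulrDl {1}Eq mulrDr -mpolyCM -addrA; congr (_ + _).
rewrite mulr_suml mulr_sumr -big_split /=; apply: eq_bigr => j _.
by rewrite mulrDr [RHS]addrC -mulrA; congr (_ + _); apply: mulrCA.
Qed.

Definition low_zero (K : fieldType) n N (p : {mpoly K[n]}) :=
  forall m, (mdeg m < N)%N -> p@_m = 0.

Lemma low_zeroX (K : fieldType) n N j (p : {mpoly K[n]}) :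
  low_zero N p -> low_zero N.+1 ('X_j * p).
Proof.
move=> lp m mN; apply/memN_msupp_eq0; rewrite mulrC (perm_mem (msuppMX _ _)).
apply/mapP => -[m' m'p Em]; move: m'p; rewrite mcoeff_msupp lp ?eqxx //.
by rewrite -ltnS; apply: leq_trans mN; rewrite Em mdegD mdeg1.
Qed.

(** The scalar product of (x, y, z) with its cross product by another vector is zero. *)
Lemma cross_cancel (R : comNzRingType) (x y z a b c u v w : R) :
  x * a + y * b + z * c =
  x * (a - (y * w - z * v)) + y * (b - (z * u - x * w)) + z * (c - (x * v - y * u)).
Proof. by ring. Qed.

(** * Graded MCM modules are free over the polynomials in three variables *)

Section Comb.
Variables (K : fieldType) (M : lmodType (R4 K)).
Local Notation A := {mpoly K[3]}.

Definition comb n (c : 'I_n -> A) (x : 'I_n -> M) : M := \sum_i emb3 (c i) *: x i.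

Lemma combD n (c d : 'I_n -> A) (x : 'I_n -> M) :
  comb (fun i => c i + d i) x = comb c x + comb d x.
Proof. by rewrite -big_split /=; apply: eq_bigr => i _; rewrite rmorphD scalerDl. Qed.

Lemma combZ n a (c : 'I_n -> A) (x : 'I_n -> M) :
  comb (fun i => a * c i) x = emb3 a *: comb c x.
Proof. by rewrite scaler_sumr; apply: eq_bigr => i _; rewrite rmorphM scalerA. Qed.

Lemma combB n (c d : 'I_n -> A) (x : 'I_n -> M) :
  comb (fun i => c i - d i) x = comb c x - comb d x.
Proof. by rewrite -sumrB /=; apply: eq_bigr => i _; rewrite rmorphB scalerBl. Qed.

Lemma comb_sum n (I : finType) (c : I -> 'I_n -> A) (x : 'I_n -> M) :
  comb (fun i => \sum_j c j i) x = \sum_j comb (c j) x.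
Proof. by rewrite exchange_big; apply: eq_bigr => i _; rewrite rmorph_sum scaler_suml. Qed.

Lemma eq_comb n (c d : 'I_n -> A) (x : 'I_n -> M) : c =1 d -> comb c x = comb d x.
Proof. by move=> cd; apply: eq_bigr => i _; rewrite cd. Qed.

Lemma comb_delta n (k : 'I_n) a (x : 'I_n -> M) :
  comb (fun i => if i == k then a else 0) x = emb3 a *: x k.
Proof.
rewrite /comb (bigD1 k) //= eqxx big1 ?addr0 // => i /negbTE->.
by rewrite rmorph0 scale0r.
Qed.

End Comb.

Section GradedFree.
Variable K : fieldType.
Hypothesis charK : [pchar K] =i pred0.
Variables (M : lmodType (R4 K)) (G : int -> M -> Prop).
Hypothesis Ggr : is_grading G.
Local Notation A := {mpoly K[3]}.

Lemma gradingD i x y : G i x -> G i y -> G i (x + y).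
Proof.
move=> Gx Gy; rewrite -[y]opprK; apply: (gradingB Ggr) => //.
by rewrite -[- y]add0r; apply: (gradingB Ggr) => //; exact: (grading0 Ggr).
Qed.

Lemma grading_big (I : finType) (F : I -> M) i :
  (forall j, G i (F j)) -> G i (\sum_j F j).
Proof.
by move=> GF; apply: (big_ind (G i)) => //; [exact: (grading0 Ggr) | exact: gradingD].
Qed.

Lemma grading_emb3 d a i x : a \is d.-homog -> G i x -> G (d%:Z + i) (emb3 a *: x).
Proof.
move=> ha; apply: (gradingZ Ggr); exists (mwiden a) => //; exact: mwiden_homog.
Qed.

Lemma grading_hcomp z (a : A) i x : G i x -> G (z + i) (emb3 (hcomp z a) *: x).
Proof.
case: z => d Gx; first by apply: grading_emb3; rewrite // hcomp_homog.
by rewrite /= rmorph0 scale0r; exact: (grading0 Ggr).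
Qed.

(** The terms of other degrees cancel, because the grading is direct. *)
Lemma comb_hcomp n (x : 'I_n -> M) (a : 'I_n -> int) (c : 'I_n -> A) d :
    (forall i, G (a i) (x i)) -> G d (comb c x) ->
  comb c x = comb (fun i => hcomp (d - a i) (c i)) x.
Proof.
move=> Gx Gm; set m := comb c x.
pose s := undup (d :: flatten [seq [seq a i + (mdeg e)%:Z | e <- msupp (c i)] | i <- enum 'I_n]).
have us : uniq s by exact: undup_uniq.
have sd : d \in s by rewrite mem_undup inE eqxx.
pose X e := comb (fun i => hcomp (e - a i) (c i)) x.
have GX e : G e (X e).
  apply: grading_big => i; rewrite -{1}[e](subrK (a i)); exact: grading_hcomp.
have sumX : \sum_(e <- s) X e = m.
  rewrite exchange_big /=; apply: eq_bigr => i _.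
  rewrite -scaler_suml -rmorph_sum; congr (emb3 _ *: _).
  rewrite -(big_map (fun e => e - a i) xpredT (fun z => hcomp z (c i))).
  apply: hcomp_sum_id => [|e ec].
    by rewrite map_inj_uniq // => u v /addIr.
  apply/mapP; exists (a i + (mdeg e)%:Z); last by rewrite addrC addKr.
  rewrite mem_undup inE; apply/orP; right; apply/flatten_mapP.
  by exists i; rewrite ?mem_enum //; apply: map_f.
have := @grading_direct _ _ _ Ggr s (fun e => X e - if e == d then m else 0) us.
case/(_ _ _ d sd)/Wrap => //.
- move=> e; apply: (gradingB Ggr) => //; case: eqP => [->|_] //.
  exact: (grading0 Ggr).
- by rewrite sumrB sumX (bigD1_seq d) //= eqxx big1 ?addr0 ?subrr // => e /negbTE->.
by rewrite eqxx => /eqP; rewrite subr_eq0 => /eqP.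
Qed.

Definition hgens n (a : 'I_n -> int) (x : 'I_n -> M) :=
  (forall i, G (a i) (x i)) /\ (forall m, exists c : 'I_n -> A, m = comb c x).

(** Homogeneous components of generators over R4, multiplied by 1, y4 and y4^2. *)
Lemma exists_hgens : fin_gen M -> exists n (a : 'I_n -> int) x, hgens a x.
Proof.
move=> [n [z zgen]].
have [s sP] := choice (fun j => grading_sum Ggr (z j)).
have [X XP] := choice sP.
pose L : seq (int * M) := flatten [seq
  flatten [seq [seq (k%:Z + i, y4 K ^+ k *: X j i) | i <- s j] | k <- iota 0 3] | j <- enum 'I_n].
have inL (j : 'I_n) k i : i \in s j -> (k < 3)%N -> (k%:Z + i, y4 K ^+ k *: X j i) \in L.
  move=> ij k3; apply/flatten_mapP; exists j; first by rewrite mem_enum.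
  by apply/flatten_mapP; exists k; [rewrite mem_iota | apply: map_f].
pose a (i : 'I_(size L)) := (nth (0, 0) L i).1.
pose x (i : 'I_(size L)) := (nth (0, 0) L i).2.
exists (size L), a, x; split.
  move=> i; have : nth (0, 0) L i \in L by apply: mem_nth.
  move=> /flatten_mapP[j _ /flatten_mapP[k _ /mapP[e _ E]]].
  rewrite /a /x E; apply: (gradingZ Ggr); last by case: (XP j) => /(_ e).
  exists (Y4 K ^+ k : {mpoly K[4]}); last by rewrite rmorphXn.
  have hY : Y4 K \is 1.-homog by rewrite dhomogX /= mdeg1.
  by have := dhomogMn k hY; rewrite mul1n.
pose P m := exists c : 'I_(size L) -> A, m = comb c x.
have PD m m' : P m -> P m' -> P (m + m').
  by move=> [c ->] [c' ->]; exists (fun i => c i + c' i); rewrite combD.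
have PZ b m : P m -> P (emb3 b *: m).
  by move=> [c ->]; exists (fun i => b * c i); rewrite combZ.
have P0 : P 0 by exists (fun=> 0); rewrite /comb big1 // => i _; rewrite rmorph0 scale0r.
have PL e m : (e, m) \in L -> P m.
  move=> /(nthP (0, 0))[i iL E]; exists (fun k => if k == Ordinal iL then 1 else 0).
  by rewrite comb_delta rmorph1 scale1r /x /= E.
move=> m; rewrite -/(P m); have [r ->] := zgen m.
apply: (big_ind P) => // j _; have [_ ->] := XP j.
rewrite scaler_sumr big_seq; apply: (big_ind P) => // i ij.
have [b0 [b1 [b2 ->]]] := R4_span (r j).
rewrite !scalerDl -!scalerA; apply: (PD); first apply: (PD); apply: (PZ).
- by apply: (PL (0%:Z + i)); rewrite -[X j i]scale1r -[1](expr0 (y4 K)); apply: inL.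
- by apply: (PL (1%:Z + i)); have := inL j 1%N i ij isT; rewrite expr1.
- by apply: (PL (2%:Z + i)); have := inL j 2%N i ij isT; rewrite expr2 -scalerA.
Qed.

Definition min_hgens n (a : 'I_n -> int) (x : 'I_n -> M) :=
  hgens a x /\ forall n' (a' : 'I_n' -> int) x', hgens a' x' -> (n <= n')%N.

Lemma exists_min_hgens : fin_gen M -> exists n (a : 'I_n -> int) x, min_hgens a x.
Proof.
move=> /exists_hgens [n0 ex0].
have exP : exists n, `[< exists (a : 'I_n -> int) x, hgens a x >].
  by exists n0; apply/asboolP.
case: (ex_minnP exP) => n /asboolP[a [x axP]] minn; exists n, a, x; split=> //.
by move=> n' a' x' ax'; apply/minn/asboolP; exists a', x'.
Qed.

(** Otherwise the degree zero coefficient is invertible and the generator can be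
    removed. *)
Lemma min_hgens_const0 n (a : 'I_n -> int) x (c : 'I_n -> A) :
  min_hgens a x -> comb c x = 0 -> forall k, (c k)@_0 = 0.
Proof.
case: n a x c => [|n] a x c; first by move=> _ _ [].
move=> [[Gx xgen] xmin] cx0 k; apply: contrapT => /eqP ck0.
have E : comb (fun i => hcomp (a k - a i) (c i)) x = 0.
  by rewrite -comb_hcomp // cx0; apply: (grading0 Ggr).
pose t : A := ((c k)@_0)^-1%:MP.
have xkE : x k = comb (fun j => - t * hcomp (a k - a (lift k j)) (c (lift k j)))
                      (fun j => x (lift k j)).
  rewrite combZ rmorphN scaleNr; apply/eqP; rewrite -addr_eq0; apply/eqP.
  move: E; rewrite /comb (bigD1_ord k) //= subrr.
  have -> : hcomp 0 (c k) = ((c k)@_0)%:MP.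
    apply/mpolyP => m; rewrite mcoeff_hcomp mcoeffC eqz_nat eq_sym mdeg_eq0 eq_sym.
    by case: eqP => [<-|_]; rewrite ?mulr1 ?mulr0.
  move/(congr1 (fun m => emb3 t *: m)); rewrite scaler0 scalerDr => E'; rewrite -[RHS]E'.
  by rewrite scalerA -rmorphM -mpolyCM mulVf // rmorph1 scale1r.
suff H : hgens (fun j => a (lift k j)) (fun j => x (lift k j)).
  by have := xmin _ _ _ H; rewrite ltnn.
split=> // m.
have [e ->] := xgen m.
rewrite /comb (bigD1_ord k) //= xkE -combZ -combD.
by eexists.
Qed.

(** A relation has coefficients without constant term, so it is a combination of Y1,
    Y2, Y3 with coefficients in M; as the Koszul homology vanishes these can be
    changed into relations. So the coefficients of every relation lie in arbitrarily
    high powers of the irrelevant ideal. *)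
Lemma MCM_min_hgens_free n (a : 'I_n -> int) x (c : 'I_n -> A) :
  is_MCM M -> min_hgens a x -> comb c x = 0 -> forall i, c i = 0.
Proof.
move=> MCM ax; suff H N : forall c, comb c x = 0 -> forall i, low_zero N (c i).
  by move=> c0 i; apply/mpolyP => m; rewrite mcoeff0; apply: (H (mdeg m).+1 c c0 i).
elim: N => {c} [|N IHN] c c0 i; first by move=> m.
have ck0 := min_hgens_const0 ax c0.
have exg k : exists g : 'I_3 -> A, c k = \sum_j 'X_j * g j.
  have [g E] := mpoly_const_split (c k).
  by exists g; rewrite {1}E ck0 mpolyC0 add0r.
have [g gE] := choice exg.
have [w [w0 w1 w2]] : koszul_boundary (@yv K) (fun j => comb (fun i => g i j) x).
  apply: (MCM_koszul charK MCM).
  rewrite -[RHS]c0 (eq_comb _ gE) comb_sum; apply: eq_bigr => j _.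
  by rewrite combZ.
have [h hE] := choice (fun j => ax.1.2 (w j)).
pose X0 : A := 'X_(@Ordinal 3 0 isT).
pose X1 : A := 'X_(@Ordinal 3 1 isT).
pose X2 : A := 'X_(@Ordinal 3 2 isT).
pose g0 k := g k (@Ordinal 3 0 isT) - (X1 * h (@Ordinal 3 2 isT) k - X2 * h (@Ordinal 3 1 isT) k).
pose g1 k := g k (@Ordinal 3 1 isT) - (X2 * h (@Ordinal 3 0 isT) k - X0 * h (@Ordinal 3 2 isT) k).
pose g2 k := g k (@Ordinal 3 2 isT) - (X0 * h (@Ordinal 3 1 isT) k - X1 * h (@Ordinal 3 0 isT) k).
have g0P : comb g0 x = 0 by rewrite !combB !combZ -!hE; apply/eqP; rewrite subr_eq0 w0.
have g1P : comb g1 x = 0 by rewrite !combB !combZ -!hE; apply/eqP; rewrite subr_eq0 w1.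
have g2P : comb g2 x = 0 by rewrite !combB !combZ -!hE; apply/eqP; rewrite subr_eq0 w2.
have -> : c i = X0 * g0 i + X1 * g1 i + X2 * g2 i.
  rewrite gE !big_ord_recl big_ord0 addr0 addrA.
  have -> : lift ord0 (lift ord0 ord0) = @Ordinal 3 2 isT :> 'I_3 by apply/val_inj.
  have -> : lift ord0 ord0 = @Ordinal 3 1 isT :> 'I_3 by apply/val_inj.
  have -> : ord0 = @Ordinal 3 0 isT :> 'I_3 by apply/val_inj.
  rewrite /g0 /g1 /g2 -/X0 -/X1 -/X2.
  exact: cross_cancel.
by move=> m mN; rewrite !mcoeffD (low_zeroX _ (IHN _ g0P i)) // (low_zeroX _ (IHN _ g1P i)) //
  (low_zeroX _ (IHN _ g2P i)) // !addr0.
Qed.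

End GradedFree.

(** * Isomorphisms between cokernels *)

Section MkLinear.
Variables (R : comNzRingType) (U V : lmodType R) (f : U -> V).
(** A function with a proof that it is linear, as an object to which the linear
    structure is attached. *)
Definition mk_linear (_ : linear f) := f.
Variable f_linear : linear f.
HB.instance Definition _ :=
  GRing.isLinear.Build R U V *:%R (mk_linear f_linear) f_linear.
End MkLinear.

Lemma linear_inverse (R : comNzRingType) (M N : lmodType R) (f : {linear M -> N}) g :
  cancel f g -> cancel g f -> linear g.
Proof. by move=> fK gK a u v; apply: (can_inj fK); rewrite linearP !gK. Qed.

Lemma lmod_isom_sym (R : comNzRingType) (M N : lmodType R) :
  lmod_isom M N -> lmod_isom N M.
Proof.
move=> [f [g fK gK]].
have glin := linear_inverse fK gK.
by exists (mk_linear glin); exists f.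
Qed.

Lemma lmod_isom_trans (R : comNzRingType) (M N P : lmodType R) :
  lmod_isom M N -> lmod_isom N P -> lmod_isom M P.
Proof.
move=> [f fb] [g gb]; exists (g \o f : {linear _ -> _}).
exact: bij_comp.
Qed.

Section Coker.
Variable K : fieldType.
Local Notation S := (S4 K).

Definition cpi (phi : detmx K) (v : 'cV[S]_3) : Coker phi := coker_pi phi v.

Lemma cpiD phi u v : cpi phi (u + v) = cpi phi u + cpi phi v.
Proof. exact: coker_piD. Qed.

Lemma cpiZ phi p v : cpi phi (p *: v) = R4_pi p *: cpi phi v.
Proof. by rewrite /cpi -coker_scaleE. Qed.

Lemma cpi0 phi : cpi phi 0 = 0.
Proof. by apply: (addrI (cpi phi 0)); rewrite -cpiD !addr0. Qed.

Lemma cpiB phi u v : cpi phi (u - v) = cpi phi u - cpi phi v.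
Proof. by rewrite cpiD -(scaleN1r v) cpiZ rmorphN1 scaleN1r. Qed.

Lemma cpi_repr phi (m : Coker phi) : cpi phi (repr m) = m.
Proof. exact: coker_piK. Qed.

Lemma cpi_eq0 phi v : cpi phi v = 0 <-> exists w, v = (phi : 'M[S]_3) *m w.
Proof.
rewrite -(cpi0 phi) [_ = _](propext (coker_piE _ _ _)) subr0.
by split=> [/asboolP|H]; last apply/asboolP.
Qed.

Lemma semilinear_delta_eq0 (M : lmodType (R4 K)) (g : 'cV[S]_3 -> M) :
    (forall u v, g (u + v) = g u + g v) ->
    (forall p v, g (p *: v) = R4_pi p *: g v) ->
    (forall i, g (delta_mx i 0) = 0) -> forall v, g v = 0.
Proof.
move=> gD gZ gd v.
have g0 : g 0 = 0 by rewrite -(scale0r (0 : 'cV[S]_3)) gZ rmorph0 scale0r.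
rewrite [v]matrix_sum_delta (big_morph g gD g0) big1 // => i _.
rewrite (big_morph g gD g0) big1 // => j _.
by rewrite gZ ord1 gd scaler0.
Qed.

(** The universal property of the cokernel, in the form of the first isomorphism
    theorem. *)
Lemma coker_isom (phi : detmx K) (M : lmodType (R4 K)) (h : 'cV[S]_3 -> M) :
    (forall u v, h (u + v) = h u + h v) ->
    (forall p v, h (p *: v) = R4_pi p *: h v) ->
    (forall v, h v = 0 <-> exists w, v = (phi : 'M[S]_3) *m w) -> (forall m, exists v, h v = m) ->
  lmod_isom (Coker phi) M.
Proof.
move=> hD hZ hker hsurj.
pose f (m : Coker phi) := h (repr m).
have hN v : h (- v) = - h v by rewrite -(scaleN1r v) hZ rmorphN1 scaleN1r.
have fE v : f (cpi phi v) = h v.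
  apply/eqP; rewrite -subr_eq0 -hN -hD; apply/eqP/hker/cpi_eq0.
  by rewrite cpiB cpi_repr subrr.
have flin : linear f.
  move=> a m n; rewrite -[m]cpi_repr -[n]cpi_repr -[a]R4_piK.
  by rewrite -cpiZ -cpiD !fE hD hZ.
exists (mk_linear flin); have [g gP] := choice hsurj.
exists (fun m => cpi phi (g m)) => m /=; last by rewrite [LHS]fE gP.
apply/eqP; rewrite -subr_eq0 -[m in X in _ - X]cpi_repr -cpiB; apply/eqP/cpi_eq0/hker.
by rewrite hD hN gP subrr.
Qed.

Definition const_mx3 (P : 'M[K]_3) : 'M[S]_3 := map_mx (@mpolyC 4 K) P.

Definition lin_equiv (phi psi : 'M[S]_3) :=
  exists P Q : 'M[K]_3, [/\ P \in unitmx, Q \in unitmx &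
    const_mx3 P *m phi = psi *m const_mx3 Q].

Lemma det_const_mx3 (P : 'M[K]_3) : \det (const_mx3 P) = (\det P)%:MP.
Proof. exact: det_map_mx. Qed.

Lemma const_mxV (P : 'M[K]_3) : P \in unitmx ->
  const_mx3 (invmx P) *m const_mx3 P = 1%:M.
Proof. by move=> Pu; rewrite -map_mxM mulVmx // map_mx1. Qed.

Lemma const_mxVr (P : 'M[K]_3) : P \in unitmx ->
  const_mx3 P *m const_mx3 (invmx P) = 1%:M.
Proof. by move=> Pu; rewrite -map_mxM mulmxV // map_mx1. Qed.

Lemma equiv_image (R : comNzRingType) (P P' Q Q' A B : 'M[R]_3) :
    P' *m P = 1%:M -> Q *m Q' = 1%:M -> P *m A = B *m Q ->
  forall v : 'cV_3, (exists w, P *m v = B *m w) <-> exists w, v = A *m w.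
Proof.
move=> PP QQ E v; split=> -[w Ew]; last by exists (Q *m w); rewrite Ew !mulmxA E.
exists (Q' *m w); rewrite -[v]mul1mx -PP -mulmxA Ew -[RHS]mul1mx -PP.
by rewrite -[RHS]mulmxA [P *m (A *m _)]mulmxA E -mulmxA [Q *m (Q' *m _)]mulmxA QQ mul1mx.
Qed.

Lemma lin_equiv_isom (phi psi : detmx K) :
  lin_equiv phi psi -> lmod_isom (Coker phi) (Coker psi).
Proof.
move=> [P [Q [Pu Qu PQ]]].
apply: (@coker_isom phi (Coker psi) (fun v => cpi psi (const_mx3 P *m v))).
- by move=> u v; rewrite mulmxDr cpiD.
- by move=> p v; rewrite -scalemxAr cpiZ.
- move=> v; rewrite cpi_eq0.
  exact: equiv_image (const_mxV Pu) (const_mxVr Qu) PQ v.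
move=> m; exists (const_mx3 (invmx P) *m repr m).
by rewrite mulmxA const_mxVr // mul1mx cpi_repr.
Qed.

Definition linear_mx (phi : 'M[S]_3) := forall i j, phi i j \is 1.-homog.

Lemma coker_lift (phi psi : detmx K) (f : {linear Coker phi -> Coker psi}) :
  exists P : 'M[S]_3, forall v, f (cpi phi v) = cpi psi (P *m v).
Proof.
exists (\matrix_(i, j) (repr (f (cpi phi (delta_mx j 0))) : 'cV[S]_3) i 0) => v.
set P := \matrix_(_, _) _.
apply: subr0_eq; move: v.
apply: (@semilinear_delta_eq0 _ (fun v => f (cpi phi v) - cpi psi (P *m v))).
- by move=> u v; rewrite mulmxDr !cpiD raddfD opprD addrACA.
- by move=> p v; rewrite -scalemxAr !cpiZ linearZ scalerBr.
move=> i; rewrite -colE.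
have -> : col i P = repr (f (cpi phi (delta_mx i 0))).
  by apply/colP => k; rewrite !mxE.
by rewrite cpi_repr subrr.
Qed.

Lemma hcomp0E n (p : {mpoly K[n]}) : hcomp 0 p = (p@_0)%:MP.
Proof.
apply/mpolyP => m; rewrite mcoeff_hcomp mcoeffC eqz_nat eq_sym mdeg_eq0 eq_sym.
by case: eqP => [<-|_]; rewrite ?mulr1 ?mulr0.
Qed.

Definition mx_at0 (P : 'M[S]_3) : 'M[K]_3 := map_mx (mcoeff 0%MM) P.

Lemma mx_at0M P Q : mx_at0 (P *m Q) = mx_at0 P *m mx_at0 Q.
Proof.
rewrite /mx_at0; apply/matrixP => i j; rewrite !mxE raddf_sum /=.
by apply: eq_bigr => k _; rewrite !mxE [LHS]rmorphM.
Qed.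

Lemma linear_mx_at0 phi : linear_mx phi -> mx_at0 phi = 0.
Proof.
move=> lp; apply/matrixP => i j; rewrite !mxE.
by apply: dhomog_nemf_coeff (lp i j) _; rewrite /= mdeg0.
Qed.

Lemma linear_mx_compl (phi P : 'M[S]_3) : linear_mx phi ->
  map_mx (hcomp 1) (P *m phi) = const_mx3 (mx_at0 P) *m phi.
Proof.
move=> lp; apply/matrixP => i j; rewrite !mxE.
rewrite (big_morph _ (hcompD _) (hcomp0 _ _ _)); apply: eq_bigr => k _.
have -> : (1 : int) = 1%N%:Z + 0 by [].
by rewrite !mxE mulrC hcomp_mul_homog // hcomp0E mulrC.
Qed.

Lemma linear_mx_compr (phi P : 'M[S]_3) : linear_mx phi ->
  map_mx (hcomp 1) (phi *m P) = phi *m const_mx3 (mx_at0 P).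
Proof.
move=> lp; apply/matrixP => i j; rewrite !mxE.
rewrite (big_morph _ (hcompD _) (hcomp0 _ _ _)); apply: eq_bigr => k _.
have -> : (1 : int) = 1%N%:Z + 0 by [].
by rewrite !mxE hcomp_mul_homog // hcomp0E.
Qed.

(** Lift the isomorphism and its inverse to matrices P and P' with P phi = psi Q; the
    parts of degree zero of P and Q satisfy the same relation as phi and psi are
    linear. P' P is the identity modulo phi, so the constant part of P is invertible,
    and comparing determinants so is that of Q. *)
Lemma isom_lin_equiv (phi psi : detmx K) : linear_mx phi -> linear_mx psi ->
  lmod_isom (Coker phi) (Coker psi) -> lin_equiv phi psi.
Proof.
move=> lphi lpsi [f [g fK gK]].
have glin := linear_inverse fK gK.
have [P PE] := coker_lift f; have [P' P'E] := coker_lift (mk_linear glin).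
have ex_col i : exists w, P *m ((phi : 'M[S]_3) *m delta_mx i 0) = (psi : 'M[S]_3) *m (w : 'cV_3).
  apply/cpi_eq0; rewrite -PE; have -> : cpi phi ((phi : 'M[S]_3) *m delta_mx i 0) = 0.
    by apply/cpi_eq0; exists (delta_mx i 0).
  exact: (raddf0 f).
have [q qE] := choice ex_col.
pose Q := \matrix_(i, j) q j i 0.
have PQ : P *m (phi : 'M[S]_3) = (psi : 'M[S]_3) *m Q.
  have Eq j : q j = Q *m delta_mx j 0 by rewrite -colE; apply/colP => i; rewrite !mxE.
  apply/matrixP => i j; have := congr1 (fun v : 'cV_3 => v i 0) (qE j).
  by rewrite Eq !mulmxA -!colE !mxE.
have ex_col' i : exists w, P' *m (P *m delta_mx i 0) - delta_mx i 0 = (phi : 'M[S]_3) *m (w : 'cV_3).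
  apply/cpi_eq0; rewrite cpiB -P'E -PE; apply/eqP; rewrite subr_eq0; apply/eqP.
  exact: (fK (cpi phi (delta_mx i 0))).
have [r rE] := choice ex_col'.
pose R := \matrix_(i, j) r j i 0.
have PP : P' *m P - 1%:M = (phi : 'M[S]_3) *m R.
  have Er j : r j = R *m delta_mx j 0 by rewrite -colE; apply/colP => i; rewrite !mxE.
  apply/matrixP => i j; have := congr1 (fun v : 'cV_3 => v i 0) (rE j).
  by rewrite Er !mulmxA -{2}[delta_mx j 0]mul1mx -mulmxBl -!colE !mxE.
have P0u : mx_at0 P \in unitmx.
  have : mx_at0 P' *m mx_at0 P = 1%:M.
    apply/eqP; rewrite -subr_eq0 -mx_at0M; apply/eqP/matrixP => i j.
    have := congr1 (fun m : 'M_3 => mx_at0 m i j) PP.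
    rewrite mx_at0M (linear_mx_at0 lphi) mul0mx !mxE raddfB /= => <-.
    by congr (_ - _); case: (_ == _); rewrite ?mcoeff1 ?mcoeff0 ?eqxx.
  by move/mulmx1_unit => [].
have E : const_mx3 (mx_at0 P) *m (phi : 'M[S]_3) = (psi : 'M[S]_3) *m const_mx3 (mx_at0 Q).
  exact: etrans (esym (linear_mx_compl P lphi)) (etrans (congr1 _ PQ) (linear_mx_compr Q lpsi)).
exists (mx_at0 P), (mx_at0 Q); split=> //.
have := congr1 (fun m : 'M_3 => \det m) E.
rewrite !det_mulmx !detmxP !det_const_mx3 mulrC.
(* The determinants of phi and psi are both f4, which cancels. *)
have f0 : f4 K != 0 by rewrite -(cubic_g3 K) cubic_neq0.
move/(mulfI f0)/eqP; rewrite mpolyC_eq => /eqP detE.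
by move: P0u; rewrite !unitmxE detE.
Qed.
End Coker.

(** * Rank one modules as cokernels of linear matrices *)

Section FreeBasis.
Variable K : fieldType.
Hypothesis charK : [pchar K] =i pred0.
Variables (M : lmodType (R4 K)).
Local Notation A := {mpoly K[3]}.

Definition afree n (x : 'I_n -> M) := forall c : 'I_n -> A, comb c x = 0 -> forall i, c i = 0.
Definition aspan n (x : 'I_n -> M) := forall m, exists c : 'I_n -> A, m = comb c x.

Lemma rank1_torsionfree : has_rank M 1 -> exists z : M, forall r : R4 K, r *: z = 0 -> r = 0.
Proof.
move=> [[x xl] _]; exists (x ord0) => r rx.
by apply: (xl (fun=> r) _ ord0); rewrite big_ord1.
Qed.

(** In a module of rank one each element is a fraction of a fixed torsion-free one,
    with denominator in K[Y1, Y2, Y3]. *)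
Lemma rank1_multiple (z : M) : has_rank M 1 -> (forall r : R4 K, r *: z = 0 -> r = 0) ->
  forall m, exists (a : A) t, a != 0 /\ emb3 a *: m = t *: z.
Proof.
move=> [_ rk1] zfree m.
have /existsNP[c /not_implyP[c0 /existsNP[i ci]]] :
    ~ lin_indep (fun i : 'I_2 => if i == ord0 then m else z).
  by move/rk1.
move: c0; rewrite !big_ord_recl big_ord0 addr0 /=; set r := c ord0; set t := c _ => rt.
have r0 : r != 0.
  apply/eqP => r0; move: rt; rewrite r0 scale0r add0r => /zfree t0; apply: ci.
  case: (unliftP ord0 i) => [j ->|->] //; rewrite -t0 /t; congr c.
  by apply/val_inj; case: j => -[].
have [r' [a [a0 Ea]]] := R4_norm charK r0.
exists a, (- r' * t); split=> //.
rewrite -Ea mulrC -scalerA; move/eqP: rt; rewrite addr_eq0 => /eqP->.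
by rewrite scalerN mulNr scaleNr scalerA.
Qed.

(** Multiples of the elements by suitable denominators lie in R4 z, and R4 has rank
    three over K[Y1, Y2, Y3]. *)
Lemma rank1_afree_le3 n (x : 'I_n -> M) : has_rank M 1 -> afree x -> (n <= 3)%N.
Proof.
move=> rk1 xfree; rewrite leqNgt; apply/negP => n4.
have [z zfree] := rank1_torsionfree rk1.
have [a aP] := choice (fun i => rank1_multiple rk1 zfree (x i)).
have [t tP] := choice aP.
have tE i := R4_span (t i).
have [t0 t0P] := choice tE; have [t1 t1P] := choice t0P; have [t2 t2P] := choice t1P.
pose w (i : 'I_4) := widen_ord n4 i.
have [c [i ci] cP] := @idomain_rows_dependent A 3
  (fun i j => [:: t0 (w i); t1 (w i); t2 (w i)]`_j).
pose d (k : 'I_n) : A := if insub (k : nat) is Some j then c j * a k else 0.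
have dw j : d (w j) = c j * a (w j) by rewrite /d /= valK.
suff /xfree/(_ (w i)) : comb d x = 0.
  by rewrite dw => /eqP; rewrite mulf_eq0 (negbTE ci) (negbTE (proj1 (tP _))).
pose F k := if insub k is Some j then emb3 (d j) *: x j else 0.
have -> : comb d x = \sum_(k < n) F k.
  by apply: eq_bigr => k _; rewrite /F valK.
have -> : \sum_(k < n) F k = \sum_(j < 4) F j.
  rewrite (big_ord_widen n F n4) [LHS](bigID (fun k : 'I_n => (k < 4)%N)) /=.
  rewrite [X in _ + X]big1 ?addr0 // => k k4; rewrite /F valK /d insubN // rmorph0.
  by rewrite scale0r.
have FE j : F (val j) = emb3 (c j) *: (t (w j) *: z).
  rewrite /F -[val j]/(val (w j)) valK dw rmorphM -scalerA.
  by rewrite (proj2 (tP (w j))).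
under eq_bigr do rewrite FE scalerA.
rewrite -scaler_suml -[RHS](scale0r z); congr (_ *: _).
have cP0 := cP ord0; have cP1 := cP (lift ord0 ord0); have cP2 := cP ord_max.
transitivity (emb3 (\sum_j c j * t0 (w j)) + emb3 (\sum_j c j * t1 (w j)) * y4 K
    + emb3 (\sum_j c j * t2 (w j)) * y4 K ^+ 2); last first.
  by rewrite [X in emb3 X]cP0 [X in emb3 X * _]cP1 [X in emb3 X * _ ^+ 2]cP2 !rmorph0 !mul0r !addr0.
rewrite !rmorph_sum !mulr_suml -!big_split /=; apply: eq_bigr => j _.
by rewrite (t2P (w j)) !rmorphM !mulrDr !mulrA.
Qed.

Lemma min_gens_aspan_ge n k (x : 'I_n -> M) : min_nb_gens M k -> aspan x -> (k <= n)%N.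
Proof.
move=> [_ mink] xspan; apply: (mink n x) => m; have [c ->] := xspan m.
by exists (fun i => emb3 (c i)).
Qed.

Lemma comb_inj n (x : 'I_n -> M) (c d : 'I_n -> A) : afree x -> comb c x = comb d x -> c =1 d.
Proof.
move=> xfree E i; apply/eqP; rewrite -subr_eq0; apply/eqP.
by apply: (xfree (fun i => c i - d i)); rewrite combB E subrr.
Qed.

End FreeBasis.

Lemma int3_min_or_max (a : 'I_3 -> int) : ~ (forall i j, a i = a j) ->
  exists k, (forall i, i != k -> (a k < a i)%R) \/ (forall i, i != k -> (a i < a k)%R).
Proof.
move=> na; pose o0 := @Ordinal 3 0 isT; pose o1 := @Ordinal 3 1 isT; pose o2 := @Ordinal 3 2 isT.
have [E01|N01] := eqVneq (a o0) (a o1).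
  have [E12|N12] := eqVneq (a o1) (a o2).
    by case: na; apply: ord3_ind; apply: ord3_ind; rewrite -/o0 -/o1 -/o2; lia.
  exists o2; have [lt|gt] : (a o1 < a o2)%R \/ (a o2 < a o1)%R by lia.
    by right; apply: ord3_ind => //= _; rewrite -/o0 -/o1 -/o2; lia.
  by left; apply: ord3_ind => //= _; rewrite -/o0 -/o1 -/o2; lia.
have [E12|N12] := eqVneq (a o1) (a o2).
  exists o0; have [lt|gt] : (a o1 < a o0)%R \/ (a o0 < a o1)%R by lia.
    by right; apply: ord3_ind => //= _; rewrite -/o0 -/o1 -/o2; lia.
  by left; apply: ord3_ind => //= _; rewrite -/o0 -/o1 -/o2; lia.
have [E02|N02] := eqVneq (a o0) (a o2).
  exists o1; have [lt|gt] : (a o1 < a o0)%R \/ (a o0 < a o1)%R by lia.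
    by left; apply: ord3_ind => //= _; rewrite -/o0 -/o1 -/o2; lia.
  by right; apply: ord3_ind => //= _; rewrite -/o0 -/o1 -/o2; lia.
have [[lt lt']|[[lt lt']|[lt lt']]] :
  ((a o0 < a o1)%R /\ (a o0 < a o2)%R) \/ ((a o1 < a o0)%R /\ (a o1 < a o2)%R) \/
  ((a o2 < a o0)%R /\ (a o2 < a o1)%R) by lia.
- by exists o0; left; apply: ord3_ind => //= _; rewrite -/o0 -/o1 -/o2; lia.
- by exists o1; left; apply: ord3_ind => //= _; rewrite -/o0 -/o1 -/o2; lia.
- by exists o2; left; apply: ord3_ind => //= _; rewrite -/o0 -/o1 -/o2; lia.
Qed.

Section Presentation.
Variable K : fieldType.
Hypothesis charK : [pchar K] =i pred0.
Variables (M : lmodType (R4 K)) (G : int -> M -> Prop).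
Hypothesis Ggr : is_grading G.
Local Notation A := {mpoly K[3]}.
Variables (a : 'I_3 -> int) (x : 'I_3 -> M).
Hypotheses (Gx : forall i, G (a i) (x i)) (xfree : afree x) (xspan : aspan x).
Hypothesis gens3 : min_nb_gens M 3.

(** T is the matrix of multiplication by y4; homogeneity dictates the degrees of its
    entries. *)
Lemma y4_matrix : exists T : 'I_3 -> 'I_3 -> A, forall j,
  y4 K *: x j = comb (T^~ j) x /\ forall i, T i j = hcomp (1 + a j - a i) (T i j).
Proof.
have ex j : exists c : 'I_3 -> A, y4 K *: x j = comb c x /\ forall i, c i = hcomp (1 + a j - a i) (c i).
  have [c E] := xspan (y4 K *: x j); exists c; split=> //.
  apply: (comb_inj xfree); rewrite -(comb_hcomp Ggr Gx) //.
  rewrite -E; apply: (gradingZ Ggr) => //.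
  by exists (Y4 K) => //; rewrite dhomogX /= mdeg1.
have [T TP] := choice ex.
by exists (fun i j => T j i).
Qed.

Variable T : 'I_3 -> 'I_3 -> A.
Hypothesis TP : forall j, y4 K *: x j = comb (T^~ j) x.
Hypothesis hT : forall i j, T i j = hcomp (1 + a j - a i) (T i j).

Definition Tapp (c : 'I_3 -> A) i := \sum_j T i j * c j.

Lemma y4_comb c : y4 K *: comb c x = comb (Tapp c) x.
Proof.
have -> : comb (Tapp c) x = comb (fun i => \sum_j c j * T i j) x.
  by apply: eq_comb => i; apply: eq_bigr => j _; rewrite mulrC.
rewrite (comb_sum (fun j i => c j * T i j)) /comb scaler_sumr; apply: eq_bigr => j _.
by rewrite -/(comb (fun i => c j * T i j) x) combZ -TP !scalerA mulrC.
Qed.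

(** Excludes an invariant line or quotient of rank one for y4, on which y4 would act
    by a cube root of g3. *)
Lemma g3_not_cube (t : A) : t ^+ 3 <> g3 K.
Proof.
move=> t3; have N0 : cubic_norm (g3 K) t (-1) 0 = 0 by rewrite /cubic_norm t3; ring.
have [_ /eqP] := norm_inj_g3 charK N0.
by rewrite oppr_eq0 oner_eq0.
Qed.

Lemma Tapp_cube c : Tapp (Tapp (Tapp c)) =1 (fun i => g3 K * c i).
Proof.
apply: (comb_inj xfree); rewrite -!y4_comb !scalerA -expr2 -exprSr.
by rewrite y4_cube combZ.
Qed.

Lemma T_no_split_row k : ~ (forall i, i != k -> T k i = 0).
Proof.
move=> Tk; have Tc c : Tapp c k = T k k * c k.
  by rewrite /Tapp (bigD1 k) //= big1 ?addr0 // => i /Tk->; rewrite mul0r.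
apply: (@g3_not_cube (T k k)); have := Tapp_cube (fun=> 1) k.
by rewrite !Tc !mulr1 -expr2 -exprS.
Qed.

Lemma T_no_split_col k : ~ (forall i, i != k -> T i k = 0).
Proof.
move=> Tk; have Td u : Tapp (fun i => if i == k then u else 0) =1
    (fun i => if i == k then T k k * u else 0).
  move=> i; rewrite /Tapp (bigD1 k) //= eqxx big1 ?addr0 => [|j /negbTE->]; last by rewrite mulr0.
  by have [->|/Tk->] := eqVneq i k; rewrite ?mul0r.
have TappE c d : c =1 d -> Tapp c =1 Tapp d.
  by move=> cd i; apply: eq_bigr => j _; rewrite cd.
apply: (@g3_not_cube (T k k)); have := Tapp_cube (fun i => if i == k then 1 else 0) k.
rewrite (TappE _ _ (TappE _ _ (Td 1))) (TappE _ _ (Td _)) Td eqxx !mulr1.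
by rewrite -expr2 -exprS.
Qed.

(** A nonzero constant entry would express one generator through the others and y4,
    against the minimality of the number of generators over R4. *)
Lemma T_const_eq0 i j : 1 + a j - a i = 0 -> T i j = 0.
Proof.
move=> aij; have := hT i j; rewrite aij hcomp0E; set c := _@_0 => Tc.
rewrite Tc; have [->|c0] := eqVneq c 0; first by rewrite mpolyC0.
have ij : i != j by apply/eqP => ij; move: aij; rewrite ij; lia.
suff : (3 <= 2)%N by [].
pose s k := emb3 (c^-1)%:MP * ((if lift i k == j then y4 K else 0) - emb3 (T (lift i k) j)).
have xE : x i = \sum_k s k *: x (lift i k).
  have [j' Ej] : exists j', j = lift i j'.
    by case: (unliftP i j) ij => [j' ->|->]; [exists j' | rewrite eqxx].
  have sumE : \sum_k (if lift i k == j then y4 K else 0) *: x (lift i k) = y4 K *: x j.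
    rewrite (bigD1 j') //= -Ej eqxx big1 ?addr0 // => k kj'.
    by rewrite Ej (inj_eq lift_inj) (negbTE kj') scale0r.
  under eq_bigr do rewrite -scalerA scalerBl.
  rewrite -scaler_sumr sumrB sumE TP /comb (bigD1_ord i) //= addrK Tc scalerA.
  by rewrite -rmorphM -mpolyCM mulVf // rmorph1 scale1r.
apply: (gens3.2 2%N (fun k => x (lift i k))) => m; have [e ->] := xspan m.
exists (fun k => emb3 (e i) * s k + emb3 (e (lift i k))).
rewrite /comb (bigD1_ord i) //= xE scaler_sumr -big_split /=.
by apply: eq_bigr => k _; rewrite scalerDl scalerA.
Qed.

Lemma T_eq0 i j : (a j < a i)%R -> T i j = 0.
Proof.
move=> lt_ij; have [|] := eqVneq (1 + a j - a i) 0; first exact: T_const_eq0.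
move=> n0; rewrite hT; case E: (1 + a j - a i) => [d|d] //; lia.
Qed.

(** If one degree were strictly extremal, the corresponding row or column of T would
    be zero off the diagonal. *)
Lemma degrees_eq : forall i j, a i = a j.
Proof.
apply: contrapT => /int3_min_or_max[k [kmin|kmax]].
  by apply: (@T_no_split_col k) => i /kmin/T_eq0.
by apply: (@T_no_split_row k) => i /kmax/T_eq0.
Qed.

Lemma T_linear i j : T i j \is 1.-homog.
Proof. by rewrite hT (degrees_eq j i) addrK; apply: (hcomp_homog 1). Qed.

End Presentation.

Lemma det_linear_homog (K : fieldType) (phi : 'M[S4 K]_3) :
  linear_mx phi -> (\det phi : {mpoly K[4]}) \is 3.-homog.
Proof.
move=> lp; apply: rpred_sum => s _; rewrite rpredMsign.
rewrite !big_ord_recl big_ord0 mulr1.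
exact: (dhomogM (lp _ _) (dhomogM (lp _ _) (lp _ _))).
Qed.

Section Pencil.
Variable K : fieldType.
Hypothesis charK : [pchar K] =i pred0.
Variables (M : lmodType (R4 K)).
Local Notation A := {mpoly K[3]}.
Local Notation S := (S4 K).
Variables (x : 'I_3 -> M) (T : 'I_3 -> 'I_3 -> A).
Hypotheses (xfree : afree x) (xspan : aspan x).
Hypothesis TP : forall j, y4 K *: x j = comb (T^~ j) x.
Hypothesis Tlin : forall i j, T i j \is 1.-homog.

(** Y4 - T, the presentation matrix of M over K[Y1, ..., Y4]. *)
Definition pencil_mx : 'M[S]_3 :=
  \matrix_(i, j) ((if i == j then Y4 K else 0) - mwiden (T i j)).

Definition pencil_act (v : 'cV[S]_3) : M := \sum_i R4_pi (v i 0) *: x i.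

Lemma pencil_actD u v : pencil_act (u + v) = pencil_act u + pencil_act v.
Proof.
rewrite -big_split; apply: eq_bigr => i _.
by rewrite mxE R4_piD scalerDl.
Qed.

Lemma pencil_actZ p v : pencil_act (p *: v) = R4_pi p *: pencil_act v.
Proof.
rewrite scaler_sumr; apply: eq_bigr => i _.
by rewrite mxE R4_piM scalerA.
Qed.

Lemma pencil_act_delta i : pencil_act (delta_mx i 0) = x i.
Proof.
rewrite /pencil_act (bigD1 i) //= mxE !eqxx R4_pi1 scale1r big1 ?addr0 // => j ji.
by rewrite mxE (negbTE ji) (rmorph0 (@R4_pi K)) scale0r.
Qed.

Lemma pencil_act_mx v : pencil_act (pencil_mx *m v) = 0.
Proof.
move: v; apply: (@semilinear_delta_eq0 _ _ (fun v => pencil_act (pencil_mx *m v))).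
- by move=> u v; rewrite mulmxDr pencil_actD.
- by move=> p v; rewrite -scalemxAr pencil_actZ.
move=> j; rewrite -colE /pencil_act.
transitivity (\sum_i ((if i == j then y4 K *: x i else 0) - emb3 (T i j) *: x i)).
  apply: eq_bigr => i _; rewrite !mxE (rmorphB (@R4_pi K)) scalerBl /=; congr (_ - _).
  by case: ifP => // _; rewrite (rmorph0 (@R4_pi K)) scale0r.
rewrite sumrB -/(comb (T^~ j) x) -TP (bigD1 j) //= eqxx big1 ?addr0 ?subrr // => i.
by move=> /negbTE->.
Qed.

Lemma pencil_linear : linear_mx pencil_mx.
Proof.
move=> i j; rewrite mxE rpredB ?mwiden_homog //.
by case: ifP => _; rewrite ?rpred0 // dhomogX /= mdeg1.
Qed.

(** Modulo the image of Y4 - T, multiplication by Y4 can be replaced by T, so Y4 can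
    be eliminated. *)
Lemma pencil_reduce v : exists w (c : 'I_3 -> A),
  v = pencil_mx *m w + \col_i mwiden (c i).
Proof.
pose P v := exists w (c : 'I_3 -> A), v = pencil_mx *m w + \col_i mwiden (c i).
have PD u v' : P u -> P v' -> P (u + v').
  move=> [w [c ->]] [w' [c' ->]]; exists (w + w'), (fun i => c i + c' i).
  rewrite mulmxDr addrACA; congr (_ + _); apply/colP => i.
  by rewrite !mxE mwidenD.
have PA b u : P u -> P (mwiden b *: u).
  move=> [w [c ->]]; exists (mwiden b *: w), (fun i => b * c i).
  rewrite scalerDr scalemxAr; congr (_ + _); apply/colP => i.
  by rewrite !mxE mwidenM.
have PY u : P u -> P (Y4 K *: u).
  move=> [w [c ->]]; rewrite scalerDr scalemxAr; apply: PD.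
    by exists (Y4 K *: w), (fun=> 0); rewrite [X in _ + X](_ : _ = 0) ?addr0 //;
       apply/colP => i; rewrite !mxE mwiden0.
  exists (\col_i mwiden (c i)), (fun i => \sum_j T i j * c j).
  apply/colP => i; rewrite !mxE raddf_sum -big_split /= (bigD1 i) //=.
  rewrite !mxE eqxx mwidenM mulrBl subrK big1 ?addr0 // => j ji.
  by rewrite !mxE eq_sym (negbTE ji) mwidenM sub0r mulNr addNr.
have PS (p : {mpoly K[4]}) u : P u -> P ((p : S) *: u).
  elim/mpoly_ring_ind: p u => [c|i|p q IHp IHq|p q IHp IHq] u Pu.
  - by rewrite -mwidenC; apply: PA.
  - elim/ord_maxW: i => [|i]; first by rewrite -Y4E; apply: PY.
    by have := PA 'X_i u Pu; rewrite mwidenX mnmwiden1.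
  - by rewrite scalerDl; apply: PD; [apply: IHp | apply: IHq].
  - by rewrite -scalerA; apply/IHp/IHq.
have P0 : P 0.
  by exists 0, (fun=> 0); rewrite mulmx0 add0r; apply/colP => i; rewrite !mxE mwiden0.
rewrite -/(P v) [v]matrix_sum_delta; apply: (big_ind P) => // i _.
apply: (big_ind P) => // j _; apply: PS; rewrite ord1.
exists 0, (fun k => if k == i then 1 else 0); rewrite mulmx0 add0r.
by apply/colP => k; rewrite !mxE andbT; case: ifP; rewrite ?mwiden1 ?mwiden0.
Qed.

Lemma pencil_act_eq0 v : pencil_act v = 0 -> exists w, v = pencil_mx *m w.
Proof.
have [w [c ->]] := pencil_reduce v; rewrite pencil_actD pencil_act_mx add0r => cx.
exists w; rewrite [X in _ + X](_ : _ = 0) ?addr0 //; apply/colP => i.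
rewrite !mxE (xfree (c := c)) ?mwiden0 // -[RHS]cx; apply: eq_bigr => j _.
by rewrite mxE.
Qed.

Lemma pencil_act_surj m : exists v, pencil_act v = m.
Proof.
have [c ->] := xspan m; exists (\col_i mwiden (c i)).
by apply: eq_bigr => i _; rewrite mxE.
Qed.

(** The determinant annihilates M, so it is a multiple of f4; both have degree three,
    and their values at (0, 0, 0, 1) are 1. *)
Lemma pencil_det (z : M) : (forall r : R4 K, r *: z = 0 -> r = 0) -> \det pencil_mx = f4 K.
Proof.
move=> zfree; have : R4_pi (\det pencil_mx) = 0.
  apply: zfree; have [v <-] := pencil_act_surj z.
  rewrite -pencil_actZ -[\det _ *: v]mul_scalar_mx -mul_mx_adj -mulmxA.
  exact: pencil_act_mx.
move/R4_pi_eq0 => [q Eq].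
have f4h : f4 K \is 3.-homog.
  have X3 (i : 'I_4) : ('X_i : {mpoly K[4]}) ^+ 3 \is 3.-homog.
    have h1 : ('X_i : {mpoly K[4]}) \is 1.-homog by rewrite dhomogX /= mdeg1.
    exact: dhomogMn 3 h1.
  by rewrite /f4 !rpredD ?X3.
have Eq0 : \det pencil_mx = (q@_0)%:MP * f4 K :> {mpoly K[4]}.
  rewrite -[LHS](hcomp_id (det_linear_homog pencil_linear)) Eq mulrC.
  by rewrite -[3%:Z]addr0 (hcomp_mul_homog 0 q f4h) hcomp0E mulrC.
(* At (0, 0, 0, 1) the matrix Y4 - T is the identity, since T is linear in Y1, Y2,
   Y3. *)
pose e4 (i : 'I_4) : K := if i == ord_max then 1 else 0.
have f4e : meval e4 (f4 K) = 1.
  rewrite /f4 !mevalD !rmorphXn /= !mevalXU /e4 /=.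
  by rewrite expr0n /= expr1n !add0r.
have dete : meval e4 (\det pencil_mx) = 1.
  rewrite -det_map_mx -[RHS](det1 K 3); congr (\det _); apply/matrixP => i j.
  rewrite !mxE /= mevalB; have -> : meval e4 (mwiden (T i j)) = 0.
    have T0 : (T i j)@_0 = 0 by apply: dhomog_nemf_coeff (Tlin i j) _; rewrite /= mdeg0.
    have [g ->] := mpoly_const_split (T i j).
    rewrite T0 mpolyC0 add0r.
    rewrite (raddf_sum (@mwiden 3 K)) (raddf_sum (meval e4)) big1 // => k _.
    rewrite /= mwidenM mwidenX mnmwiden1.
    by rewrite mevalM mevalXU /e4 -val_eqE /= ltn_eqF ?mul0r.
  rewrite subr0; case: (i == j); last by rewrite meval0.
  by rewrite mevalXU.
have : q@_0 = 1 by have := congr1 (meval e4) Eq0; rewrite dete mevalM mevalC f4e mulr1.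
by move=> q1; rewrite Eq0 q1 mpolyC1 mul1r.
Qed.

Lemma pencil_coker (detphi : \det pencil_mx = f4 K) :
  lmod_isom (Coker (DetMx detphi)) M.
Proof.
apply: (@coker_isom _ _ _ pencil_act).
- exact: pencil_actD.
- exact: pencil_actZ.
- move=> v; split; first exact: pencil_act_eq0.
  by move=> [w ->]; apply: pencil_act_mx.
- exact: pencil_act_surj.
Qed.
End Pencil.

(** A minimal family x has three elements: at most three since it is free over K[Y1,
    Y2, Y3], at least three since it generates M over R4. *)
Lemma MCM_linear_coker (K : fieldType) (charK : [pchar K] =i pred0) (M : lmodType (R4 K)) :
    is_graded M -> is_MCM M -> has_rank M 1 -> min_nb_gens M 3 ->
  exists phi : detmx K, linear_mx phi /\ lmod_isom M (Coker phi).
Proof.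
move=> [G Ggr] MCM rk1 gens3.
have [n [a [x ax]]] := exists_min_hgens Ggr MCM.1.
have xfree : afree x by move=> c c0; exact: (MCM_min_hgens_free charK Ggr MCM ax c0).
have [Gx xspan] := ax.1.
have n3 : n = 3%N.
  by apply/eqP; rewrite eqn_leq (rank1_afree_le3 charK rk1 xfree) (min_gens_aspan_ge gens3 xspan).
subst n.
have [T TP] := y4_matrix Ggr Gx xfree xspan.
have TP1 j := proj1 (TP j); have hT i j := proj2 (TP j) i.
have Tlin := T_linear charK xfree xspan gens3 TP1 hT.
have [z zfree] := rank1_torsionfree rk1.
have det3 := pencil_det xspan TP1 Tlin zfree.
exists (DetMx det3); split; first exact: pencil_linear.
exact: lmod_isom_sym (pencil_coker xfree xspan TP1 det3).
Qed.

(** * Generators and rank of the cokernel of a linear matrix *)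

Notation o30 := (@Ordinal 3 0 isT).
Notation o31 := (@Ordinal 3 1 isT).
Notation o32 := (@Ordinal 3 2 isT).

Lemma big_ord3 (V : nmodType) (F : 'I_3 -> V) : \sum_i F i = F o30 + F o31 + F o32.
Proof.
rewrite !big_ord_recl big_ord0 addr0 addrA.
by congr (F _ + F _ + F _); apply/val_inj.
Qed.

Section Det3.
Variable R : comNzRingType.

(** The determinant of the matrix with columns a, b, c, as an explicit polynomial. *)
Definition det3 (a b c : 'I_3 -> R) :=
  a o30 * (b o31 * c o32 - b o32 * c o31) - a o31 * (b o30 * c o32 - b o32 * c o30)
  + a o32 * (b o30 * c o31 - b o31 * c o30).

Lemma det_mx22 (A : 'M[R]_2) :
  \det A = A ord0 ord0 * A ord_max ord_max - A ord0 ord_max * A ord_max ord0.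
Proof.
rewrite (expand_det_row _ ord0) !big_ord_recl big_ord0 addr0 /cofactor !det_mx11 !mxE /=.
rewrite expr0 expr1 mul1r mulN1r mulrN; congr (_ * A _ _ - A _ _ * A _ _);
by apply/val_inj.
Qed.

Lemma det_mx33 (A : 'M[R]_3) :
  \det A = det3 (A^~ o30) (A^~ o31) (A^~ o32).
Proof.
rewrite (expand_det_col _ o30) big_ord3 /cofactor !det_mx22 !mxE /=.
have l00 : lift o30 (ord0 : 'I_2) = o31 by apply/val_inj.
have l01 : lift o30 (ord_max : 'I_2) = o32 by apply/val_inj.
have l10 : lift o31 (ord0 : 'I_2) = o30 by apply/val_inj.
have l11 : lift o31 (ord_max : 'I_2) = o32 by apply/val_inj.
have l20 : lift o32 (ord0 : 'I_2) = o30 by apply/val_inj.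
have l21 : lift o32 (ord_max : 'I_2) = o31 by apply/val_inj.
rewrite /det3 ?(l00, l01, l10, l11, l20, l21) !addn0 expr0 expr1.
rewrite expr2 mulrNN !mul1r mulN1r mulrN.
ring.
Qed.

(** Cramer's rule for the system with columns a, b, c. *)
Lemma det3_cramer (a b c v : 'I_3 -> R) k :
  a k * det3 v b c + b k * det3 a v c + c k * det3 a b v = det3 a b c * v k.
Proof. by rewrite /det3; elim/ord3_ind: k; ring. Qed.

(** The linear relation between the four vectors p, q, a, b of a space of dimension
    three. *)
Lemma det3_four (p q a b : 'I_3 -> R) k :
  det3 q a b * p k - det3 p a b * q k = b k * det3 p q a - a k * det3 p q b.
Proof. by rewrite /det3; elim/ord3_ind: k; ring. Qed.

Lemma sum3_factor (x y z a b c f : R) :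
  x * (a * f) + y * (b * f) + z * (c * f) = f * (x * a + y * b + z * c).
Proof. by ring. Qed.

Lemma det3_rot (a b c : 'I_3 -> R) : det3 a b c = det3 b c a.
Proof. by rewrite /det3; ring. Qed.

End Det3.

Section LinearCoker.
Variable K : fieldType.
Hypothesis charK : [pchar K] =i pred0.
Local Notation S := (S4 K).
Variable phi : detmx K.
Hypothesis phi_lin : linear_mx phi.
Local Notation C := (Coker phi).
Local Notation col0 := (fun i => (phi : 'M[S]_3) i o30).
Local Notation col1 := (fun i => (phi : 'M[S]_3) i o31).
Local Notation col2 := (fun i => (phi : 'M[S]_3) i o32).

Lemma f4_neq0 : f4 K != 0.
Proof. by rewrite -(cubic_g3 K) cubic_neq0. Qed.

Lemma f4_det3 : f4 K = det3 col0 col1 col2.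
Proof. by rewrite -(detmxP phi) det_mx33. Qed.

Lemma cpi_combine (v : 'cV[S]_3) : cpi phi v = \sum_i R4_pi (v i 0) *: cpi phi (delta_mx i 0).
Proof.
rewrite -/(pencil_act (fun i => cpi phi (delta_mx i 0)) v); apply: subr0_eq; move: v.
apply: (@semilinear_delta_eq0 _ _
  (fun v => cpi phi v - pencil_act (fun i => cpi phi (delta_mx i 0)) v)).
- by move=> u v; rewrite cpiD pencil_actD opprD addrACA.
- by move=> p v; rewrite cpiZ pencil_actZ scalerBr.
by move=> i; rewrite pencil_act_delta subrr.
Qed.

Lemma coker_generates : generates (fun i : 'I_3 => cpi phi (delta_mx i 0)).
Proof.
move=> m; exists (fun i => R4_pi ((repr m : 'cV[S]_3) i 0)).
by rewrite -[m in LHS]cpi_repr [LHS]cpi_combine.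
Qed.

Lemma delta_not_im i w : delta_mx i 0 <> (phi : 'M[S]_3) *m (w : 'cV_3).
Proof.
move=> /matrixP /(_ i 0); rewrite !mxE !eqxx => /(congr1 (mcoeff 0%MM)).
rewrite raddf_sum /= mcoeff1 eqxx big1 => [/eqP|k _]; first by rewrite oner_eq0.
rewrite rmorphM /=; have -> : ((phi : 'M[S]_3) i k)@_0 = 0; last by rewrite mul0r.
by apply: dhomog_nemf_coeff (phi_lin i k) _; rewrite /= mdeg0.
Qed.

(** Reduce modulo the irrelevant ideal: phi becomes zero, so the cokernel becomes a
    space of dimension three. *)
Lemma coker_min_gens : min_nb_gens C 3.
Proof.
split; first by exists (fun i => cpi phi (delta_mx i 0)); exact: coker_generates.
move=> k x xgen.
have ex i : exists c : 'I_k -> S, exists w,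
    delta_mx i 0 = \col_l (\sum_j c j * (repr (x j) : 'cV[S]_3) l 0) + (phi : 'M[S]_3) *m w.
  have [c E] := xgen (cpi phi (delta_mx i 0)).
  have [w Ew] : exists w, delta_mx i 0 - \col_l (\sum_j (repr (c j) : S) * (repr (x j) : 'cV[S]_3) l 0)
      = (phi : 'M[S]_3) *m w.
    apply/cpi_eq0; rewrite cpiB E; apply/eqP; rewrite subr_eq0; apply/eqP.
    have -> : \col_l (\sum_j (repr (c j) : S) * (repr (x j) : 'cV[S]_3) l 0) =
       \sum_j (repr (c j) : S) *: (repr (x j) : 'cV[S]_3).
      by apply/colP => l; rewrite !mxE summxE; apply: eq_bigr => j _; rewrite mxE.
    rewrite (big_morph _ (cpiD phi) (cpi0 phi)); apply: eq_bigr => j _.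
    by rewrite cpiZ R4_piK cpi_repr.
  by exists (fun j => repr (c j)), w; rewrite -Ew addrC subrK.
have [c /choice[w E]] := choice ex.
pose U : 'M[K]_(3, k) := \matrix_(l, j) ((repr (x j) : 'cV[S]_3) l 0)@_0.
pose V : 'M[K]_(k, 3) := \matrix_(j, i) (c i j)@_0.
have UV : U *m V = 1%:M.
  apply/matrixP => l i; have /matrixP /(_ l 0) := E i; rewrite !mxE andbT.
  move=> /(congr1 (mcoeff 0%MM)); rewrite mcoeffD !raddf_sum /= [X in _ + X]big1 ?addr0.
    have -> : ((l == i)%:R : {mpoly K[4]})@_0 = (l == i)%:R.
      by case: (l == i); rewrite ?mcoeff1 ?mcoeff0 ?eqxx.
    by move=> ->; apply: eq_bigr => j _; rewrite !mxE rmorphM mulrC.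
  move=> j _; rewrite rmorphM /=; have -> : ((phi : 'M[S]_3) l j)@_0 = 0; last by rewrite mul0r.
  by apply: dhomog_nemf_coeff (phi_lin l j) _; rewrite /= mdeg0.
by have := mulmx_max_rank U V; rewrite UV mxrank1.
Qed.

(** If r kills the class of v then f4 divides r times adj(phi) v. As f4 is prime it
    divides r, or else it divides adj(phi) v, which puts v in the image of phi. *)
Lemma coker_lin_indep (v : 'cV[S]_3) : cpi phi v <> 0 -> forall r : R4 K, r *: cpi phi v = 0 -> r = 0.
Proof.
move=> v0 r; rewrite -[r]R4_piK -cpiZ => /cpi_eq0[w Ew].
have Er i : (repr r : S) * (\adj phi *m v) i 0 = w i 0 * f4 K.
  have := congr1 (fun u => (\adj phi *m u) i 0) Ew.
  by rewrite mulmxA mul_adj_mx detmxP mul_scalar_mx -scalemxAr !mxE [f4 K * _]mulrC.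
have [dvr|ndv] := pselect (divides (f4 K) (repr r : {mpoly K[4]})); first exact/R4_pi_eq0.
have dvd i : exists q, (\adj phi *m v) i 0 = q * f4 K.
  have /(f4_prime charK)[//|//] : divides (f4 K) ((repr r : {mpoly K[4]}) * (\adj phi *m v) i 0).
  by exists (w i 0); rewrite Er.
have [q Eq] := choice dvd; case: v0; apply/cpi_eq0; exists (\col_i q i).
have Eq' : \adj phi *m v = f4 K *: \col_i q i.
  by apply/colP => i; rewrite Eq !mxE mulrC.
have := congr1 (mulmx phi) Eq'; rewrite mulmxA mul_mx_adj detmxP mul_scalar_mx -scalemxAr.
move/colP => E; apply/colP => i; have := E i; rewrite !mxE.
exact: (mulfI f4_neq0).
Qed.

(** For two elements p and q, the determinants of each with two columns of phi give
    relations between their classes (det3_four). If the classes were independent, f4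
    would divide all these determinants for q, and Cramer's rule would put q in the
    image of phi. *)
Lemma coker_rank1 : has_rank C 1.
Proof.
have d0 : cpi phi (delta_mx o30 0) <> 0 by move=> /cpi_eq0[w]; apply: delta_not_im.
split.
  exists (fun=> cpi phi (delta_mx o30 0)) => c; rewrite big_ord1 => /(coker_lin_indep d0) c0 i.
  by rewrite ord1.
move=> k x xl; rewrite leqNgt; apply/negP => k2.
pose j0 : 'I_k := Ordinal (ltnW k2); pose j1 : 'I_k := Ordinal k2.
pose p : 'cV[S]_3 := repr (x j0); pose q : 'cV[S]_3 := repr (x j1).
have rel (a b : R4 K) : a *: x j0 + b *: x j1 = 0 -> a = 0.
  move=> ab; pose c (i : 'I_k) : R4 K := if i == j0 then a else if i == j1 then b else 0.
  have := xl c; rewrite (bigD1 j0) // (bigD1 j1) //= big1 => [|i /andP[/negbTE i0 /negbTE i1]].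
    by rewrite addr0 /c !eqxx /= => /(_ ab j0); rewrite eqxx.
  by rewrite /c i0 i1 scale0r.
pose d (a b c : 'I_3 -> S) : {mpoly K[4]} := det3 a b c.
have rel_d (i j : 'I_3) : i != j ->
    divides (f4 K) (d (q^~ 0) (fun k => (phi : 'M[S]_3) k i) (fun k => (phi : 'M[S]_3) k j)).
  move=> ij; apply/R4_pi_eq0; set a := fun k => _ k i; set b := fun k => _ k j.
  apply: (rel _ (- R4_pi (d (p^~ 0) a b))).
  rewrite -[x j0]cpi_repr -[x j1]cpi_repr -/p -/q scaleNr -!cpiZ -cpiB; apply/cpi_eq0.
  exists (\col_k if k == j then d (p^~ 0) (q^~ 0) a else if k == i then - d (p^~ 0) (q^~ 0) b else 0).
  apply/colP => l; rewrite !mxE /d det3_four.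
  rewrite (bigD1 j) //= (bigD1 i) //= !mxE !eqxx (negbTE ij) big1 => [|e /andP[/negbTE l0 /negbTE l1]].
    by rewrite addr0 mulrN.
  by rewrite !mxE l0 l1 mulr0.
suff : cpi phi q = 0.
  rewrite /q cpi_repr => x1; have := xl (fun i => if i == j1 then 1 else 0).
  rewrite (bigD1 j1) //= x1 scaler0 add0r big1 => [/(_ erefl j1)|i /negbTE->]; last by rewrite scale0r.
  by rewrite eqxx => /eqP; rewrite oner_eq0.
have [q0 E0] := rel_d o31 o32 isT; have [q1 E1] := rel_d o32 o30 isT.
have [q2 E2] := rel_d o30 o31 isT.
apply/cpi_eq0; exists (\col_k [:: q0; q1; q2]`_k).
apply/colP => l; rewrite !mxE big_ord3 !mxE /=.
apply: (mulfI f4_neq0); rewrite {1}f4_det3 -(det3_cramer _ _ _ (q^~ 0) l).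
rewrite (det3_rot _ (q^~ 0)) (det3_rot _ _ (q^~ 0)) (det3_rot _ (q^~ 0)).
rewrite [det3 _ _ _]E0 [det3 (q^~ 0) _ col0]E1 [det3 (q^~ 0) _ col1]E2.
exact: sum3_factor.
Qed.
End LinearCoker.

(** * Grading and depth of the cokernel of a linear matrix *)

Lemma homog1_meval0 (K : fieldType) n (p : {mpoly K[n]}) : p \is 1.-homog -> p.@[fun=> 0] = 0.
Proof.
move=> hp; have p0 : p@_0 = 0 by apply: dhomog_nemf_coeff hp _; rewrite /= mdeg0.
have [g ->] := mpoly_const_split p; rewrite p0 mpolyC0 add0r.
by rewrite (raddf_sum (meval _)) big1 // => k _; rewrite /= mevalM mevalXU mul0r.
Qed.

Lemma mpolyX_neq0 (K : fieldType) n (m : 'X_{1..n}) : 'X_[m] != 0 :> {mpoly K[n]}.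
Proof. by rewrite -msize_poly_eq0 msizeX. Qed.

Section Specialization.
Variables (R : idomainType) (kil : nat -> {rmorphism R -> R}) (X : nat -> R) (N : nat).
Hypothesis kil_kil : forall k l p, (k <= l)%N -> kil l (kil k p) = kil l p.
Hypothesis kil_X : forall k, (k < N)%N -> kil k.+1 (X k) = 0.
Hypothesis keep_X : forall k, (k < N)%N -> kil k (X k) = X k.
Hypothesis X_neq0 : forall k, X k != 0.
Hypothesis kil_step : forall k p, (k < N)%N -> exists q, kil k p - kil k.+1 p = q * X k.
Variables (n : nat) (phi : 'M[R]_n).
Implicit Types (u v w : 'cV[R]_n).

Definition kil_col k v : 'cV[R]_n := map_mx (kil k) v.
Definition kil_mx k (A : 'M[R]_n) : 'M[R]_n := map_mx (kil k) A.

Let kil_colM k A v : kil_col k (A *m v) = kil_mx k A *m kil_col k v.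
Proof. exact: map_mxM. Qed.
Let kil_colD k u v : kil_col k (u + v) = kil_col k u + kil_col k v.
Proof. exact: map_mxD. Qed.
Let kil_colB k u v : kil_col k (u - v) = kil_col k u - kil_col k v.
Proof. exact: map_mxB. Qed.
Let kil_colZ k p v : kil_col k (p *: v) = kil k p *: kil_col k v.
Proof. exact: map_mxZ. Qed.
Let kil_col_kil k l v : (k <= l)%N -> kil_col l (kil_col k v) = kil_col l v.
Proof. by move=> kl; apply/colP => i; rewrite !mxE kil_kil. Qed.
Let kil_mx_kil k l A : (k <= l)%N -> kil_mx l (kil_mx k A) = kil_mx l A.
Proof. by move=> kl; apply/matrixP => i j; rewrite !mxE kil_kil. Qed.

Let kil_col_step k v : (k < N)%N -> kil_col k.+1 v = 0 ->
  exists w, kil_col k v = X k *: w.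
Proof.
move=> kN v0; have [q qE] := choice (fun i => kil_step (v i 0) kN).
exists (\col_i q i); apply/colP => i; rewrite !mxE mulrC -qE.
by have /colP /(_ i) := v0; rewrite !mxE => ->; rewrite subr0.
Qed.

(** u belongs to the image of phi modulo X 0, ..., X (k - 1). The retraction kil k
    sets these elements to zero, so that quotient rings are replaced by subrings of
    R. *)
Definition kil_image k u := exists w, kil_col k u = kil_mx k phi *m kil_col k w.

Lemma kil_image_succ k u : (k < N)%N ->
  kil_image k.+1 u <->
  exists v z w, kil_image k v /\ u = v + X k *: z + phi *m w.
Proof.
move=> kN; split.
  move=> [w Ew]; pose d := u - phi *m w.
  have [|z Ez] := @kil_col_step k d kN.
    by rewrite kil_colB kil_colM Ew subrr.
  have Ez' : kil_col k d = X k *: kil_col k z.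
    by rewrite -[LHS](kil_col_kil _ (leqnn k)) Ez kil_colZ keep_X.
  exists (u - X k *: z), z, 0; split; last by rewrite mulmx0 addr0 subrK.
  exists w; rewrite kil_colB kil_colZ keep_X // -Ez' kil_colB kil_colM.
  by rewrite opprB addrC subrK.
move=> [v [z [w [[w' Ew'] ->]]]]; exists (w' + w).
rewrite !kil_colD kil_colZ kil_X // scale0r addr0 kil_colM mulmxDr; congr (_ + _).
have := congr1 (kil_col k.+1) Ew'.
by rewrite kil_colM !kil_col_kil // kil_mx_kil.
Qed.

(** The determinant of phi stays nonzero after killing X k, so phi stays injective
    there: if X k u is in the image, its preimage is divisible by X k. *)
Lemma kil_image_regular k u : (k < N)%N -> kil k.+1 (\det phi) != 0 ->
  kil_image k (X k *: u) -> kil_image k u.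
Proof.
move=> kN det0 [w]; rewrite kil_colZ keep_X // => Ew.
have w0 : kil_col k.+1 w = 0.
  have := congr1 (kil_col k.+1) Ew; rewrite kil_colZ kil_X // scale0r.
  rewrite kil_colM !kil_col_kil // kil_mx_kil // => /(congr1 (mulmx (\adj (kil_mx k.+1 phi)))).
  rewrite mulmx0 mulmxA mul_adj_mx mul_scalar_mx det_map_mx.
  move=> /colP E; apply/colP => i; have := E i; rewrite !mxE => /esym/eqP.
  by rewrite mulf_eq0 (negbTE det0) => /eqP.
have [w' Ew'] := kil_col_step kN w0.
have Ew2 : kil_col k w = X k *: kil_col k w'.
  by have := congr1 (kil_col k) Ew'; rewrite kil_colZ keep_X // kil_col_kil.
exists w'; move: Ew; rewrite Ew2 -scalemxAr => /colP E; apply/colP => i.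
by have := E i; rewrite !mxE => /(mulfI (X_neq0 _)).
Qed.
End Specialization.

Section LinearCokerMCM.
Variable K : fieldType.
Hypothesis charK : [pchar K] =i pred0.
Local Notation S := (S4 K).
Variable phi : detmx K.
Hypothesis phi_lin : linear_mx phi.
Local Notation C := (Coker phi).

Definition hcol (z : int) (v : 'cV[S]_3) : 'cV[S]_3 := map_mx (hcomp z) v.

Lemma hcolD z u v : hcol z (u + v) = hcol z u + hcol z v.
Proof. by apply/colP => i; rewrite !mxE hcompD. Qed.

Lemma hcol0 z : hcol z 0 = 0.
Proof. by apply/colP => i; rewrite !mxE hcomp0. Qed.

Lemma hcol_id_eq z z' v : hcol z v = v -> hcol z' v = if z' == z then v else 0.
Proof.
move=> <-; case: eqP => [->|zz]; apply/colP => i; rewrite !mxE; apply/mpolyP => m;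
  rewrite ?mcoeff0 !mcoeff_hcomp; first by case: eqP.
by case: eqP => // E; case: eqP => // E'; case: zz; rewrite E E'.
Qed.

Lemma hcolZ d z (p : {mpoly K[4]}) v : p \is d.-homog ->
  hcol (d%:Z + z) ((p : S) *: v) = (p : S) *: hcol z v.
Proof. by move=> ph; apply/colP => i; rewrite !mxE hcomp_mul_homog. Qed.

Lemma hcol_mx z w : hcol z ((phi : 'M[S]_3) *m w) = (phi : 'M[S]_3) *m hcol (z - 1) w.
Proof.
apply/colP => i; rewrite !mxE (big_morph _ (hcompD z) (hcomp0 _ _ _)).
apply: eq_bigr => j _; rewrite mxE -[z in LHS](subrK 1) addrC.
exact: (hcomp_mul_homog (z - 1) _ (phi_lin i j)).
Qed.

(** The generators are given degree 0 and the relations degree 1. *)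
Definition coker_grading (z : int) (m : C) := exists v, hcol z v = v /\ m = cpi phi v.

Lemma coker_graded : is_graded C.
Proof.
exists coker_grading; split.
- by move=> z; exists 0; rewrite hcol0 cpi0.
- move=> z _ _ [u [hu ->]] [v [hv ->]]; exists (u - v); split; last by rewrite cpiB.
  rewrite hcolD hu; congr (_ + _).
  apply: (addrI v); rewrite -{1}hv -hcolD !subrr; exact: hcol0.
- move=> d z r _ [p ph ->] [v [hv ->]]; exists ((p : S) *: v); split; last by rewrite cpiZ.
  by rewrite hcolZ // hv.
- move=> m; pose v : 'cV[S]_3 := repr m.
  pose s := undup (flatten [seq [seq (mdeg e)%:Z | e <- msupp (v i 0 : {mpoly K[4]})] | i <- enum 'I_3]).
  exists s, (fun z => cpi phi (hcol z v)); split.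
    move=> z; exists (hcol z v); split=> //; apply/colP => i; rewrite !mxE.
    by apply/mpolyP => e; rewrite !mcoeff_hcomp; case: eqP.
  rewrite -(big_morph (cpi phi) (cpiD phi) (cpi0 phi)) -[LHS]cpi_repr; congr (cpi phi _).
  apply/colP => i; rewrite summxE; under eq_bigr do rewrite mxE.
  rewrite hcomp_sum_id ?undup_uniq // => e ev.
  rewrite mem_undup; apply/flatten_mapP; exists i; first by rewrite mem_enum.
  exact: map_f.
move=> s x us xG; have [v vP] := choice xG.
rewrite (eq_bigr (fun i => cpi phi (v i))) => [|i _]; last exact: (proj2 (vP i)).
rewrite -(big_morph (cpi phi) (cpiD phi) (cpi0 phi)) => /cpi_eq0[w Ew] z zs.
rewrite (proj2 (vP z)); apply/cpi_eq0; exists (hcol (z - 1) w).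
rewrite -hcol_mx -Ew (big_morph _ (hcolD z) (hcol0 z)) (bigD1_seq z) //= (proj1 (vP z)).
rewrite big1 ?addr0 // => i iz; rewrite (hcol_id_eq _ (proj1 (vP i))).
by rewrite eq_sym (negbTE iz).
Qed.

Definition kill_tuple k : 4.-tuple {mpoly K[4]} :=
  [tuple (if (i < 4 - k)%N then 'X_i else 0) | i < 4].

Definition kill k (p : {mpoly K[4]}) : {mpoly K[4]} := p \mPo kill_tuple k.

Lemma killX k i : kill k 'X_i = if (i < 4 - k)%N then 'X_i else 0.
Proof. by rewrite /kill comp_mpolyXU -tnth_nth tnth_mktuple. Qed.

Lemma kill0 p : kill 0 p = p.
Proof.
rewrite -[RHS]comp_mpoly_id; congr (_ \mPo _); apply: eq_from_tnth => i.
by rewrite !tnth_mktuple subn0 ltn_ord.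
Qed.

Lemma kill_kill k l p : (k <= l)%N -> kill l (kill k p) = kill l p.
Proof.
move=> kl; symmetry; apply: comp_mpoly_subst => i; rewrite !tnth_mktuple.
case: ifP => li.
  have -> : (i < 4 - k)%N by apply: leq_trans li _; rewrite leq_sub2l.
  by have := killX l i; rewrite li.
case: ifP => _; last by rewrite comp_mpoly0.
by have := killX l i; rewrite li.
Qed.

Lemma kill_step k (p : {mpoly K[4]}) : (k < 4)%N -> exists q,
  kill k p - kill k.+1 p = q * 'X_(inord (3 - k)).
Proof.
move=> k4; pose t : 4.-tuple {mpoly K[4]} := [tuple (if i == inord (3 - k) then 0 else 'X_i) | i < 4].
have -> : kill k.+1 p = kill k p \mPo t.
  apply: comp_mpoly_subst => i; rewrite !tnth_mktuple.
  have iE : (i == inord (3 - k)) = (i == 3 - k :> nat)%N.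
    by rewrite -val_eqE /= inordK // ltnS leq_subr.
  case: ifP => li.
    have -> : (i < 4 - k)%N by lia.
    rewrite comp_mpolyXU -tnth_nth tnth_mktuple iE; case: eqP => //; lia.
  case: ifP => li'; last by rewrite comp_mpoly0.
  rewrite comp_mpolyXU -tnth_nth tnth_mktuple iE; case: eqP => //; lia.
apply: mpoly_subst_divides => i; rewrite tnth_mktuple; case: eqP => [->|_].
  by exists 1; rewrite mul1r subr0.
by exists 0; rewrite mul0r subrr.
Qed.

(** The variables Y4, Y3, Y2, in this order, form the regular sequence. *)
Definition reg_var k : R4 K := R4_pi 'X_(inord (3 - k)).
Definition vars_seq : seq (R4 K) := [:: reg_var 0; reg_var 1; reg_var 2].

Lemma kill_var k l : (l < k <= 4)%N -> kill k 'X_(inord (3 - l)) = 0.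
Proof.
move=> lk; rewrite killX inordK; last by rewrite ltnS leq_subr.
by case: ifP => //; lia.
Qed.

Lemma keep_var k : (k < 4)%N -> kill k 'X_(inord (3 - k)) = 'X_(inord (3 - k)).
Proof.
move=> k4; rewrite killX inordK; last by rewrite ltnS leq_subr.
by case: ifP => //; lia.
Qed.

HB.instance Definition _ k := GRing.RMorphism.copy (kill k) (comp_mpoly (kill_tuple k)).

Definition kill_image k (u : 'cV[S]_3) := @kil_image {mpoly K[4]} kill 3 phi k u.

(** f4 still contains Y1^3. *)
Lemma kill_f4_neq0 k : (k <= 3)%N -> kill k (f4 K) != 0.
Proof.
move=> k3; apply/eqP => /(congr1 (meval (fun i : 'I_4 => if i == ord0 then 1 else 0))).
rewrite meval0 comp_mpoly_meval /f4 !mevalD !rmorphXn /= !mevalXU !tnth_mktuple.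
have -> : (0 < 4 - k)%N by lia.
rewrite mevalXU /=.
have e0 (i : 'I_4) (b : bool) : i != ord0 ->
    (if b then 'X_i else 0 : {mpoly K[4]}).@[fun i : 'I_4 => if i == ord0 then 1 else 0] = 0.
  by move=> i0; case: b; rewrite ?meval0 // mevalXU (negbTE i0).
by rewrite !e0 // !expr0n /= expr1n !addr0 => /eqP; rewrite oner_eq0.
Qed.

Lemma kill_image_succ k (u : 'cV[S]_3) : (k < 4)%N ->
  kill_image k.+1 u <-> exists v z w, kill_image k v /\
    u = v + ('X_(inord (3 - k)) : S) *: z + (phi : 'M[S]_3) *m w.
Proof.
apply: (@kil_image_succ {mpoly K[4]} kill (fun k => 'X_(inord (3 - k))) 4).
- by move=> i j p; apply: kill_kill.
- by move=> i i4; apply: kill_var; rewrite ltnSn.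
- by move=> i i4; apply: keep_var.
- by move=> i p i4; apply: kill_step.
Qed.

Lemma kill_image_regular k (u : 'cV[S]_3) : (k < 3)%N ->
  kill_image k (('X_(inord (3 - k)) : S) *: u) -> kill_image k u.
Proof.
move=> k3; apply: (@kil_image_regular {mpoly K[4]} kill (fun k => 'X_(inord (3 - k))) 4).
- by move=> i j p; apply: kill_kill.
- by move=> i i4; apply: kill_var; rewrite ltnSn.
- by move=> i i4; apply: keep_var.
- by move=> i; apply: mpolyX_neq0.
- by move=> i p i4; apply: kill_step.
- exact: leq_trans k3 _.
by rewrite [\det _](detmxP phi); apply: kill_f4_neq0.
Qed.

(** Translates membership in (Y4, Y3, Y2) C into membership in the image of phi after
    killing variables. *)
Lemma in_ideal_mul_kill k (u : 'cV[S]_3) : (k <= 3)%N ->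
  in_ideal_mul (take k vars_seq) (cpi phi u) <-> kill_image k u.
Proof.
elim: k u => [|k IHk] u k3.
  rewrite take0 in_ideal_mul_nil cpi_eq0.
  have k0c v : @kil_col {mpoly K[4]} kill 3 0 v = v by apply/colP => i; rewrite mxE [LHS]kill0.
  have k0m : @kil_mx {mpoly K[4]} kill 3 0 phi = phi by apply/matrixP => i j; rewrite mxE [LHS]kill0.
  by split=> -[w E]; exists w; move: E; rewrite ?k0c ?k0m.
have vk : vars_seq`_k = reg_var k by case: (k) k3 => [|[|[|]]].
rewrite in_ideal_mul_takeS // vk kill_image_succ; last exact: leqW; split.
  move=> [n [u' [nI]]]; rewrite -[n]cpi_repr -[u']cpi_repr -cpiZ -cpiD => E.
  have /cpi_eq0[w Ew] : cpi phi (u - (repr n + 'X_(inord (3 - k)) *: repr u')) = 0.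
    by rewrite cpiB E subrr.
  exists (repr n), (repr u'), w; split; last by rewrite -[X in _ + X]Ew addrC subrK.
  by apply/(IHk _ (ltnW k3)); rewrite cpi_repr.
move=> [v [z [w [Iv ->]]]]; exists (cpi phi v), (cpi phi z); split.
  exact/(IHk _ (ltnW k3)).
rewrite !cpiD cpiZ; have -> : cpi phi ((phi : 'M[S]_3) *m w) = 0 by apply/cpi_eq0; exists w.
by rewrite addr0.
Qed.

Lemma vars_regular : regular_seq C vars_seq.
Proof.
split.
  move=> k k3 m; have vk : vars_seq`_k = reg_var k by case: (k) k3 => [|[|[|]]].
  rewrite -[m]cpi_repr vk -cpiZ => /in_ideal_mul_kill -/(_ (ltnW k3)) Im.
  apply/in_ideal_mul_kill; first exact: ltnW.
  exact: kill_image_regular Im.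
exists (cpi phi (delta_mx o30 0)); rewrite -[vars_seq](take_oversize (n := 3)) //.
move=> /in_ideal_mul_kill -/(_ isT)[w].
move=> /colP /(_ o30); rewrite !mxE !eqxx /= => /(congr1 (meval (fun=> 0))).
rewrite [kill 3 1]comp_mpoly1 meval1 (raddf_sum (meval _)) big1 => [/eqP|j _].
  by rewrite oner_eq0.
rewrite /= mevalM !mxE comp_mpoly_meval.
have -> : ((phi : 'M[S]_3) o30 j).@[fun i => (tnth (kill_tuple 3) i).@[fun=> 0]] = 0.
  rewrite (meval_eq (v2 := fun=> 0)) ?homog1_meval0 // => i.
  by rewrite tnth_mktuple; case: ifP => _; rewrite ?mevalXU ?meval0.
by rewrite mul0r.
Qed.

Lemma coker_MCM : is_MCM C.
Proof.
split; first by exists 3%N; eexists; exact: coker_generates.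
exists 3%N; first exact: R4_krull_dim.
split; last by move=> s [_ /R4_regular_size_le3]; apply.
exists vars_seq => //; split; last exact: vars_regular.
move=> r; rewrite !inE => rV; have [i ->] : exists i, r = R4_pi 'X_i.
  by case/or3P: rV => /eqP->; eexists; reflexivity.
exists (fun j => if j == i then 1 else 0).
by rewrite (bigD1 i) //= eqxx mul1r big1 ?addr0 // => j /negbTE->; rewrite mul0r.
Qed.
End LinearCokerMCM.

(** * Families of matrices and the lines they contract *)

Lemma rank_lt_kernel (K : fieldType) m n (A : 'M[K]_(m, n)) : (\rank A < m)%N ->
  exists2 y : 'rV_m, y != 0 & y *m A = 0.
Proof.
move=> rA; have : kermx A != 0.
  by rewrite kermx_eq0 /row_free neq_ltn rA.
by case/rowV0Pn => y /sub_kermxP yA y0; exists y.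
Qed.

Section Family.
Variable K : fieldType.
Implicit Types (Phi : 'I_4 -> 'M[K]_3) (y : 'rV[K]_4) (u : 'rV[K]_3) (v : 'cV[K]_3).

(** The family is regarded as a linear function on K^4. *)
Definition evf Phi y : 'M[K]_3 := \sum_t y 0 t *: Phi t.

Lemma evfD Phi y z : evf Phi (y + z) = evf Phi y + evf Phi z.
Proof. by rewrite -big_split; apply: eq_bigr => t _; rewrite mxE scalerDl. Qed.

Lemma evfZ Phi a y : evf Phi (a *: y) = a *: evf Phi y.
Proof. by rewrite scaler_sumr; apply: eq_bigr => t _; rewrite mxE scalerA. Qed.

Lemma evf0 Phi : evf Phi 0 = 0.
Proof. by rewrite /evf big1 // => t _; rewrite mxE scale0r. Qed.

Lemma evf_delta Phi t : evf Phi (delta_mx 0 t) = Phi t.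
Proof.
rewrite /evf (bigD1 t) //= mxE !eqxx scale1r big1 ?addr0 // => s st.
by rewrite mxE (negbTE st) andbF scale0r.
Qed.

(** When u is nonzero, the points y with Phi(y) v = 0 then form a space of dimension
    at least two, and similarly with u and v exchanged. *)
Definition orth Phi u v := forall t, u *m Phi t *m v = 0.

Lemma orth_evf Phi u v y : orth Phi u v -> u *m evf Phi y *m v = 0.
Proof.
move=> uv; rewrite mulmx_sumr mulmx_suml big1 // => t _.
by rewrite -scalemxAr -scalemxAl uv scaler0.
Qed.

(** For fixed v, the matrix of the linear map sending y to Phi(y) v. *)
Definition nmx Phi v : 'M[K]_(4, 3) := \matrix_(t, i) (Phi t *m v) i 0.

Lemma mul_nmx Phi y v : y *m nmx Phi v = (evf Phi y *m v)^T.
Proof.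
apply/rowP => i; rewrite mxE [RHS]mxE mulmx_suml summxE; apply: eq_bigr => t _.
by rewrite -scalemxAl !mxE.
Qed.

Lemma mul_nmx_eq0 Phi y v : y *m nmx Phi v = 0 <-> evf Phi y *m v = 0.
Proof. by rewrite mul_nmx; split=> [/(congr1 trmx)|->]; rewrite ?trmxK trmx0. Qed.

Lemma orth_nmx Phi u v : orth Phi u v <-> nmx Phi v *m u^T = 0.
Proof.
have E t : (nmx Phi v *m u^T) t 0 = (u *m Phi t *m v) 0 0.
  by rewrite -mulmxA !mxE; apply: eq_bigr => i _; rewrite !mxE mulrC.
split=> [uv|/colP nu t]; first by apply/colP => t; rewrite E uv !mxE.
by apply/matrixP => i j; rewrite !ord1 -E nu !mxE.
Qed.

Definition indep2 (y z : 'rV[K]_4) := forall a b, a *: y + b *: z = 0 -> a = 0 /\ b = 0.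

Lemma rank_indep2 (y z : 'rV[K]_4) : indep2 y z -> \rank (col_mx y z) = 2%N.
Proof.
move=> yz; apply/eqP; rewrite -[_ == _]/(row_free _) -kermx_eq0 -submx0.
apply/row_subP => i; rewrite submx0; set w := row i _.
have : w *m col_mx y z = 0 by rewrite -row_mul mulmx_ker row0.
rewrite -[w]hsubmxK mul_row_col.
rewrite [lsubmx w]mx11_scalar [rsubmx w]mx11_scalar !mul_scalar_mx => /yz[-> ->].
by rewrite !raddf0 row_mx0.
Qed.

(** If Phi(y) v vanishes on a line, the vectors Phi(y) v span a space of dimension at
    most two, which is orthogonal to some u. *)
Lemma kill_line_orth Phi v y z : indep2 y z ->
  evf Phi y *m v = 0 -> evf Phi z *m v = 0 -> exists2 u, u != 0 & orth Phi u v.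
Proof.
move=> /rank_indep2 yz /mul_nmx_eq0 yv /mul_nmx_eq0 zv.
have [|u u0 uE] := @rank_lt_kernel K _ _ (nmx Phi v)^T.
  have : col_mx y z *m nmx Phi v = 0 by rewrite mul_col_mx yv zv col_mx0.
  by move/mulmx0_rank_max; rewrite yz mxrank_tr; case: (\rank _) => [|[|[]]].
by exists u => //; apply/orth_nmx; apply: trmx_inj; rewrite trmx_mul trmxK uE trmx0.
Qed.

(** The map sending y to Phi(y) v has rank two at most, so its kernel contains a
    line; the line is given by a basis in reduced echelon form, whose pivots are the
    coordinates k and l. *)
Lemma orth_reduced_line Phi u v : u != 0 -> orth Phi u v ->
  exists k l, exists r s : 'rV[K]_4, [/\ k != l,
    evf Phi r *m v = 0, evf Phi s *m v = 0,
    r 0 k = 1 /\ r 0 l = 0 & s 0 k = 0 /\ s 0 l = 1].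
Proof.
move=> u0 /orth_nmx uN.
have rN : (\rank (nmx Phi v) <= 2)%N.
  have := mulmx0_rank_max uN; rewrite mxrank_tr rank_rV u0.
  by case: (\rank _) => [|[|[|]]] // n; rewrite addn1.
have [|y y0 /mul_nmx_eq0 yv] := @rank_lt_kernel K _ _ (nmx Phi v); first exact: leq_ltn_trans rN _.
have [l yl] := rV0Pn _ y0.
have [|z z0] := @rank_lt_kernel K _ _ (row_mx (nmx Phi v) (delta_mx l (0 : 'I_1))).
  rewrite -mxrank_tr tr_row_mx; apply: leq_ltn_trans (_ : 3 < 4)%N => //.
  rewrite -addsmxE; apply: leq_trans (mxrank_adds_leqif _ _) _; rewrite !mxrank_tr.
  by apply: leq_add rN _; rewrite mxrank_delta.
rewrite mul_mx_row -row_mx0 => /eq_row_mx[/mul_nmx_eq0 zv zl].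
have {}zl : z 0 l = 0 by move/matrixP/(_ 0 0): zl; rewrite -colE !mxE.
have [k zk] := rV0Pn _ z0.
have kl : k != l by apply: contraNneq zk => ->; rewrite zl.
exists k, l, ((z 0 k)^-1 *: z), ((y 0 l)^-1 *: (y - (y 0 k / z 0 k) *: z)).
split=> //; rewrite ?evfZ ?evfD -?scaleNr ?evfZ -?scalemxAl ?mulmxDl -?scalemxAl ?yv ?zv.
- by rewrite scaler0.
- by rewrite scaler0 addr0 scaler0.
- by rewrite !mxE zl mulr0 mulVf.
by rewrite !mxE zl mulr0 addr0 mulVf // mulNr divfK // subrr mulr0.
Qed.

End Family.

(** * Singular pencils of 3 x 3 matrices *)

(** For x an eigenvector of the pencil, the two forms x C1 and x C2 are proportional
    and so have a common zero. *)
Lemma bilinear2_common_zero (K : closedFieldType) (C1 C2 : 'M[K]_2) :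
  exists (x : 'rV_2) (y : 'cV_2), [/\ x != 0, y != 0, x *m C1 *m y = 0 & x *m C2 *m y = 0].
Proof.
have kery (w : 'rV[K]_2) : exists2 y : 'cV_2, y != 0 & w *m y = 0.
  have [|y y0 yw] := @rank_lt_kernel K _ _ w^T; first by rewrite mxrank_tr ltnS rank_leq_row.
  exists y^T; first by apply: contra_neq y0 => y0; rewrite -[y]trmxK y0 trmx0.
  by apply: trmx_inj; rewrite trmx_mul trmxK yw trmx0.
have [C2u|C2s] := boolP (C2 \in unitmx).
  have [mu] : exists mu, root (char_poly (C1 *m invmx C2)) mu.
    by apply/closed_rootP; rewrite size_char_poly.
  rewrite -eigenvalue_root_char => /eigenvalueP[x xE x0].
  have [y y0 Cy] := kery (x *m C2).
  exists x, y; split=> //.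
  have -> : x *m C1 = mu *: (x *m C2).
    by rewrite scalemxAl -xE mulmxA mulmxKV.
  by rewrite -scalemxAl Cy scaler0.
have [|x x0 xC2] := @rank_lt_kernel K _ _ C2.
  by rewrite ltn_neqAle rank_leq_row andbT; rewrite -row_free_unit in C2s.
have [y y0 Cy] := kery (x *m C1).
by exists x, y; split=> //; rewrite xC2 mul0mx.
Qed.

Section Pencils.
Variable K : fieldType.
Hypothesis charK : [pchar K] =i pred0.

(** Evaluation at 0, 1 and -1. *)
Lemma quadratic_fun_eq0 (a b c : K) :
  (forall s, a + s * b + s ^+ 2 * c = 0) -> [/\ a = 0, b = 0 & c = 0].
Proof.
move=> E; have a0 : a = 0 by have := E 0; rewrite expr0n /= !mul0r !addr0.
have n2 := natK_neq0 charK 1.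
have E1 : 2%:R * b = 0.
  have -> : 2%:R * b = (a + 1 * b + 1 ^+ 2 * c) - (a + -1 * b + (-1) ^+ 2 * c) by ring.
  by rewrite !E subrr.
have b0 : b = 0 by move/eqP: E1; rewrite mulf_eq0 (negbTE n2) => /eqP.
by split=> //; have := E 1; rewrite a0 b0 expr1n !mul1r !add0r.
Qed.

(** Evaluation at 1, -1 and 2. *)
Lemma cubic_fun_eq0 (b c d : K) :
  (forall s, s * b + s ^+ 2 * c + s ^+ 3 * d = 0) -> b = 0.
Proof.
move=> E; have n6 := natK_neq0 charK 5.
have : 6%:R * b = 0.
  have -> : 6%:R * b = 6%:R * (1 * b + 1 ^+ 2 * c + 1 ^+ 3 * d)
    - 2%:R * (-1 * b + (-1) ^+ 2 * c + (-1) ^+ 3 * d)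
    - (2%:R * b + 2%:R ^+ 2 * c + 2%:R ^+ 3 * d) by ring.
  by rewrite !E !mulr0 !subr0.
by move/eqP; rewrite mulf_eq0 (negbTE n6) => /eqP.
Qed.

Definition mx_seq m n (s : seq (seq K)) : 'M[K]_(m, n) :=
  \matrix_(i, j) (nth [::] s i)`_j.

Lemma row_free2 n (M : 'M[K]_(2, n)) :
  (forall a b, (forall j, a * M 0 j + b * M 1 j = 0) -> a = 0 /\ b = 0) -> row_free M.
Proof.
move=> H; rewrite -kermx_eq0 -submx0; apply/row_subP => i; rewrite submx0.
set w := row i _; have wM : w *m M = 0 by rewrite -row_mul mulmx_ker row0.
have [] := H (w 0 0) (w 0 1).
  move=> j; have /rowP /(_ j) := wM; rewrite mxE [RHS]mxE !big_ord_recl big_ord0 addr0.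
  have -> : lift ord0 ord0 = 1 :> 'I_2 by apply/val_inj.
  exact: id.
move=> w0 w1; apply/eqP/rowP => j; rewrite [RHS]mxE.
case: j => -[|[|//]] lj; [rewrite -[RHS]w0|rewrite -[RHS]w1]; congr (w _ _); by apply/val_inj.
Qed.

(** The three types of singular pencils: a common kernel, a common cokernel, or a
    common 2 x 2 zero block after a change of bases. *)
Definition compression (A B : 'M[K]_3) :=
  [\/ exists2 v : 'cV_3, v != 0 & A *m v = 0 /\ B *m v = 0,
      exists2 u : 'rV_3, u != 0 & u *m A = 0 /\ u *m B = 0
    | exists (U : 'M_(2, 3)) (V : 'M_(3, 2)),
        [/\ row_free U, row_free V^T, U *m A *m V = 0 & U *m B *m V = 0]].

(** Up to multiples of the preceding ones, the coefficients of the determinant in s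
    are the corner of B, the product c b of its border row and column, and c B' b
    with B' the 2 x 2 block of B. Their vanishing says that the plane spanned by (c,
    0) and e3 and the one spanned by (b, 0) and e3 give a zero block, unless b or c
    vanishes. *)
Lemma compression_pid (B : 'M[K]_3) :
  (forall s, \det (s *: pid_mx 2 + B) = 0) -> compression (pid_mx 2) B.
Proof.
move=> detB; set D := pid_mx 2.
have DE i j : D i j = ((i == j) && (i < 2)%N)%:R by rewrite mxE.
pose b0 := B o30 o32; pose b1 := B o31 o32.
pose c0 := B o32 o30; pose c1 := B o32 o31; pose be := B o32 o32.
pose B00 := B o30 o30; pose B01 := B o30 o31; pose B10 := B o31 o30; pose B11 := B o31 o31.
have := @quadratic_fun_eq0 (\det B) (be * (B00 + B11) - (c0 * b0 + c1 * b1)) be.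
case=> [s|detB0 lin be0].
  rewrite -[RHS](detB s) !det_mx33 /det3 !mxE /=.
  rewrite -/b0 -/b1 -/c0 -/c1 -/be -/B00 -/B01 -/B10 -/B11; ring.
move: lin; rewrite be0 mul0r sub0r => /eqP; rewrite oppr_eq0 => /eqP cb.
have cBb : c0 * (B00 * b0 + B01 * b1) + c1 * (B10 * b0 + B11 * b1) = 0.
  have -> : c0 * (B00 * b0 + B01 * b1) + c1 * (B10 * b0 + B11 * b1) =
    \det B - be * (B00 * B11 - B10 * B01) + (B00 + B11) * (c0 * b0 + c1 * b1).
    rewrite det_mx33 /det3 -/b0 -/b1 -/c0 -/c1 -/be -/B00 -/B01 -/B10 -/B11; ring.
  by rewrite detB0 be0 cb; ring.
have [/andP[/eqP b00 /eqP b10]|bn0] := boolP ((b0 == 0) && (b1 == 0)).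
  apply: Or31; exists (delta_mx o32 0).
    by apply/eqP => /matrixP /(_ o32 0); rewrite !mxE !eqxx => /eqP; rewrite oner_eq0.
  by rewrite -!colE; split; apply/colP; apply: ord3_ind; rewrite !mxE.
have [/andP[/eqP c00 /eqP c10]|cn0] := boolP ((c0 == 0) && (c1 == 0)).
  apply: Or32; exists (delta_mx 0 o32).
    by apply/eqP => /matrixP /(_ 0 o32); rewrite !mxE !eqxx => /eqP; rewrite oner_eq0.
  by rewrite -!rowE; split; apply/rowP; apply: ord3_ind; rewrite !mxE.
apply: Or33; exists (mx_seq 2 3 [:: [:: c0; c1; 0]; [:: 0; 0; 1]]).
exists (mx_seq 3 2 [:: [:: b0; 0]; [:: b1; 0]; [:: 0; 1]]); split.
- apply: row_free2 => x y H; have := H o32; have := H o31; have := H o30.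
  rewrite !mxE /= !mulr0 !addr0 mulr1 add0r => E0 E1 E2; split=> //.
  move: cn0; rewrite negb_and => /orP[] n0; [move/eqP: E0|move/eqP: E1];
  by rewrite mulf_eq0 (negbTE n0) orbF => /eqP.
- apply: row_free2 => x y H; have := H o32; have := H o31; have := H o30.
  rewrite !mxE /= !mulr0 !addr0 mulr1 add0r => E0 E1 E2; split=> //.
  move: bn0; rewrite negb_and => /orP[] n0; [move/eqP: E0|move/eqP: E1];
  by rewrite mulf_eq0 (negbTE n0) orbF => /eqP.
- apply/matrixP => i j; rewrite !mxE big_ord3 !mxE !big_ord3 !mxE /=.
  case: i j => -[|[|//]] li [[|[|//]] lj] /=; rewrite !(mulr0, mul0r, addr0, add0r, mulr1) //.
- apply/matrixP => i j; rewrite !mxE big_ord3 !mxE !big_ord3 !mxE /=.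
  rewrite -/b0 -/b1 -/c0 -/c1 -/be -/B00 -/B01 -/B10 -/B11 be0.
  case: i j => -[|[|//]] li [[|[|//]] lj] /=; rewrite !(mulr0, mul0r, addr0, add0r, mulr1) //.
    apply: (etrans _ cBb); ring.
  apply: (etrans _ cb); ring.
Qed.

Lemma compression_equiv (A B P Q : 'M[K]_3) : P \in unitmx -> Q \in unitmx ->
  compression (P *m A *m Q) (P *m B *m Q) -> compression A B.
Proof.
move=> Pu Qu.
have unit_inj (v : 'cV[K]_3) : P *m v = 0 -> v = 0.
  by move=> Pv; rewrite -[v](mulKmx Pu) Pv mulmx0.
have unit_injl (u : 'rV[K]_3) : u *m Q = 0 -> u = 0.
  by move=> uQ; rewrite -[u](mulmxK Qu) uQ mul0mx.
case=> [[v v0 [Av Bv]]|[u u0 [uA uB]]|[U [V [Uf Vf UAV UBV]]]].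
- apply: Or31; exists (Q *m v).
    by apply: contra_neq v0 => Qv; rewrite -[v](mulKmx Qu) Qv mulmx0.
  by split; apply: unit_inj; rewrite !mulmxA.
- apply: Or32; exists (u *m P).
    by apply: contra_neq u0 => uP; rewrite -[u](mulmxK Pu) uP mul0mx.
  by split; apply: unit_injl; rewrite -!mulmxA mulmxA -?mulmxA ?mulmxA in uA uB *.
apply: Or33; exists (U *m P), (Q *m V); split; rewrite ?mulmxA in UAV UBV * => //.
  by rewrite /row_free mxrankMfree // row_free_unit.
by rewrite /row_free trmx_mul mxrankMfree // row_free_unit unitmx_tr.
Qed.

Lemma compression_rank2 (A B : 'M[K]_3) : \rank A = 2%N ->
  (forall s, \det (s *: A + B) = 0) -> compression A B.
Proof.
move=> rA detAB; pose L := invmx (col_ebase A); pose R := invmx (row_ebase A).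
have Lu : L \in unitmx by rewrite unitmx_inv col_ebase_unit.
have Ru : R \in unitmx by rewrite unitmx_inv row_ebase_unit.
have LAR : L *m A *m R = pid_mx 2.
  rewrite -[A in L *m A](mulmx_ebase A) rA /L /R !mulmxA mulVmx ?col_ebase_unit // mul1mx.
  by rewrite mulmxK // row_ebase_unit.
apply: (compression_equiv Lu Ru); rewrite LAR; apply: compression_pid => s.
rewrite -LAR -[s *: _](_ : L *m (s *: A) *m R = _); last first.
  by rewrite -scalemxAr -scalemxAl.
by rewrite -mulmxDl -mulmxDr !det_mulmx detAB mulr0 mul0r.
Qed.

Lemma compression_sym (A B : 'M[K]_3) : compression A B -> compression B A.
Proof.
case=> [[v v0 [Av Bv]]|[u u0 [uA uB]]|[U [V [Uf Vf UAV UBV]]]].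
- by apply: Or31; exists v.
- by apply: Or32; exists u.
by apply: Or33; exists U, V.
Qed.

(** If neither A nor B has rank two, their ranks add up to at most two, so that they
    have a common cokernel. *)
Lemma singular_pencil_compression (A B : 'M[K]_3) :
  (forall s t, \det (s *: A + t *: B) = 0) -> compression A B.
Proof.
move=> detAB.
have rA : (\rank A < 3)%N.
  rewrite ltn_neqAle rank_leq_row andbT -[_ == _]/(row_free A) row_free_unit unitmxE.
  by have := detAB 1 0; rewrite scale1r scale0r addr0 => ->; rewrite unitr0.
have rB : (\rank B < 3)%N.
  rewrite ltn_neqAle rank_leq_row andbT -[_ == _]/(row_free B) row_free_unit unitmxE.
  by have := detAB 0 1; rewrite scale1r scale0r add0r => ->; rewrite unitr0.
have [rA2|rA2] := eqVneq (\rank A) 2%N.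
  by apply: compression_rank2 => // s; have := detAB s 1; rewrite scale1r.
have [rB2|rB2] := eqVneq (\rank B) 2%N.
  apply: compression_sym; apply: compression_rank2 => // s.
  by have := detAB 1 s; rewrite scale1r addrC.
have [|u u0 uE] := @rank_lt_kernel K _ _ (row_mx A B).
  rewrite -mxrank_tr tr_row_mx -addsmxE.
  apply: leq_ltn_trans (mxrank_adds_leqif _ _) _; rewrite !mxrank_tr.
  by move: rA rB rA2 rB2; case: (\rank A) => [|[|[|]]] //; case: (\rank B) => [|[|[|]]].
apply: Or32; exists u => //.
by move: uE; rewrite mul_mx_row -row_mx0 => /eq_row_mx.
Qed.

End Pencils.

(** * Orthogonal pairs of vectors *)

Lemma exists_unitmx_row0 (K : fieldType) n (u : 'rV[K]_n.+1) : u != 0 ->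
  exists2 P : 'M_n.+1, P \in unitmx & row ord0 P = u.
Proof.
move=> u0; have ru : \rank u = 1%N by rewrite rank_rV u0.
exists ((col_ebase u) 0 0 *: row_ebase u).
  rewrite unitmxZ ?row_ebase_unit // unitfE.
  have := col_ebase_unit u; rewrite {1}[col_ebase u]mx11_scalar unitmxE det_scalar1.
  by rewrite unitfE.
rewrite -[u in RHS](mulmx_ebase u) ru [col_ebase u in RHS]mx11_scalar mul_scalar_mx.
rewrite -scalemxAl linearZ /=; congr (_ *: _).
rewrite rowE; congr (_ *m _); apply/rowP => j; rewrite !mxE eqxx /=.
by rewrite eq_sym; case: j => -[].
Qed.

Definition pt4 (K : nzRingType) (s : seq K) : 'rV[K]_4 := \row_i s`_i.

Definition fermat_form (K : fieldType) (y : 'rV[K]_4) : K := \sum_t y 0 t ^+ 3.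

(** Phi is a determinantal representation of the Fermat cubic. *)
Definition det_fermat (K : fieldType) (Phi : 'I_4 -> 'M[K]_3) :=
  forall y, \det (evf Phi y) = fermat_form y.

Section Skew.
Variable K : fieldType.
Hypothesis charK : [pchar K] =i pred0.

(** The coefficient of t is the derivative of the form at z in the direction y. *)
Lemma fermat_form_line (z y : 'rV[K]_4) t : fermat_form (z + t *: y) =
  fermat_form z + t * (3%:R * \sum_i z 0 i ^+ 2 * y 0 i)
  + t ^+ 2 * (3%:R * \sum_i z 0 i * y 0 i ^+ 2) + t ^+ 3 * fermat_form y.
Proof.
rewrite /fermat_form !mulr_sumr -!big_split /=; apply: eq_bigr => i _.
by rewrite !mxE; ring.
Qed.

(** In bases starting with u and v, the matrix Phi(y) has a zero corner, and Phi(z)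
    has zero first row and column. Hence the determinant at z + t y has no term of
    degree one in t: the gradient of the form vanishes at z, and the Fermat cubic is
    smooth. *)
Lemma orth_skew (Phi : 'I_4 -> 'M[K]_3) u v z : det_fermat Phi -> u != 0 -> v != 0 ->
  orth Phi u v -> evf Phi z *m v = 0 -> u *m evf Phi z = 0 -> z = 0.
Proof.
move=> detPhi u0 v0 uv zv uz.
have [P Pu Prow] := exists_unitmx_row0 u0.
have [Q Qu Qrow] : exists2 Q : 'M_3, Q \in unitmx & col ord0 Q = v.
  have [|Q Qu Qrow] := @exists_unitmx_row0 K 2 v^T.
    by apply: contra_neq v0 => v0; rewrite -[v]trmxK v0 trmx0.
  by exists Q^T; rewrite ?unitmx_tr // -tr_row Qrow trmxK.
pose m y := P *m evf Phi y *m Q.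
have m0 y : m y ord0 ord0 = 0.
  transitivity ((u *m evf Phi y *m v) 0 0); last by rewrite orth_evf // mxE.
  by rewrite -Prow -Qrow -row_mul !mxE; apply: eq_bigr => k _; rewrite !mxE.
have mz0 j : m z ord0 j = 0.
  have : row ord0 (m z) = 0 by rewrite /m !row_mul Prow uz mul0mx.
  by move/rowP/(_ j); rewrite !mxE.
have mz1 i : m z i ord0 = 0.
  have : col ord0 (m z) = 0 by rewrite /m !colE -!mulmxA -colE Qrow zv mulmx0.
  by move/colP/(_ i); rewrite !mxE.
pose kap := \det P * \det Q.
have kap0 : kap != 0.
  by rewrite mulf_neq0 // -unitfE -unitmxE.
have detm y : \det (m y) = kap * fermat_form y.
  by rewrite !det_mulmx detPhi /kap mulrAC.
have mD y t : m (z + t *: y) = m z + t *: m y.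
  by rewrite /m evfD evfZ mulmxDr mulmxDl -scalemxAr -scalemxAl.
apply/rowP => k; rewrite mxE.
pose y : 'rV[K]_4 := delta_mx 0 k.
have fz : fermat_form z = 0.
  have := detm z; rewrite det_mx33 /det3.
  have -> : o30 = ord0 by apply/val_inj.
  rewrite !(mz0, mz1) !(mul0r, mulr0, subrr, addr0) => /esym/eqP.
  by rewrite mulf_eq0 (negbTE kap0) => /eqP.
(* The coefficients of t^2 and t^3 in the determinant. *)
pose al := - m y ord0 o31 * (m y o31 ord0 * m z o32 o32 - m z o31 o32 * m y o32 ord0)
  + m y ord0 o32 * (m y o31 ord0 * m z o32 o31 - m z o31 o31 * m y o32 ord0).
pose be := - m y ord0 o31 * (m y o31 ord0 * m y o32 o32 - m y o31 o32 * m y o32 ord0)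
  + m y ord0 o32 * (m y o31 ord0 * m y o32 o31 - m y o31 o31 * m y o32 ord0).
have E t : \det (m (z + t *: y)) = t ^+ 2 * al + t ^+ 3 * be.
  have mDe i j : m (z + t *: y) i j = m z i j + t * m y i j.
    by rewrite mD mxE [X in _ + X]mxE.
  rewrite det_mx33 /det3; have -> : o30 = ord0 by apply/val_inj.
  rewrite !mDe !(mz0, mz1, m0) /al /be.
  ring.
have := @cubic_fun_eq0 K charK (kap * (3%:R * \sum_i z 0 i ^+ 2 * y 0 i))
  (kap * (3%:R * \sum_i z 0 i * y 0 i ^+ 2) - al) (kap * fermat_form y - be).
case/(_ _)/Wrap => [t|/eqP].
  have := E t; rewrite detm fermat_form_line fz => H.
  rewrite !mulrBr -[X in _ = X](subrr (t ^+ 2 * al + t ^+ 3 * be)) -{1}H; ring.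
rewrite mulf_eq0 (negbTE kap0) mulf_eq0 (negbTE (natK_neq0 charK 2)) /=.
rewrite (bigD1 k) //= mxE !eqxx mulr1 big1 ?addr0; last first.
  by move=> i ik; rewrite mxE (negbTE ik) andbF mulr0.
by rewrite expf_eq0 => /eqP.
Qed.

End Skew.

Section Existence.
Variable K : closedFieldType.
Hypothesis charK : [pchar K] =i pred0.

(** Apply the classification of singular pencils to the restriction of Phi to the
    line through p and q on the surface. In the case of a zero block, the two
    remaining coordinates of the family give two bilinear forms on K^2, which have a
    common zero. *)
Lemma exists_orth (Phi : 'I_4 -> 'M[K]_3) : det_fermat Phi ->
  exists u v, [/\ u != 0, v != 0 & orth Phi u v].
Proof.
(* The line through p and q lies on the surface. *)
move=> detPhi; pose p : 'rV[K]_4 := pt4 [:: 1; -1; 0; 0]; pose q : 'rV[K]_4 := pt4 [:: 0; 0; 1; -1].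
have pq : indep2 p q.
  move=> a b /rowP E; have := E 0; have := E (@Ordinal 4 2 isT); rewrite !mxE /=.
  by rewrite !(mulr0, mulr1, addr0, add0r).
have det0 s t : \det (s *: evf Phi p + t *: evf Phi q) = 0.
  rewrite -!evfZ -evfD detPhi /fermat_form !big_ord_recl big_ord0 !mxE /=.
  ring.
have [[v v0 [pv qv]]|[u u0 [up uq]]|[U [V [Uf Vf Up Uq]]]] :=
  singular_pencil_compression charK det0.
- by have [u u0 uv] := kill_line_orth pq pv qv; exists u, v.
- have evfT y : evf (fun t => (Phi t)^T) y = (evf Phi y)^T.
    by rewrite /evf raddf_sum; apply: eq_bigr => t _; apply/matrixP => i j; rewrite !mxE.
  have [||u' u'0 uv] := @kill_line_orth K (fun t => (Phi t)^T) u^T p q pq.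
  + by rewrite evfT -trmx_mul up trmx0.
  + by rewrite evfT -trmx_mul uq trmx0.
  exists u, u'^T; split=> //.
    by apply: contra_neq u'0 => u'0; rewrite -[u']trmxK u'0 trmx0.
  by move=> t; apply: trmx_inj; rewrite !trmx_mul trmxK mulmxA uv trmx0.
pose r : 'rV[K]_4 := pt4 [:: 1; 0; 0; 0]; pose s : 'rV[K]_4 := pt4 [:: 0; 0; 1; 0].
have [x [y [x0 y0 xC1 xC2]]] := bilinear2_common_zero (U *m evf Phi r *m V) (U *m evf Phi s *m V).
exists (x *m U), (V *m y); split.
- by apply: contra_neq x0 => xU; apply: (row_free_inj Uf); rewrite /= xU mul0mx.
- apply: contra_neq y0 => Vy; apply: trmx_inj; apply: (row_free_inj Vf).
  by rewrite /= -trmx_mul Vy !trmx0 mul0mx.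
move=> t; rewrite -evf_delta; set z := delta_mx 0 t.
(* Any point is a combination of p, q and of the first and third coordinate vectors. *)
have -> : z = (z 0 0 + z 0 1) *: r - z 0 1 *: p + (z 0 (@Ordinal 4 2 isT) + z 0 (@Ordinal 4 3 isT)) *: s
    - z 0 (@Ordinal 4 3 isT) *: q.
  move: z => z; apply/rowP => -[[|[|[|[|//]]]] i]; rewrite ![in RHS]mxE /=;
  rewrite !(mulr0, mulr1, addr0, add0r, subr0, mulrN1, opprK, oppr0, addrK, sub0r);
  by congr (z _ _); apply/val_inj.
rewrite -!scaleNr !evfD !evfZ !mulmxDr !mulmxDl -!scalemxAr -!scalemxAl.
have gE M : x *m U *m M *m (V *m y) = x *m (U *m M *m V) *m y by rewrite !mulmxA.
by rewrite !gE xC1 xC2 Up Uq !(mulmx0, mul0mx, scaler0, addr0).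
Qed.
End Existence.

(** * Lines on the Fermat cubic surface *)

Section Lines.
Variable K : fieldType.
Hypothesis charK : [pchar K] =i pred0.

(** The coefficients of a^2 b and a b^2 give p^2 q + r^2 v = 0 and p q^2 + r v^2 = 0;
    together with 1 + q^3 + v^3 = 0 they force p or q to vanish. *)
Lemma fermat_line_slopes (p q r v : K) :
    (forall a b, a ^+ 3 + b ^+ 3 + (a * p + b * q) ^+ 3 + (a * r + b * v) ^+ 3 = 0) ->
  [/\ p = 0, v = 0, r ^+ 3 = -1 & q ^+ 3 = -1] \/
  [/\ q = 0, r = 0, p ^+ 3 = -1 & v ^+ 3 = -1].
Proof.
move=> E.
have n3 := natK_neq0 charK 2; have n6 := natK_neq0 charK 5.
have Epr : 1 + p ^+ 3 + r ^+ 3 = 0 by rewrite -[RHS](E 1 0); ring.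
have Eqv : 1 + q ^+ 3 + v ^+ 3 = 0 by rewrite -[RHS](E 0 1); ring.
have X1 : p ^+ 2 * q + r ^+ 2 * v = 0.
  apply: (mulfI n6); rewrite mulr0.
  have -> : 6%:R * (p ^+ 2 * q + r ^+ 2 * v) =
   (1 ^+ 3 + 1 ^+ 3 + (1 * p + 1 * q) ^+ 3 + (1 * r + 1 * v) ^+ 3)
   - (1 ^+ 3 + (-1) ^+ 3 + (1 * p + -1 * q) ^+ 3 + (1 * r + -1 * v) ^+ 3)
   - 2%:R * (1 + q ^+ 3 + v ^+ 3) by ring.
  by rewrite !E Eqv; ring.
have X2 : p * q ^+ 2 + r * v ^+ 2 = 0.
  apply: (mulfI n6); rewrite mulr0.
  have -> : 6%:R * (p * q ^+ 2 + r * v ^+ 2) =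
   (1 ^+ 3 + 1 ^+ 3 + (1 * p + 1 * q) ^+ 3 + (1 * r + 1 * v) ^+ 3)
   + (1 ^+ 3 + (-1) ^+ 3 + (1 * p + -1 * q) ^+ 3 + (1 * r + -1 * v) ^+ 3)
   - 2%:R * (1 + p ^+ 3 + r ^+ 3) by ring.
  by rewrite !E Epr; ring.
have cube_neq0 (x : K) : x ^+ 3 = -1 -> x != 0.
  by move=> x3; apply/eqP => x0; move/eqP: x3; rewrite x0 expr0n /= eq_sym oppr_eq0 oner_eq0.
have [p0|p0] := eqVneq p 0.
  left; have r3 : r ^+ 3 = -1 by apply/eqP; rewrite -addr_eq0 addrC -Epr p0; apply/eqP; ring.
  move/eqP: X1; rewrite p0 expr0n mul0r add0r mulf_eq0 expf_eq0 /= (negbTE (cube_neq0 _ r3)) /=.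
  move=> /eqP v0; split=> //; apply/eqP; rewrite -addr_eq0 addrC -Eqv v0; apply/eqP; ring.
have [q0|q0] := eqVneq q 0.
  right; have v3 : v ^+ 3 = -1 by apply/eqP; rewrite -addr_eq0 addrC -Eqv q0; apply/eqP; ring.
  move/eqP: X1; rewrite q0 mulr0 add0r mulf_eq0 expf_eq0 /= (negbTE (cube_neq0 _ v3)) orbF.
  move=> /eqP r0; split=> //; apply/eqP; rewrite -addr_eq0 addrC -Epr r0; apply/eqP; ring.
have r0 : r != 0.
  apply: contraNneq p0 => r0; move/eqP: X1.
  by rewrite r0 expr0n mul0r addr0 mulf_eq0 (negbTE q0) orbF expf_eq0.
have v0 : v != 0.
  apply: contraNneq p0 => v0; move/eqP: X1.
  by rewrite v0 mulr0 addr0 mulf_eq0 (negbTE q0) orbF expf_eq0.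
have rq : r * q = v * p.
  apply: (mulfI (mulf_neq0 r0 v0)).
  have -> : r * v * (r * q) = (p ^+ 2 * q + r ^+ 2 * v) * q - (p * q ^+ 2 + r * v ^+ 2) * p
     + r * v * (v * p) by ring.
  by rewrite X1 X2; ring.
have : p ^+ 2 * (1 + q ^+ 3 + v ^+ 3) - q ^+ 2 * (p ^+ 2 * q + r ^+ 2 * v) = p ^+ 2.
  have -> : q ^+ 2 * (p ^+ 2 * q + r ^+ 2 * v) = q ^+ 3 * p ^+ 2 + (r * q) ^+ 2 * v by ring.
  by rewrite rq; ring.
by rewrite Eqv X1 !mulr0 subrr => /esym/eqP; rewrite expf_eq0 (negbTE p0).
Qed.

Definition o40 := @Ordinal 4 0 isT.
Definition o41 := @Ordinal 4 1 isT.
Definition o42 := @Ordinal 4 2 isT.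
Definition o43 := @Ordinal 4 3 isT.

Lemma ord4_ind (P : 'I_4 -> Prop) : P o40 -> P o41 -> P o42 -> P o43 -> forall i, P i.
Proof.
move=> P0 P1 P2 P3 [[|[|[|[|//]]]] lti].
- by have -> : Ordinal lti = o40 by apply/val_inj.
- by have -> : Ordinal lti = o41 by apply/val_inj.
- by have -> : Ordinal lti = o42 by apply/val_inj.
- by have -> : Ordinal lti = o43 by apply/val_inj.
Qed.

Lemma big_ord4 (V : nmodType) (F : 'I_4 -> V) : \sum_i F i = F o40 + F o41 + F o42 + F o43.
Proof.
rewrite !big_ord_recl big_ord0 addr0 !addrA.
by congr (F _ + F _ + F _ + F _); apply/val_inj.
Qed.

(** W meets the edge of the coordinate tetrahedron joining the vertices a and b in a
    point of the surface. *)
Definition root_point (W : 'rV[K]_4 -> Prop) (a b : 'I_4) :=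
  exists2 c, c ^+ 3 = -1 & W (c *: delta_mx 0 a + delta_mx 0 b).

Lemma root_pointC (W : 'rV[K]_4 -> Prop) a b :
  (forall c y, W y -> W (c *: y)) -> root_point W a b -> root_point W b a.
Proof.
move=> WZ [c c3 Wc]; have c0 : c != 0.
  by apply/eqP => c0; move/eqP: c3; rewrite c0 expr0n /= eq_sym oppr_eq0 oner_eq0.
exists c^-1; first by rewrite exprVn c3 invrN1.
have := WZ c^-1 _ Wc; rewrite scalerDr scalerA mulVf // scale1r addrC.
by [].
Qed.

(** So a line on the surface joins two points of this kind, for complementary pairs
    of coordinates: there are 3 * 3 * 3 = 27 such lines. *)
Lemma line_root_points (W : 'rV[K]_4 -> Prop) k l (r s : 'rV[K]_4) :
    k != l -> (forall c y, W y -> W (c *: y)) -> W r -> W s ->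
    r 0 k = 1 -> r 0 l = 0 -> s 0 k = 0 -> s 0 l = 1 ->
    (forall a b, fermat_form (a *: r + b *: s) = 0) ->
  [\/ root_point W o40 o41 /\ root_point W o42 o43,
      root_point W o40 o42 /\ root_point W o41 o43 |
      root_point W o40 o43 /\ root_point W o41 o42].
Proof.
move=> kl WZ Wr Ws rk rl sk sl F.
suff [m [n [mn [Rk Rl]]]] : exists m n, uniq [:: k; l; m; n] /\
    root_point W m k /\ root_point W n l.
  have C a b := @root_pointC W a b WZ.
  move: mn Rk Rl; clear -C.
  elim/ord4_ind: k; elim/ord4_ind: l; elim/ord4_ind: m; elim/ord4_ind: n => //= _ Rk Rl;
  solve [by apply: Or31; split; auto | by apply: Or32; split; auto | by apply: Or33; split; auto].
have [m [n mn]] : exists m n, uniq [:: k; l; m; n].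
  move: kl; clear; elim/ord4_ind: k; elim/ord4_ind: l => //= _;
  solve [by exists o40, o41 | by exists o40, o42 | by exists o40, o43 | by exists o41, o42 |
   by exists o41, o43 | by exists o42, o43].
have fE y : fermat_form y = y 0 k ^+ 3 + y 0 l ^+ 3 + y 0 m ^+ 3 + y 0 n ^+ 3.
  rewrite /fermat_form big_ord4; move: mn; clear.
  by elim/ord4_ind: k; elim/ord4_ind: l; elim/ord4_ind: m; elim/ord4_ind: n => //= _; ring.
have yE (y : 'rV[K]_4) : y = y 0 k *: delta_mx 0 k + y 0 l *: delta_mx 0 l +
   y 0 m *: delta_mx 0 m + y 0 n *: delta_mx 0 n.
  apply/rowP => j; rewrite !mxE; move: mn; clear.
  elim/ord4_ind: k; elim/ord4_ind: l; elim/ord4_ind: m; elim/ord4_ind: n => //= _;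
  by elim/ord4_ind: j; rewrite /= !(mulr0, mulr1, addr0, add0r).
have [|[p0 v0 r3 q3]|[q0 r0 p3 v3]] := @fermat_line_slopes (r 0 m) (s 0 m) (r 0 n) (s 0 n).
- by move=> a b; rewrite -[RHS](F a b) fE !mxE rk rl sk sl; ring.
- exists n, m; split.
    by move: mn; clear; elim/ord4_ind: k; elim/ord4_ind: l; elim/ord4_ind: m; elim/ord4_ind: n.
  split; [exists (r 0 n) => // | exists (s 0 m) => //].
    by move: Wr; rewrite [r in W r]yE rk rl p0 !scale0r scale1r !addr0 addrC.
  by move: Ws; rewrite [s in W s]yE sk sl v0 !scale0r scale1r addr0 add0r addrC.
exists m, n; split=> //; split; [exists (r 0 m) => // | exists (s 0 n) => //].
  by move: Wr; rewrite [r in W r]yE rk rl r0 !scale0r scale1r !addr0 addrC.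
by move: Ws; rewrite [s in W s]yE sk sl q0 !scale0r scale1r addr0 add0r addrC.
Qed.

End Lines.

(** * Two disjoint lines determine the family *)

Section Uniqueness.
Variable K : fieldType.
Hypothesis charK : [pchar K] =i pred0.
Implicit Types (Phi Psi A : 'I_4 -> 'M[K]_3).

(** The first row of the matrix at y is (0, y0, y1) and the first column is (0, y2,
    y3). *)
Definition normal_border A := forall (t : 'I_4) (i : 'I_3),
  A t o30 i = (((t == o40) && (i == o31)) || ((t == o41) && (i == o32)))%:R /\
  A t i o30 = (((t == o42) && (i == o31)) || ((t == o43) && (i == o32)))%:R.

Lemma evf_entry A y i j : evf A y i j = y 0 o40 * A o40 i j + y 0 o41 * A o41 i j +
  y 0 o42 * A o42 i j + y 0 o43 * A o43 i j.
Proof. by rewrite /evf summxE big_ord4 !mxE. Qed.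

(** With such a border, the determinant is bilinear in the border and linear in the 2
    x 2 block. *)
Lemma normal_det A y : normal_border A -> \det (evf A y) =
  y 0 o41 * (y 0 o42 * evf A y o32 o31 - y 0 o43 * evf A y o31 o31)
  - y 0 o40 * (y 0 o42 * evf A y o32 o32 - y 0 o43 * evf A y o31 o32).
Proof.
move=> nA; rewrite det_mx33 /det3.
have row0 i : evf A y o30 i = (if i == o31 then y 0 o40 else if i == o32 then y 0 o41 else 0).
  rewrite evf_entry !(proj1 (nA _ i)); elim/ord3_ind: i => /=; ring.
have col0 i : evf A y i o30 = (if i == o31 then y 0 o42 else if i == o32 then y 0 o43 else 0).
  rewrite evf_entry !(proj2 (nA _ i)); elim/ord3_ind: i => /=; ring.
rewrite row0 /= !row0 !col0 /=; ring.
Qed.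

(** The linear syzygies of the four products y z, y w, x z, x w are generated by the
    obvious ones. *)
Lemma linear4_syzygy (a b c d : 'I_4 -> K) :
    (forall x y z w : K,
      y * (z * (x * a o40 + y * a o41 + z * a o42 + w * a o43)
           - w * (x * b o40 + y * b o41 + z * b o42 + w * b o43))
      - x * (z * (x * c o40 + y * c o41 + z * c o42 + w * c o43)
           - w * (x * d o40 + y * d o41 + z * d o42 + w * d o43)) = 0) ->
  exists c1 c2 e1 e2 : K,
    [/\ forall t, a t = (if t == o40 then c2 else 0) + (if t == o43 then e1 else 0),
        forall t, b t = (if t == o40 then c1 else 0) + (if t == o42 then e1 else 0),
        forall t, c t = (if t == o41 then c2 else 0) + (if t == o43 then e2 else 0)
      & forall t, d t = (if t == o41 then c1 else 0) + (if t == o42 then e2 else 0)].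
Proof.
move=> E; have n2 := natK_neq0 charK 1.
have pair0 (u v : K) : u + v = 0 -> u - v = 0 -> u = 0 /\ v = 0.
  move=> uv1 uv2; have u0 : u = 0.
    have : 2%:R * u = 0 by rewrite -[RHS]addr0 -{1}uv1 -uv2; ring.
    by move/eqP; rewrite mulf_eq0 (negbTE n2) => /eqP.
  by split=> //; rewrite -uv1 u0 add0r.
have [a1 a2] : a o41 = 0 /\ a o42 = 0.
  by apply: pair0; [rewrite -[RHS](E 0 1 1 0) | rewrite -[RHS]oppr0 -[in RHS](E 0 1 (-1) 0)]; ring.
have [b1 b3] : b o41 = 0 /\ b o43 = 0.
  by apply: pair0; [rewrite -[RHS]oppr0 -[in RHS](E 0 1 0 1) | rewrite -[RHS](E 0 1 0 (-1))]; ring.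
have [c0 c2] : c o40 = 0 /\ c o42 = 0.
  by apply: pair0; [rewrite -[RHS]oppr0 -[in RHS](E 1 0 1 0) | rewrite -[RHS](E 1 0 (-1) 0)]; ring.
have [d0 d3] : d o40 = 0 /\ d o43 = 0.
  by apply: pair0; [rewrite -[RHS](E 1 0 0 1) | rewrite -[RHS]oppr0 -[in RHS](E 1 0 0 (-1))]; ring.
have c1 : c o41 = a o40.
  apply/esym/subr0_eq; have := E 1 1 1 0; rewrite a1 a2 c0 c2 => <-; ring.
have d1 : d o41 = b o40.
  apply/subr0_eq; have := E 1 1 0 1; rewrite b1 b3 d0 d3 => <-; ring.
have d2 : d o42 = c o43.
  apply/subr0_eq; have := E 1 0 1 1; rewrite c0 c2 d0 d3 => <-; ring.
have b2 : b o42 = a o43.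
  apply/esym/subr0_eq; have := E 0 1 1 1; rewrite a1 a2 b1 b3 => <-; ring.
exists (b o40), (a o40), (a o43), (c o43).
by split; elim/ord4_ind; rewrite /= ?addr0 ?add0r.
Qed.

(** Row and column operations by such matrices keep the border and change the 2 x 2
    block by the obvious syzygies. *)
Definition lower3 (c1 c2 : K) : 'M[K]_3 :=
  mx_seq 3 3 [:: [:: 1; 0; 0]; [:: c1; 1; 0]; [:: c2; 0; 1]].

Lemma lower3_unit c1 c2 : lower3 c1 c2 \in unitmx.
Proof.
rewrite unitmxE det_mx33 /det3 !mxE /= (_ : _ + _ = 1) ?unitr1 //; ring.
Qed.

(** Two families with the same border and the same determinant differ in the 2 x 2
    block by a syzygy of linear4_syzygy; the four parameters of the syzygy are row
    and column operations. *)
Lemma normal_border_unique A B : normal_border A -> normal_border B ->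
    (forall y, \det (evf A y) = \det (evf B y)) ->
  exists P Q, [/\ P \in unitmx, Q \in unitmx & forall t, P *m A t = B t *m Q].
Proof.
move=> nA nB detAB.
have [x y z w|c1 [c2 [e1 [e2 [Ea Eb Ec Ed]]]]] := @linear4_syzygy
  (fun t => B t o32 o31 - A t o32 o31) (fun t => B t o31 o31 - A t o31 o31)
  (fun t => B t o32 o32 - A t o32 o32) (fun t => B t o31 o32 - A t o31 o32).
  pose p : 'rV[K]_4 := pt4 [:: x; y; z; w].
  have := detAB p; rewrite (normal_det _ nA) (normal_det _ nB) !evf_entry !mxE /= => /eqP.
  by rewrite eq_sym -subr_eq0 => /eqP <-; ring.
(* c1, c2 add multiples of the first row, e1, e2 multiples of the first column. *)
exists (lower3 c1 c2), (lower3 (- e1) (- e2))^T; split.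
- exact: lower3_unit.
- by rewrite unitmx_tr lower3_unit.
move=> t.
have A0 k := proj1 (nA t k); have A1 k := proj2 (nA t k).
have B0 k := proj1 (nB t k); have B1 k := proj2 (nB t k).
have shift (u v w : K) : v - u = w -> v = u + w by move=> <-; rewrite addrC subrK.
have {}Ea := shift _ _ _ (Ea t); have {}Eb := shift _ _ _ (Eb t).
have {}Ec := shift _ _ _ (Ec t); have {}Ed := shift _ _ _ (Ed t).
apply/matrixP => i j; rewrite [LHS]mxE [RHS]mxE !big_ord3.
rewrite ![lower3 _ _ _ _]mxE ![(lower3 _ _)^T _ _]mxE ![lower3 _ _ _ _]mxE.
elim/ord3_ind: i; elim/ord3_ind: j; rewrite /= ?(A0, A1, B0, B1, Ea, Eb, Ec, Ed);
  clear -t; elim/ord4_ind: t; rewrite /=; ring.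
Qed.

End Uniqueness.

Section NormalForm.
Variable K : fieldType.
Hypothesis charK : [pchar K] =i pred0.
Implicit Types (Phi Psi : 'I_4 -> 'M[K]_3) (u : 'rV[K]_3) (v : 'cV[K]_3).

Lemma row_free_kernel m n (B : 'M[K]_(m, n)) :
  (forall x : 'rV_m, x *m B = 0 -> x = 0) -> row_free B.
Proof.
move=> H; rewrite -kermx_eq0; apply/eqP/row_matrixP => i.
by rewrite row0; apply: H; rewrite -row_mul mulmx_ker row0.
Qed.

Lemma evfT Phi y : evf (fun t => (Phi t)^T) y = (evf Phi y)^T.
Proof.
by rewrite /evf raddf_sum; apply: eq_bigr => t _; apply/matrixP => i j; rewrite !mxE.
Qed.

Lemma det_fermatT Phi : det_fermat Phi -> det_fermat (fun t => (Phi t)^T).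
Proof. by move=> dP y; rewrite evfT det_tr. Qed.

Lemma orthT Phi u v : orth Phi u v -> orth (fun t => (Phi t)^T) v^T u^T.
Proof. by move=> uv t; apply: trmx_inj; rewrite !trmx_mul !trmxK mulmxA uv trmx0. Qed.

Lemma trmx_neq0 m n (A : 'M[K]_(m, n)) : A != 0 -> A^T != 0.
Proof. by apply: contra_neq => A0; rewrite -[A]trmxK A0 trmx0. Qed.

(** The data from which Phi is reconstructed: two orthogonal vectors and the lines
    along which Phi kills them. *)
Definition contracts Phi u v (p1 p2 q1 q2 : 'rV[K]_4) :=
  [/\ u != 0, v != 0, orth Phi u v,
      evf Phi p1 *m v = 0 /\ evf Phi p2 *m v = 0
    & u *m evf Phi q1 = 0 /\ u *m evf Phi q2 = 0].

Lemma contractsT Phi u v p1 p2 q1 q2 : contracts Phi u v p1 p2 q1 q2 ->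
  contracts (fun t => (Phi t)^T) v^T u^T q1 q2 p1 p2.
Proof.
move=> [u0 v0 uv [p1v p2v] [q1u q2u]].
split; rewrite ?trmx_neq0 //; first exact: orthT.
  by rewrite !evfT -!trmx_mul q1u q2u trmx0.
by rewrite !evfT -!trmx_mul p1v p2v trmx0.
Qed.

(** The vector v is completed to a basis Q in which the functionals u Phi(p1) and u
    Phi(p2), both orthogonal to v, are coordinates. They are independent because the
    two lines do not meet (orth_skew). *)
Lemma border_basis Phi u v p1 p2 q1 q2 : det_fermat Phi ->
    contracts Phi u v p1 p2 q1 q2 -> indep2 p1 p2 ->
  exists2 Q : 'M_3, Q \in unitmx & [/\ col o30 Q = v,
    u *m evf Phi p1 *m Q = delta_mx 0 o31 & u *m evf Phi p2 *m Q = delta_mx 0 o32].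
Proof.
move=> dPhi [u0 v0 uv [p1v p2v] _] p12.
have [w wv] : exists w : 'rV_3, w *m v = 1.
  have [k vk] : exists k, v k 0 != 0.
    apply: contrapT => nk; case/eqP: v0; apply/colP => k; rewrite mxE.
    by apply: contrapT => /eqP vk; apply: nk; exists k.
  exists ((v k 0)^-1 *: delta_mx 0 k); rewrite -scalemxAl -rowE.
  by apply/matrixP => i j; rewrite !ord1 !mxE mulVf // eqxx.
pose rw (i : 'I_3) := if i == o30 then w else if i == o31 then u *m evf Phi p1 else u *m evf Phi p2.
pose B : 'M_3 := \matrix_i rw i.
have xB (x : 'rV_3) : x *m B = x 0 o30 *: w + x 0 o31 *: (u *m evf Phi p1) + x 0 o32 *: (u *m evf Phi p2).
  by rewrite mulmx_sum_row big_ord3 !rowK.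
have uevf y : u *m evf Phi y *m v = 0 by exact: orth_evf.
have Bu : B \in unitmx.
  rewrite -row_free_unit; apply: row_free_kernel => x; rewrite xB => E.
  have x0 : x 0 o30 = 0.
    have := congr1 (mulmx^~ v) E.
    rewrite !mulmxDl -!scalemxAl !uevf !scaler0 !addr0 wv mul0mx.
    by move/matrixP/(_ 0 0); rewrite !mxE eqxx mulr1.
  pose z := x 0 o31 *: p1 + x 0 o32 *: p2.
  have z0 : z = 0.
    apply: (orth_skew charK dPhi u0 v0 uv); rewrite /z evfD !evfZ.
      by rewrite mulmxDl -!scalemxAl p1v p2v !scaler0 addr0.
    by rewrite mulmxDr -!scalemxAr; move: E; rewrite x0 scale0r add0r.
  have [x1 x2] := p12 _ _ z0.
  by apply/rowP; elim/ord3_ind; rewrite mxE.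
have BQ : B *m invmx B = 1%:M by rewrite mulmxV.
have rowBQ i : rw i *m invmx B = delta_mx 0 i.
  by rewrite -[rw i](rowK rw) -row_mul BQ row1.
exists (invmx B); first by rewrite unitmx_inv.
split; last 2 first.
- exact: (rowBQ o31).
- exact: (rowBQ o32).
have Bv : B *m v = delta_mx o30 0.
  apply/row_matrixP => i; rewrite row_mul rowK /rw.
  by elim/ord3_ind: i => /=; rewrite ?uevf ?wv; apply/matrixP => a b; rewrite !ord1 !mxE.
by rewrite colE -Bv mulmxA mulVmx // mul1mx.
Qed.

Lemma contracts_spans Phi u v p1 p2 q1 q2 : det_fermat Phi ->
    contracts Phi u v p1 p2 q1 q2 -> indep2 p1 p2 -> indep2 q1 q2 ->
  forall y, exists a b c d, y = a *: p1 + b *: p2 + c *: q1 + d *: q2.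
Proof.
move=> dPhi [u0 v0 uv [p1v p2v] [q1u q2u]] p12 q12.
pose rw (i : 'I_4) := if i == o40 then p1 else if i == o41 then p2 else if i == o42 then q1 else q2.
pose B : 'M_4 := \matrix_i rw i.
have xB (x : 'rV_4) : x *m B = x 0 o40 *: p1 + x 0 o41 *: p2 + x 0 o42 *: q1 + x 0 o43 *: q2.
  by rewrite mulmx_sum_row big_ord4 !rowK.
have Bu : B \in unitmx.
  rewrite -row_free_unit; apply: row_free_kernel => x; rewrite xB => E.
  pose z := x 0 o40 *: p1 + x 0 o41 *: p2.
  have zE : z = - (x 0 o42 *: q1 + x 0 o43 *: q2).
    by apply/eqP; rewrite -addr_eq0 addrA; apply/eqP.
  have z0 : z = 0.
    apply: (orth_skew charK dPhi u0 v0 uv).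
      by rewrite /z evfD !evfZ mulmxDl -!scalemxAl p1v p2v !scaler0 addr0.
    rewrite zE -scaleN1r evfZ evfD !evfZ -scalemxAr mulmxDr -!scalemxAr q1u q2u.
    by rewrite !scaler0 addr0 scaler0.
  have [x1 x2] := p12 _ _ z0; move/esym/eqP: zE; rewrite z0 oppr_eq0 => /eqP /q12[x3 x4].
  by apply/rowP; elim/ord4_ind; rewrite mxE.
by move=> y; rewrite -[y](mulmxKV Bu) xB; do 4 eexists.
Qed.

Definition basis4 (p1 p2 q1 q2 : 'rV[K]_4) (t : 'I_4) : 'rV[K]_4 :=
  if t == o40 then p1 else if t == o41 then p2 else if t == o42 then q1 else q2.

(** Coordinates with respect to p1, p2, q1, q2, and the bases given by border_basis
    for Phi and its transpose. The diagonal matrices D1 and D2 rescale the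
    determinant of the change of bases to 1 without changing the border. *)
Lemma normal_form Phi u v p1 p2 q1 q2 : det_fermat Phi ->
    contracts Phi u v p1 p2 q1 q2 -> indep2 p1 p2 -> indep2 q1 q2 ->
  let b := basis4 p1 p2 q1 q2 in
  exists P Q, let A t := P *m evf Phi (b t) *m Q in
    [/\ P \in unitmx, Q \in unitmx, normal_border A &
        forall x, \det (evf A x) = fermat_form (\sum_t x 0 t *: b t)].
Proof.
move=> dPhi cPhi p12 q12 b.
have [Q Qu [Q0 Q1 Q2]] := border_basis dPhi cPhi p12.
have [PT PTu [P0 P1 P2]] := border_basis (det_fermatT dPhi) (contractsT cPhi) q12.
have [u0 v0 uv [p1v p2v] [q1u q2u]] := cPhi.
pose P := PT^T; have Pu : P \in unitmx by rewrite unitmx_tr.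
have Pu0 : row o30 P = u by rewrite /P -tr_col P0 trmxK.
have Pq1 : P *m evf Phi q1 *m v = delta_mx o31 0.
  by apply: trmx_inj; rewrite !trmx_mul trmxK trmx_delta -P1 evfT mulmxA.
have Pq2 : P *m evf Phi q2 *m v = delta_mx o32 0.
  by apply: trmx_inj; rewrite !trmx_mul trmxK trmx_delta -P2 evfT mulmxA.
(* D1 multiplies the first row by s, D2 divides the last two columns by s: the border
   is unchanged and the determinant is divided by s. *)
pose s := \det P * \det Q.
have s0 : s != 0 by rewrite mulf_neq0 // -unitfE -unitmxE.
pose D1 : 'M[K]_3 := diag_mx (\row_i if i == o30 then s else 1).
pose D2 : 'M[K]_3 := diag_mx (\row_i if i == o30 then 1 else s^-1).
have det1 : \det D1 = s.
  by rewrite det_diag !big_ord_recl big_ord0 !mxE /= !mulr1.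
have det2 : \det D2 = s^-1 ^+ 2.
  by rewrite det_diag !big_ord_recl big_ord0 !mxE /= mulr1 mul1r.
exists (D1 *m P), (Q *m D2); move=> A.
have AE t i j : A t i j = (if i == o30 then s else 1) * (P *m evf Phi (b t) *m Q) i j *
    (if j == o30 then 1 else s^-1).
  have -> : A t = D1 *m (P *m evf Phi (b t) *m Q) *m D2 by rewrite /A !mulmxA.
  move: (P *m evf Phi (b t) *m Q) => M.
  rewrite /D2 mul_mx_diag [LHS]mxE [X in _ * X]mxE; congr (_ * _).
  by rewrite /D1 mul_diag_mx [LHS]mxE [X in X * _]mxE.
have row0 t i : (P *m evf Phi (b t) *m Q) o30 i = (u *m evf Phi (b t) *m Q) 0 i.
  by rewrite -Pu0 -!row_mul [RHS]mxE.
have col0 t i : (P *m evf Phi (b t) *m Q) i o30 = (P *m evf Phi (b t) *m v) i 0.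
  by rewrite -Q0 colE mulmxA -colE [RHS]mxE.
split.
- by rewrite unitmxE det_mulmx det1 unitrM unitfE s0 -unitmxE.
- by rewrite unitmxE det_mulmx det2 unitrM -unitmxE Qu unitfE expf_neq0 // invr_eq0.
- move=> t i; rewrite !AE row0 col0; split.
    elim/ord4_ind: t; rewrite /b /basis4 /= ?Q1 ?Q2 ?q1u ?q2u ?mul0mx ?[_ 0 i]mxE ?eqxx /=;
    elim/ord3_ind: i; rewrite /= ?(mulr0, mul0r, mulr1) ?divff //.
  elim/ord4_ind: t; rewrite /b /basis4 /= -?mulmxA ?p1v ?p2v ?mulmx0 ?mulmxA ?Pq1 ?Pq2 ?[_ i 0]mxE ?eqxx /=;
  elim/ord3_ind: i; rewrite /= ?(mulr0, mul0r, mulr1) ?divff //.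
move=> x; have -> : evf A x = D1 *m P *m evf Phi (\sum_t x 0 t *: b t) *m (Q *m D2).
  rewrite (big_morph (evf Phi) (evfD Phi) (evf0 Phi)) mulmx_sumr mulmx_suml.
  by apply: eq_bigr => t _; rewrite evfZ -scalemxAr -scalemxAl.
rewrite !det_mulmx det1 det2 dPhi expr2.
have -> : forall f, s * \det P * f * (\det Q * (s^-1 * s^-1)) = (s / s) * (s / s) * f.
  move=> f; transitivity (s * (\det P * \det Q) * s^-1 * s^-1 * f); first by ring.
  by rewrite -/s; ring.
by rewrite divff // !mul1r.
Qed.

(** Both families have the same normal border and, in the coordinates adapted to the
    two lines, the same determinant. *)
Lemma contracts_unique Phi Psi u v u' v' p1 p2 q1 q2 :
    det_fermat Phi -> det_fermat Psi -> indep2 p1 p2 -> indep2 q1 q2 ->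
    contracts Phi u v p1 p2 q1 q2 -> contracts Psi u' v' p1 p2 q1 q2 ->
  exists P Q, [/\ P \in unitmx, Q \in unitmx & forall t, P *m Phi t = Psi t *m Q].
Proof.
move=> dPhi dPsi p12 q12 cPhi cPsi.
have [P1 [Q1 [P1u Q1u nA detA]]] := normal_form dPhi cPhi p12 q12.
have [P2 [Q2 [P2u Q2u nB detB]]] := normal_form dPsi cPsi p12 q12.
have [x|P [Q [Pu Qu PQ]]] := normal_border_unique charK nA nB; first by rewrite detA detB.
exists (invmx P2 *m P *m P1), (Q2 *m Q *m invmx Q1); split.
- by rewrite !unitmx_mul unitmx_inv P2u Pu.
- by rewrite !unitmx_mul unitmx_inv Q2u Qu.
have Eb t : invmx P2 *m P *m P1 *m evf Phi (basis4 p1 p2 q1 q2 t) =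
   evf Psi (basis4 p1 p2 q1 q2 t) *m (Q2 *m Q *m invmx Q1).
  have := congr1 (fun M => invmx P2 *m M *m invmx Q1) (PQ t).
  rewrite !mulmxA mulVmx // mul1mx => <-.
  by rewrite mulmxK.
move=> t; rewrite -[Phi t]evf_delta -[Psi t]evf_delta.
have [a [b [c [d ->]]]] := contracts_spans dPhi cPhi p12 q12 (delta_mx 0 t).
rewrite !evfD !evfZ !mulmxDr !mulmxDl -!scalemxAr -!scalemxAl.
by rewrite (Eb o40) (Eb o41) (Eb o42) (Eb o43).
Qed.
End NormalForm.

(** * Linear matrices as families of constant matrices *)

Section Coefficients.
Variable K : fieldType.
Local Notation S := (S4 K).
Implicit Types (phi psi : 'M[S]_3) (P Q : 'M[K]_3).

Definition coefmx phi (t : 'I_4) : 'M[K]_3 := \matrix_(i, j) mcoeff U_(t) (phi i j).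

Lemma homog1E (p : {mpoly K[4]}) : p \is 1.-homog -> p = \sum_t p@_U_(t) *: 'X_t.
Proof.
move=> hp; apply/mpolyP => m; rewrite raddf_sum /=.
have [/mdeg1P[t /eqP->]|m1] := boolP (mdeg m == 1%N).
  rewrite (bigD1 t) //= mcoeffZ mcoeffXU eqxx mulr1 big1 ?addr0 // => s st.
  by rewrite mcoeffZ mcoeffXU (negbTE st) mulr0.
rewrite (dhomog_nemf_coeff hp m1) big1 // => t _.
rewrite mcoeffZ mcoeffX; case: eqP => [tm|_]; last by rewrite mulr0.
by rewrite -tm mdeg1 in m1.
Qed.

Lemma meval_coefmx phi (y : 'rV[K]_4) : linear_mx phi ->
  map_mx (meval (fun t => y 0 t)) phi = evf (coefmx phi) y.
Proof.
move=> lphi; apply/matrixP => i j; rewrite mxE [in LHS](homog1E (lphi i j)).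
rewrite (raddf_sum (meval _)) summxE; apply: eq_bigr => t _ /=.
by rewrite mevalZ mevalXU !mxE mulrC.
Qed.

Lemma meval_f4 (y : 'rV[K]_4) : meval (fun t => y 0 t) (f4 K) = fermat_form y.
Proof.
rewrite /f4 !mevalD !rmorphXn /= !mevalXU /fermat_form big_ord4.
by [].
Qed.

(** Evaluation at y. *)
Lemma coefmx_det_fermat phi : linear_mx phi -> \det phi = f4 K -> det_fermat (coefmx phi).
Proof.
move=> lphi dphi y; rewrite -meval_coefmx // -meval_f4 -dphi.
exact: det_map_mx.
Qed.

Lemma mcoeff_const_mul P phi i j m :
  mcoeff m ((const_mx3 P *m phi) i j) = \sum_k P i k * mcoeff m (phi k j).
Proof.
rewrite mxE (raddf_sum (mcoeff m)); apply: eq_bigr => k _ /=.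
by rewrite mxE mcoeffCM.
Qed.

Lemma mcoeff_mul_const psi Q i j m :
  mcoeff m ((psi *m const_mx3 Q) i j) = \sum_k mcoeff m (psi i k) * Q k j.
Proof.
rewrite mxE (raddf_sum (mcoeff m)); apply: eq_bigr => k _ /=.
by rewrite mxE mulrC mcoeffCM mulrC.
Qed.

Lemma lin_equiv_coefmx phi psi : lin_equiv phi psi -> exists P Q,
  [/\ P \in unitmx, Q \in unitmx & forall t, P *m coefmx phi t = coefmx psi t *m Q].
Proof.
move=> [P [Q [Pu Qu E]]]; exists P, Q; split=> // t; apply/matrixP => i j.
have := congr1 (fun M : 'M[S]_3 => mcoeff U_(t) (M i j)) E.
rewrite /= mcoeff_const_mul mcoeff_mul_const !mxE => E'.
transitivity (\sum_k P i k * (phi k j : {mpoly K[4]})@_U_(t)).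
  by apply: eq_bigr => k _; rewrite !mxE.
by rewrite E'; apply: eq_bigr => k _; rewrite !mxE.
Qed.

Lemma coefmx_lin_equiv phi psi P Q : linear_mx phi -> linear_mx psi ->
    P \in unitmx -> Q \in unitmx -> (forall t, P *m coefmx phi t = coefmx psi t *m Q) ->
  lin_equiv phi psi.
Proof.
move=> lphi lpsi Pu Qu E; exists P, Q; split=> //.
apply/matrixP => i j; apply/mpolyP => m; rewrite mcoeff_const_mul mcoeff_mul_const.
have [/mdeg1P[t /eqP->]|m1] := boolP (mdeg m == 1%N); last first.
  rewrite !big1 // => k _; first by rewrite (dhomog_nemf_coeff (lpsi i k) m1) mul0r.
  by rewrite (dhomog_nemf_coeff (lphi k j) m1) mulr0.
have := congr1 (fun M : 'M[K]_3 => M i j) (E t); rewrite !mxE.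
under eq_bigr do rewrite mxE; move=> ->.
by apply: eq_bigr => k _; rewrite mxE.
Qed.

End Coefficients.

(** * Arithmetic of Eisenstein integers *)

(** (x, y) stands for x + y w, where w is a primitive cubic root of unity. The
    operations are given on pairs of binary integers so that they compute. *)
Definition eis : Type := (BinNums.Z * BinNums.Z)%type.
Definition eis0 : eis := (0, 0).
Definition eis1 : eis := (1, 0).
Definition addE (x y : eis) : eis := (BinInt.Z.add x.1 y.1, BinInt.Z.add x.2 y.2).
Definition oppE (x : eis) : eis := (BinInt.Z.opp x.1, BinInt.Z.opp x.2).
Definition mulE (x y : eis) : eis :=
  let t := BinInt.Z.mul x.2 y.2 in
  (BinInt.Z.sub (BinInt.Z.mul x.1 y.1) t,
   BinInt.Z.sub (BinInt.Z.add (BinInt.Z.mul x.1 y.2) (BinInt.Z.mul x.2 y.1)) t).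
Lemma addEE x y : addE x y = (x.1 + y.1, x.2 + y.2). Proof. by []. Qed.
Lemma oppEE x : oppE x = (- x.1, - x.2). Proof. by []. Qed.
Lemma mulEE x y : mulE x y = (x.1 * y.1 - x.2 * y.2, x.1 * y.2 + x.2 * y.1 - x.2 * y.2).
Proof. by []. Qed.

Definition nthE (s : seq eis) i := nth eis0 s i.
Definition dot3 (r s : seq eis) :=
  addE (addE (mulE (nthE r 0) (nthE s 0)) (mulE (nthE r 1) (nthE s 1))) (mulE (nthE r 2) (nthE s 2)).
Definition dot4 (r s : seq eis) :=
  addE (addE (addE (mulE (nthE r 0) (nthE s 0)) (mulE (nthE r 1) (nthE s 1)))
    (mulE (nthE r 2) (nthE s 2))) (mulE (nthE r 3) (nthE s 3)).
Definition cross (r s : seq eis) : seq eis :=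
  let minor i j := addE (mulE (nthE r i) (nthE s j)) (oppE (mulE (nthE r j) (nthE s i))) in
  [:: minor 1 2; minor 2 0; minor 0 1].

(** T i j is the list of the four coefficients of the linear form at (i, j). *)
Definition table := seq (seq (seq eis)).
Definition entry (T : table) i j := nth [::] (nth [::] T i) j.
Definition trT (T : table) : table := [seq [seq entry T j i | j <- iota 0 3] | i <- iota 0 3].
Definition eval_row T p i := [seq dot4 (entry T i j) p | j <- iota 0 3].
Definition zero3 : seq eis := [:: eis0; eis0; eis0].

Fixpoint cross_with r (s : seq (seq eis)) : seq eis :=
  if s is x :: s' then let c := cross r x in if c == zero3 then cross_with r s' else c
  else zero3.
(** The first nonzero cross product of two of the given vectors: if the vectors have
    rank two it spans their orthogonal. *)
Fixpoint kvec (s : seq (seq eis)) : seq eis :=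
  if s is r :: s' then let c := cross_with r s' in if c == zero3 then kvec s' else c
  else zero3.

Definition line_rows T (l : seq eis * seq eis) :=
  [seq eval_row T l.1 i | i <- iota 0 3] ++ [seq eval_row T l.2 i | i <- iota 0 3].
Definition kills (R : seq (seq eis)) v := all (fun r => dot3 r v == eis0) R.

(** The values Phi_t v, so that u is orthogonal to v when it kills them. *)
Definition images (T : table) v : seq (seq eis) :=
  [seq [seq dot3 [seq nthE (entry T i j) t | j <- iota 0 3] v | i <- iota 0 3] | t <- iota 0 4].
Definition orthE T u v := kills (images T v) u.

Section Eisenstein.
Variables (K : fieldType) (w : K).
Hypothesis w2 : w ^+ 2 + w + 1 = 0.

Definition ev (x : eis) : K := (int_of_Z x.1)%:~R + (int_of_Z x.2)%:~R * w.

Lemma ev0 : ev eis0 = 0. Proof. by rewrite /ev /= mul0r addr0. Qed.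
Lemma ev1 : ev eis1 = 1. Proof. by rewrite /ev /= mul0r addr0. Qed.
Lemma evD x y : ev (addE x y) = ev x + ev y.
Proof. by rewrite addEE /ev /= !rmorphD /=; ring. Qed.
Lemma evN x : ev (oppE x) = - ev x.
Proof. by rewrite oppEE /ev /= !rmorphN /=; ring. Qed.
Lemma evM x y : ev (mulE x y) = ev x * ev y.
Proof.
rewrite mulEE /ev /= !(rmorphD, rmorphN, rmorphM) /=.
apply/eqP; rewrite -subr_eq0; apply/eqP.
transitivity (- ((int_of_Z x.2)%:~R * (int_of_Z y.2)%:~R * (w ^+ 2 + w + 1))); first by ring.
by rewrite w2 mulr0 oppr0.
Qed.

Definition eis_row (r : seq eis) : 'rV[K]_3 := \row_j ev (nthE r j).
Definition eis_col (r : seq eis) : 'cV[K]_3 := \col_j ev (nthE r j).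
Definition eis_pt (r : seq eis) : 'rV[K]_4 := \row_j ev (nthE r j).
Definition eis_fam (T : table) (t : 'I_4) : 'M[K]_3 := \matrix_(i, j) ev (nthE (entry T i j) t).

Lemma ev_dot3 r s : ev (dot3 r s) = (eis_row r *m eis_col s) 0 0.
Proof. by rewrite !(evD, evM) mxE big_ord3 !mxE. Qed.

Lemma ev_dot3C r s : ev (dot3 r s) = ev (dot3 s r).
Proof. by rewrite !(evD, evM); ring. Qed.

Lemma ev_dot3_cross r s t : let x (i : nat) := ev (nthE r i) in let y (i : nat) := ev (nthE s i) in
  let z (i : nat) := ev (nthE t i) in
  ev (dot3 r (cross s t)) = x 0%N * (y 1%N * z 2%N - y 2%N * z 1%N) + x 1%N * (y 2%N * z 0%N - y 0%N * z 2%N)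
    + x 2%N * (y 0%N * z 1%N - y 1%N * z 0%N).
Proof.
move=> x y z; by rewrite /dot3 !(evD, evM, evN).
Qed.

Lemma nth_trT T i j : (i < 3)%N -> (j < 3)%N -> entry (trT T) i j = entry T j i.
Proof. by case: i => [|[|[|//]]]; case: j => [|[|[|//]]]. Qed.

Lemma eis_fam_tr T t : eis_fam (trT T) t = (eis_fam T t)^T.
Proof. by apply/matrixP => i j; rewrite !mxE nth_trT. Qed.

Lemma row_evf_eis_fam T p (i : 'I_3) : row i (evf (eis_fam T) (eis_pt p)) = eis_row (eval_row T p i).
Proof.
apply/rowP => j; rewrite mxE evf_entry !mxE /nthE /eval_row (nth_map 0%N) ?size_iota //.
rewrite nth_iota // add0n /dot4 !(evD, evM) /=.
by rewrite ![ev (nthE p _) * _]mulrC.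
Qed.

Lemma kills_line T l v : kills (line_rows T l) v ->
  evf (eis_fam T) (eis_pt l.1) *m eis_col v = 0 /\ evf (eis_fam T) (eis_pt l.2) *m eis_col v = 0.
Proof.
rewrite /kills /line_rows all_cat => /andP[] /allP k1 /allP k2.
have E p : (forall i, i \in iota 0 3 -> dot3 (eval_row T p i) v == eis0) ->
    evf (eis_fam T) (eis_pt p) *m eis_col v = 0.
  move=> H; apply/row_matrixP => i; rewrite row_mul row_evf_eis_fam row0.
  apply/matrixP => a b; rewrite !ord1 -ev_dot3 mxE (eqP (H i _)) ?ev0 //.
  by rewrite mem_iota ltn_ord.
by split; apply: E => i li; [apply: k1 | apply: k2]; apply: map_f.
Qed.

Lemma orthE_orth T u v : orthE T u v -> orth (eis_fam T) (eis_row u) (eis_col v).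
Proof.
move=> /allP uv t; apply/matrixP => a b; rewrite !ord1 [RHS]mxE.
have /uv/eqP/(congr1 ev) : nth [::] (images T v) t \in images T v by rewrite mem_nth ?size_map.
rewrite ev0 => <-; rewrite ev_dot3C ev_dot3 -mulmxA (nth_map 0%N) ?size_iota // nth_iota // add0n.
congr (fun_of_matrix _ 0 0); congr (_ *m _); apply/colP => i.
rewrite [RHS]mxE /nthE (nth_map 0%N) ?size_iota // nth_iota // add0n ev_dot3 -/(nthE _ _).
rewrite !mxE; apply: eq_bigr => j _; rewrite !mxE; congr (ev _ * _).
by rewrite {2}/nthE (nth_map 0%N) ?size_iota // nth_iota.
Qed.

Lemma cross_with_mem r s : cross_with r s = zero3 \/
  exists2 x, x \in s & cross_with r s = cross r x.
Proof.
elim: s => [|x s IH] /=; first by left.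
case: ifP => _; last by right; exists x; rewrite ?mem_head.
by case: IH => [->|[y ys ->]]; [left | right; exists y; rewrite ?inE ?ys ?orbT].
Qed.

Lemma kvec_mem s : kvec s = zero3 \/ exists r x, [/\ r \in s, x \in s & kvec s = cross r x].
Proof.
elim: s => [|r s IH] /=; first by left.
case: ifP => _; last first.
  case: (cross_with_mem r s) => [->|[y ys ->]]; first by left.
  by right; exists r, y; rewrite !inE eqxx ys orbT.
case: IH => [->|[x [y [xs ys ->]]]]; first by left.
by right; exists x, y; rewrite !inE xs ys !orbT.
Qed.

Hypothesis charK : [pchar K] =i pred0.

Lemma intK_eq0 (z : int) : z%:~R = 0 :> K -> z = 0.
Proof.
case: z => [[|m]|m] //=; first by move/eqP; rewrite -[_%:~R]/(m.+1%:R) (negbTE (natK_neq0 charK m)).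
by rewrite NegzE rmorphN /= => /eqP; rewrite oppr_eq0 -[_%:~R]/(m.+1%:R) (negbTE (natK_neq0 charK m)).
Qed.

(** The norm x^2 - x y + y^2 is positive definite. *)
Lemma ev_eq0 x : ev x = 0 -> x = eis0.
Proof.
case: x => x y; rewrite /ev /= => xy.
have : (int_of_Z (x ^+ 2 - x * y + y ^+ 2))%:~R = 0 :> K.
  rewrite !(rmorphD, rmorphN, rmorphM, rmorphXn) /=.
  transitivity (((int_of_Z x)%:~R + (int_of_Z y)%:~R * w) *
      ((int_of_Z x)%:~R - (int_of_Z y)%:~R - (int_of_Z y)%:~R * w)
    + (int_of_Z y)%:~R ^+ 2 * (w ^+ 2 + w + 1)); first by ring.
  by rewrite xy w2 mul0r mulr0 addr0.
move/intK_eq0 => E; have [x0 y0] : x = 0 /\ y = 0 by move: E; clear; rewrite !expr2; nia.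
by rewrite x0 y0.
Qed.

Lemma ev_inj : injective ev.
Proof.
move=> [a b] [c d] E; have := @ev_eq0 (addE (a, b) (oppE (c, d))).
rewrite evD evN E subrr => /(_ erefl) []; rewrite /= => ac bd.
by congr pair; apply/eqP; rewrite -subr_eq0; apply/eqP.
Qed.

Lemma eis_col_neq0 v : size v = 3 -> v != zero3 -> eis_col v != 0.
Proof.
case: v => [|x [|y [|z []]]] // _; apply: contra_neqN => /eqP/colP v0.
have := v0 o30; have := v0 o31; have := v0 o32; rewrite !mxE /nthE /=.
by move=> /ev_eq0-> /ev_eq0-> /ev_eq0->.
Qed.

Lemma size_kvec s : size (kvec s) = 3.
Proof. by case: (kvec_mem s) => [->|[r [x [_ _ ->]]]]. Qed.

(** Unlike the vector v itself, the set of lines contracted by some column vector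
    does not depend on the choice of bases. *)
Definition contracted (Phi : 'I_4 -> 'M[K]_3) (p1 p2 : 'rV[K]_4) :=
  exists2 v : 'cV[K]_3, v != 0 & evf Phi p1 *m v = 0 /\ evf Phi p2 *m v = 0.

Definition contractedE T l := kills (line_rows T l) (kvec (line_rows T l)).

(** If kvec, the cross product of two rows, does not kill a third row, then the three
    rows are independent and no vector is killed. *)
Lemma contractedP T l : kvec (line_rows T l) != zero3 ->
  contracted (eis_fam T) (eis_pt l.1) (eis_pt l.2) <-> contractedE T l.
Proof.
move=> k0; split=> [[v v0 [v1 v2]]|/kills_line k]; last first.
  by exists (eis_col (kvec (line_rows T l))) => //; apply: eis_col_neq0 (size_kvec _) k0.
have rv r : r \in line_rows T l -> eis_row r *m v = 0.
  rewrite mem_cat => /orP[] /mapP[i]; rewrite mem_iota => /= li ->;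
  by rewrite -[i]/(val (Ordinal li)) -row_evf_eis_fam -row_mul ?v1 ?v2 row0.
apply/allP => r lr; apply: contraNT v0 => rk; apply/eqP.
have [k|[x [y [xl yl k]]]] := kvec_mem (line_rows T l); first by rewrite k in k0.
move: rk; rewrite k => rk.
have {}rk : ev (dot3 r (cross x y)) != 0 by apply: contra rk => /eqP/ev_eq0->.
have E z : z \in line_rows T l ->
    ev (nthE z 0) * v o30 0 + ev (nthE z 1) * v o31 0 + ev (nthE z 2) * v o32 0 = 0.
  by move=> /rv/matrixP/(_ 0 0); rewrite !mxE big_ord3 !mxE.
have [Er Ex Ey] := And3 (E _ lr) (E _ xl) (E _ yl).
move: rk Er Ex Ey; rewrite ev_dot3_cross /=.
set r0 := ev (nthE r 0); set r1 := ev (nthE r 1); set r2 := ev (nthE r 2).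
set x0 := ev (nthE x 0); set x1 := ev (nthE x 1); set x2 := ev (nthE x 2).
set y0 := ev (nthE y 0); set y1 := ev (nthE y 1); set y2 := ev (nthE y 2).
move=> D0 Er Ex Ey.
apply/colP; elim/ord3_ind; rewrite [RHS]mxE; apply: (mulfI D0); rewrite mulr0.
- transitivity ((r0 * v o30 0 + r1 * v o31 0 + r2 * v o32 0) * (x1 * y2 - x2 * y1)
   - (x0 * v o30 0 + x1 * v o31 0 + x2 * v o32 0) * (r1 * y2 - r2 * y1)
   + (y0 * v o30 0 + y1 * v o31 0 + y2 * v o32 0) * (r1 * x2 - r2 * x1)); first by ring.
  by rewrite Er Ex Ey; ring.
- transitivity ((r0 * v o30 0 + r1 * v o31 0 + r2 * v o32 0) * (x2 * y0 - x0 * y2)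
   - (x0 * v o30 0 + x1 * v o31 0 + x2 * v o32 0) * (r2 * y0 - r0 * y2)
   + (y0 * v o30 0 + y1 * v o31 0 + y2 * v o32 0) * (r2 * x0 - r0 * x2)); first by ring.
  by rewrite Er Ex Ey; ring.
transitivity ((r0 * v o30 0 + r1 * v o31 0 + r2 * v o32 0) * (x0 * y1 - x1 * y0)
   - (x0 * v o30 0 + x1 * v o31 0 + x2 * v o32 0) * (r0 * y1 - r1 * y0)
   + (y0 * v o30 0 + y1 * v o31 0 + y2 * v o32 0) * (r0 * x1 - r1 * x0)); first by ring.
by rewrite Er Ex Ey; ring.
Qed.

End Eisenstein.

(** * The finite verification *)

Definition prodE (s : seq eis) := foldr mulE eis1 s.
Definition lform (x y z t : eis) : seq eis := [:: x; y; z; t].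

(** The parameter a of the matrix is b c d / e, and 1 / e = e^2. *)
Definition alpha_table (b c d e : eis) : table :=
  let o := eis0 in let l := eis1 in
  let a := prodE [:: b; c; d; e; e] in
  [:: [:: lform o o o o; lform l o o (oppE a); lform o l (oppE b) o];
      [:: lform l (oppE c) o o;
          lform o o (oppE (mulE b b)) (oppE (prodE [:: a; b; c; c; e; e]));
          lform o o (prodE [:: b; b; c; c]) (oppE (prodE [:: a; b; c; e; e]))];
      [:: lform o o l (oppE d);
          lform o (mulE c c) (prodE [:: b; c; c]) (mulE a c);
          lform (oppE l) (oppE c) o (oppE a)]].

Definition eta_table (a b c e : eis) : table :=
  let o := eis0 in let l := eis1 in
  [:: [:: lform o o o o; lform l l o o; lform o o l (oppE a)];
      [:: lform l e o o; lform o o (oppE l) c; lform o o o o];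
      [:: lform o o l (oppE b); lform o o o o; lform (oppE l) (oppE (mulE e e)) o o]].

Definition theta_table (a b c : eis) : table :=
  let o := eis0 in let l := eis1 in
  [:: [:: lform o o o o; lform l o l o; lform o l o (oppE a)];
      [:: lform l o (oppE (prodE [:: a; a; b])) o; lform o (oppE l) o c; lform o o o o];
      [:: lform o l o (oppE b); lform o o o o; lform (oppE l) o (prodE [:: a; b; b]) o]].

(** A kind (0 for alpha, 1 for beta, 2 for eta, 3 for vartheta) and the list of
    parameters. *)
Definition code := (nat * seq eis)%type.

Definition code_table (c : code) : table :=
  let: (k, s) := c in
  if k == 0%N then alpha_table (nthE s 0) (nthE s 1) (nthE s 2) (nthE s 3) else
  if k == 1%N then trT (alpha_table (nthE s 0) (nthE s 1) (nthE s 2) (nthE s 3)) else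
  if k == 2%N then eta_table (nthE s 0) (nthE s 1) (nthE s 2) (nthE s 3) else
  theta_table (nthE s 0) (nthE s 1) (nthE s 2).

(** The primitive cubic roots of unity and the cubic roots of -1. *)
Definition unitsE : seq eis := [:: (0, 1); (-1, -1)].
Definition rootsE : seq eis := [:: (-1, 0); (0, -1); (1, 1)].

Fixpoint words (A : eqType) (ls : seq (seq A)) : seq (seq A) :=
  if ls is l :: ls' then [seq x :: s | x <- l, s <- words ls'] else [:: [::]].

Definition codes_M : seq code :=
  [seq (k, s) | k <- [:: 0%N; 1%N], s <- words [:: rootsE; rootsE; rootsE; unitsE]].
Definition codes_N : seq code :=
  [seq (2%N, s) | s <- words [:: rootsE; rootsE; rootsE; unitsE] & uniq (take 3 s)] ++
  [seq (3%N, s) | s <- words [:: rootsE; rootsE; rootsE] & uniq s].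
Definition codes := codes_M ++ codes_N.

Definition twist (c : code) : code :=
  let: (k, s) := c in let e := nthE s 3 in
  (k, [:: mulE (nthE s 0) e; mulE (nthE s 1) e; mulE (nthE s 2) e; mulE e e]).

(** A basis of the line joining a point of the edge i, j of the coordinate
    tetrahedron to one of the edge k, l, where {{i, j}, {k, l}} is the partition of
    the coordinates of index f. *)
Definition line_points (f : nat) (c d : eis) : seq eis * seq eis :=
  let o := eis0 in let l := eis1 in
  if f == 0%N then ([:: c; l; o; o], [:: o; o; d; l]) else
  if f == 1%N then ([:: c; o; l; o], [:: o; d; o; l]) else
  ([:: c; o; o; l], [:: o; d; l; o]).

Definition lines : seq (nat * (eis * eis)) :=
  [seq (f, x) | f <- [:: 0%N; 1%N; 2%N], x <- [seq (c, d) | c <- rootsE, d <- rootsE]].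
Definition pts (x : nat * (eis * eis)) := line_points x.1 x.2.1 x.2.2.

Definition line_code := (nat * (eis * eis))%type.

Definition contract_at T (x : line_code) : option (line_code * seq eis) :=
  let R := line_rows T (pts x) in let v := kvec R in
  if (v != zero3) && kills R v then Some (x, v) else None.
Definition contracting T : seq (line_code * seq eis) := pmap (contract_at T) lines.

(** The pairs of lines (L, L') such that some v contracts L, some u contracts L', and
    u and v are orthogonal. *)
Definition matches T : seq (line_code * line_code) :=
  let us := contracting (trT T) in
  flatten [seq let R := images T xv.2 in [seq (xv.1, yu.1) | yu <- us & kills R yu.2]
          | xv <- contracting T].

Definition comb4 (x y : eis) (l : seq eis * seq eis) : seq eis :=
  [seq addE (mulE x (nthE l.1 i)) (mulE y (nthE l.2 i)) | i <- iota 0 4].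

(** The candidates for a common point, as pairs of coefficients on each line: a
    shared basis point, when both lines belong to the same partition, or the point
    found by solving for it when they do not. *)
Definition meet (l l' : line_code) : bool :=
  let (d, d') := (l.2.2, l'.2.2) in let u := eis1 in let o := eis0 in
  has (fun c => let p := comb4 c.1.1 c.1.2 (pts l) in
        (p == comb4 c.2.1 c.2.2 (pts l')) && (p != [:: o; o; o; o]))
   [:: ((u, o), (u, o)); ((o, u), (o, u)); ((d', u), (d, u)); ((mulE d d', u), (u, d));
       ((u, d'), (mulE d d', u)); ((d, d'), (d', d))].

(** Of the 729 pairs of lines, 297 meet or are equal; the 432 others are all
    obtained. *)
Definition lines_covered : bool :=
  let covered := flatten [seq matches (code_table c) | c <- codes] in
  all (fun l => all (fun l' => meet l l' || ((l, l') \in covered)) lines) lines.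

Lemma lines_coveredP : lines_covered.
Proof. by vm_compute. Qed.

Definition signature T : seq bool := [seq contractedE T (pts x) | x <- lines].
Definition codes_separated : bool :=
  let sigs := [seq (c, signature (code_table c)) | c <- codes] in
  all (fun x => all (fun y => [|| x.1 == y.1, x.2 != y.2 |
    ((x.1.1 < 2)%N && (x.1 == twist y.1))]) sigs) sigs.
Lemma codes_separatedP : codes_separated.
Proof. by vm_compute. Qed.

Definition kvecs_neq0 : bool :=
  all (fun c => all (fun x => kvec (line_rows (code_table c) (pts x)) != zero3) lines) codes.

Lemma kvecs_neq0P : kvecs_neq0.
Proof. by vm_compute. Qed.

Definition twists_match : bool :=
  all (fun c => let s := matches (code_table (twist c)) in
    has (fun p => p \in s) (matches (code_table c))) codes_M.

Lemma twists_matchP : twists_match.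
Proof. by vm_compute. Qed.

Lemma twist_codes_M : all (fun c => twist c \in codes_M) codes_M.
Proof. by vm_compute. Qed.

(** * Determinants and coefficients of the members *)

(** Stated over a commutative ring in order to be applied to polynomials over K. *)
Lemma alpha_det_ring (R : comNzRingType) (b c d e a X Y Z T : R) :
    b ^+ 3 = -1 -> c ^+ 3 = -1 -> d ^+ 3 = -1 -> e ^+ 2 = - 1 - e -> a = b * c * d * e ^+ 2 ->
  \det (\matrix_(i < 3, j < 3) (nth [::]
    [:: [:: 0; X - a * T; Y - b * Z];
        [:: X - c * Y; - (b ^+ 2 * Z) - (a * b * c ^+ 2 * e ^+ 2) * T;
            (b ^+ 2 * c ^+ 2) * Z - (a * b * c * e ^+ 2) * T];
        [:: Z - d * T; c ^+ 2 * Y + (b * c ^+ 2) * Z + (a * c) * T; - X - c * Y - a * T]] i)`_j)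
  = X ^+ 3 + Y ^+ 3 + Z ^+ 3 + T ^+ 3.
Proof.
move=> b3 c3 d3 e2 ->; rewrite det_mx33 /det3 !mxE /=.
ring: b3 c3 d3 e2.
Qed.

Lemma eta_det_ring (R : comNzRingType) (a b c e X Y Z T : R) :
    a ^+ 3 = -1 -> b ^+ 2 = - a * b - a ^+ 2 -> c = - a - b -> e ^+ 2 = - 1 - e ->
  \det (\matrix_(i < 3, j < 3) (nth [::]
    [:: [:: 0; X + Y; Z - a * T];
        [:: X + e * Y; - Z + c * T; 0];
        [:: Z - b * T; 0; - X - e ^+ 2 * Y]] i)`_j)
  = X ^+ 3 + Y ^+ 3 + Z ^+ 3 + T ^+ 3.
Proof.
move=> a3 b2 -> e2; rewrite det_mx33 /det3 !mxE /=.
ring: a3 b2 e2.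
Qed.

Lemma theta_det_ring (R : comNzRingType) (a b c X Y Z T : R) :
    a ^+ 3 = -1 -> b ^+ 2 = - a * b - a ^+ 2 -> c = - a - b ->
  \det (\matrix_(i < 3, j < 3) (nth [::]
    [:: [:: 0; X + Z; Y - a * T];
        [:: X - (a ^+ 2 * b) * Z; - Y + c * T; 0];
        [:: Y - b * T; 0; - X + (a * b ^+ 2) * Z]] i)`_j)
  = X ^+ 3 + Y ^+ 3 + Z ^+ 3 + T ^+ 3.
Proof.
move=> a3 b2 ->; rewrite det_mx33 /det3 !mxE /=.
ring: a3 b2.
Qed.

Section Members.
Variable K : fieldType.
Local Notation S := (S4 K).

Lemma unity_root_trinomial (e : K) : e ^+ 3 = 1 -> e <> 1 -> e ^+ 2 = - 1 - e.
Proof.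
move=> e3 e1; apply/eqP; rewrite -subr_eq0; apply/eqP.
have : (e - 1) * (e ^+ 2 - (- 1 - e)) = 0 by ring: e3.
by move/eqP; rewrite mulf_eq0 subr_eq0 => /orP[/eqP|/eqP].
Qed.

Lemma inv_unity3 (e : K) : e ^+ 3 = 1 -> e^-1 = e ^+ 2.
Proof.
move=> e3; have e0 : e != 0.
  by apply/eqP => e0; move/eqP: e3; rewrite e0 expr0n /= eq_sym oner_eq0.
by apply: (mulIf e0); rewrite mulVf // -exprSr e3.
Qed.

(** The coefficients of z^3 + 1, in a form oriented for rewriting. *)
Lemma cubic_roots_vieta (a b c : K) : cubic_roots a b c ->
  [/\ a ^+ 3 = -1, b ^+ 2 = - a * b - a ^+ 2 & c = - a - b].
Proof.
move=> [a3 b3 c3]; rewrite /= !inE negb_or andbT => /andP[/andP[ab ac] bc].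
have quad x y : x ^+ 3 = -1 -> y ^+ 3 = -1 -> x != y -> x ^+ 2 + x * y + y ^+ 2 = 0 :> K.
  move=> x3 y3 xy; have : (x - y) * (x ^+ 2 + x * y + y ^+ 2) = 0 by ring: x3 y3.
  by move/eqP; rewrite mulf_eq0 subr_eq0 (negbTE xy) => /eqP.
have Eab := quad _ _ a3 b3 ab; have Eac := quad _ _ a3 c3 ac.
split=> //; first by apply/eqP; rewrite -subr_eq0 -Eab; apply/eqP; ring.
have : (b - c) * (a + b + c) = 0 by rewrite -[RHS](subrr 0) -{1}Eab -Eac; ring.
move/eqP; rewrite mulf_eq0 subr_eq0 (negbTE bc) => /eqP E.
by apply/eqP; rewrite -subr_eq0 -E; apply/eqP; ring.
Qed.

Lemma alpha_det (b c d e : K) : M_params b c d e -> \det (alpha b c d e) = f4 K.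
Proof.
move=> [b3 c3 d3 e3 e1]; have e2 := unity_root_trinomial e3 e1.
have ae : b * c * d / e = b * c * d * e ^+ 2.
  by rewrite inv_unity3.
have C (x : K) n : (x%:MP : {mpoly K[4]}) ^+ n = (x ^+ n)%:MP by rewrite -rmorphXn.
rewrite /f4 -(@alpha_det_ring {mpoly K[4]} b%:MP c%:MP d%:MP e%:MP (b * c * d / e)%:MP); first last.
- by rewrite ae C -!mpolyCM.
- by rewrite C e2 mpolyCB mpolyCN.
- by rewrite C d3 mpolyCN.
- by rewrite C c3 mpolyCN.
- by rewrite C b3 mpolyCN.
by rewrite !C -!mpolyCM !mul_mpolyC.
Qed.

Lemma mpolyC_exp (x : K) n : (x%:MP : {mpoly K[4]}) ^+ n = (x ^+ n)%:MP.
Proof. by rewrite -rmorphXn. Qed.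

Lemma eta_det (a b c e : K) : cubic_roots a b c -> e ^+ 3 = 1 -> e <> 1 ->
  \det (eta a b c e) = f4 K.
Proof.
move=> /cubic_roots_vieta[a3 b2 cE] e3 e1; have e2 := unity_root_trinomial e3 e1.
rewrite /f4 -(@eta_det_ring {mpoly K[4]} a%:MP b%:MP c%:MP e%:MP); first last.
- by rewrite mpolyC_exp e2 mpolyCB mpolyCN.
- by rewrite cE mpolyCB mpolyCN.
- by rewrite !mpolyC_exp b2 mpolyCB mpolyCM mpolyCN.
- by rewrite mpolyC_exp a3 mpolyCN.
by rewrite !mpolyC_exp !mul_mpolyC.
Qed.

Lemma vartheta_det (a b c : K) : cubic_roots a b c -> \det (vartheta a b c) = f4 K.
Proof.
move=> /cubic_roots_vieta[a3 b2 cE].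
rewrite /f4 -(@theta_det_ring {mpoly K[4]} a%:MP b%:MP c%:MP); first last.
- by rewrite cE mpolyCB mpolyCN.
- by rewrite !mpolyC_exp b2 mpolyCB mpolyCM mpolyCN.
- by rewrite mpolyC_exp a3 mpolyCN.
by rewrite !mpolyC_exp -!mpolyCM !mul_mpolyC.
Qed.

End Members.

Section LinearMembers.
Variable K : fieldType.
Local Notation S := (S4 K).

Lemma linear_mx3 (rows : seq (seq {mpoly K[4]})) :
  all (all (fun p => p \is 1.-homog)) rows -> linear_mx (mx3 rows).
Proof.
move=> /allP hr i j; rewrite mxE.
have [|si] := ltnP i (size rows); last by rewrite [nth [::] _ _]nth_default // nth_nil rpred0.
move=> /(mem_nth [::])/hr/allP hi.
have [|sj] := ltnP j (size (nth [::] rows i)); last by rewrite nth_default // rpred0.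
by move=> /(mem_nth 0)/hi.
Qed.

Lemma homog1X i : ('X_i : {mpoly K[4]}) \is 1.-homog.
Proof. by rewrite dhomogX /= mdeg1. Qed.

Lemma alpha_linear (b c d e : K) : linear_mx (alpha b c d e).
Proof.
apply: linear_mx3; rewrite /= /Y1 /Y2 /Y3 /Y4.
do ?[apply/andP; split=> //];
by do ?[exact: rpred0 | exact: homog1X | apply: rpredB | apply: rpredD | apply: rpredZ | rewrite rpredN].
Qed.

Lemma linear_mx_tr (phi : 'M[S]_3) : linear_mx phi -> linear_mx phi^T.
Proof. by move=> lphi i j; rewrite mxE. Qed.

Lemma eta_linear (a b c e : K) : linear_mx (eta a b c e).
Proof.
apply: linear_mx3; rewrite /= /Y1 /Y2 /Y3 /Y4.
do ?[apply/andP; split=> //];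
by do ?[exact: rpred0 | exact: homog1X | apply: rpredB | apply: rpredD | apply: rpredZ | rewrite rpredN].
Qed.

Lemma vartheta_linear (a b c : K) : linear_mx (vartheta a b c).
Proof.
apply: linear_mx3; rewrite /= /Y1 /Y2 /Y3 /Y4.
do ?[apply/andP; split=> //];
by do ?[exact: rpred0 | exact: homog1X | apply: rpredB | apply: rpredD | apply: rpredZ | rewrite rpredN].
Qed.

Lemma coefmx_tr (phi : 'M[S]_3) t : coefmx phi^T t = (coefmx phi t)^T.
Proof. by apply/matrixP => i j; rewrite !mxE. Qed.

Variable w : K.
Hypothesis w2 : w ^+ 2 + w + 1 = 0.
Local Notation ev := (ev w).

Lemma ev_prod s : ev (prodE s) = \prod_(x <- s) ev x.
Proof. by elim: s => [|x s IH]; rewrite ?big_nil ?ev1 // big_cons /= evM // IH. Qed.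

Lemma coefmx_mx3 (rows : seq (seq {mpoly K[4]})) (T : table) t :
  (forall i j : 'I_3, mcoeff U_(t) (nth [::] rows i)`_j = ev (nthE (entry T i j) t)) ->
  coefmx (mx3 rows) t = eis_fam w T t.
Proof. by move=> E; apply/matrixP => i j; rewrite !mxE E. Qed.

Lemma coefmx_alpha b c d e t : ev e ^+ 3 = 1 ->
  coefmx (alpha (ev b) (ev c) (ev d) (ev e)) t = eis_fam w (alpha_table b c d e) t.
Proof.
move=> /inv_unity3 eV; apply: coefmx_mx3 => i j; rewrite eV /alpha_table.
elim/ord3_ind: i; elim/ord3_ind: j; rewrite /entry /= /Y1 /Y2 /Y3 /Y4
  ?mcoeffB ?(mcoeffD, mcoeffN, mcoeffZ, mcoeff0, mcoeffXU);
elim/ord4_ind: t; rewrite /nthE /= ?(evN, evM w2, ev_prod, ev0, ev1, big_cons, big_nil) //; ring.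
Qed.

Lemma coefmx_eta a b c e t :
  coefmx (eta (ev a) (ev b) (ev c) (ev e)) t = eis_fam w (eta_table a b c e) t.
Proof.
apply: coefmx_mx3 => i j; rewrite /eta_table.
elim/ord3_ind: i; elim/ord3_ind: j; rewrite /entry /= /Y1 /Y2 /Y3 /Y4
  ?mcoeffB ?(mcoeffD, mcoeffN, mcoeffZ, mcoeff0, mcoeffXU);
elim/ord4_ind: t; rewrite /nthE /= ?(evN, evM w2, ev_prod, ev0, ev1, big_cons, big_nil) //; ring.
Qed.

Lemma coefmx_vartheta a b c t :
  coefmx (vartheta (ev a) (ev b) (ev c)) t = eis_fam w (theta_table a b c) t.
Proof.
apply: coefmx_mx3 => i j; rewrite /theta_table.
elim/ord3_ind: i; elim/ord3_ind: j; rewrite /entry /= /Y1 /Y2 /Y3 /Y4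
  ?mcoeffB ?(mcoeffD, mcoeffN, mcoeffZ, mcoeff0, mcoeffXU);
elim/ord4_ind: t; rewrite /nthE /= ?(evN, evM w2, ev_prod, ev0, ev1, big_cons, big_nil) //; ring.
Qed.
End LinearMembers.

(** * The members and their codes *)

Lemma exists_eisenstein (K : closedFieldType) : exists w : K, w ^+ 2 + w + 1 = 0.
Proof.
have [w] := @solve_monicpoly K 2 (fun=> -1) isT.
rewrite !big_ord_recl big_ord0 => E; exists w; rewrite E /=; ring.
Qed.

Section Codes.
Variable K : fieldType.
Hypothesis charK : [pchar K] =i pred0.
Variable w : K.
Hypothesis w2 : w ^+ 2 + w + 1 = 0.
Local Notation S := (S4 K).
Local Notation ev := (ev w).

Lemma ev_literals :
  [/\ [/\ ev (-1, 0) = -1, ev (0, -1) = - w & ev (1, 1) = 1 + w], ev (0, 1) = w &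
      ev (-1, -1) = -1 - w].
Proof.
have z0 : int_of_Z 0 = 0 by []. have z1 : int_of_Z 1 = 1 by [].
have zN : int_of_Z (-1) = -1 by [].
by rewrite /ev /fst /snd z0 z1 zN; split; [split| |]; ring.
Qed.

Lemma ev_rootsP x : x ^+ 3 = -1 <-> exists2 r, r \in rootsE & ev r = x.
Proof.
have [[l1 l2 l3] _ _] := ev_literals.
split=> [x3|[r]].
  have : (x + 1) * ((x + w) * (x - 1 - w)) = 0.
    transitivity (x ^+ 3 + 1 - (w ^+ 2 + w + 1) * (x + 1)); first by ring.
    by rewrite x3 w2 mul0r subr0 addNr.
  move/eqP; rewrite !mulf_eq0 => /or3P[] /eqP E.
  - exists (-1, 0) => //; rewrite l1; apply/eqP; rewrite -subr_eq0 -oppr_eq0 -E; apply/eqP; ring.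
  - exists (0, -1) => //; rewrite l2; apply/eqP; rewrite -subr_eq0 -oppr_eq0 -E; apply/eqP; ring.
  exists (1, 1) => //; rewrite l3; apply/eqP; rewrite -subr_eq0 -oppr_eq0 -E; apply/eqP; ring.
have w2' : w ^+ 2 = - 1 - w by apply/eqP; rewrite -subr_eq0 -w2; apply/eqP; ring.
by rewrite !inE => /or3P[] /eqP-> <-; rewrite ?(l1, l2, l3); ring: w2'.
Qed.

Lemma ev_unitsP x : (x ^+ 3 = 1 /\ x <> 1) <-> exists2 r, r \in unitsE & ev r = x.
Proof.
have [_ l1 l2] := ev_literals.
have w2' : w ^+ 2 = - 1 - w by apply/eqP; rewrite -subr_eq0 -w2; apply/eqP; ring.
split=> [[x3 x1]|[r]].
  have E0 := unity_root_trinomial x3 x1.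
  have : (x - w) * (x + 1 + w) = 0 by ring: E0 w2'.
  move/eqP; rewrite mulf_eq0 => /orP[] /eqP E.
  - exists (0, 1) => //; rewrite l1; apply/eqP; rewrite -subr_eq0 -oppr_eq0 -E; apply/eqP; ring.
  exists (-1, -1) => //; rewrite l2; apply/eqP; rewrite -subr_eq0 -oppr_eq0 -E; apply/eqP; ring.
by rewrite !inE => /orP[] /eqP-> <-; split; try (by rewrite ?(l1, l2); ring: w2');
  rewrite -(ev1 w) => /(ev_inj w2 charK).
Qed.

Definition code_mx (c : code) : 'M[S]_3 :=
  let: (k, s) := c in
  if k == 0%N then alpha (ev (nthE s 0)) (ev (nthE s 1)) (ev (nthE s 2)) (ev (nthE s 3)) else
  if k == 1%N then beta (ev (nthE s 0)) (ev (nthE s 1)) (ev (nthE s 2)) (ev (nthE s 3)) else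
  if k == 2%N then eta (ev (nthE s 0)) (ev (nthE s 1)) (ev (nthE s 2)) (ev (nthE s 3)) else
  vartheta (ev (nthE s 0)) (ev (nthE s 1)) (ev (nthE s 2)).

Lemma words_cons (A : eqType) (l : seq A) ls s : s \in words (l :: ls) <->
  exists x s', [/\ x \in l, s' \in words ls & s = x :: s'].
Proof.
split=> [/allpairsP[[x s'] /= [xl hs ->]]|[x [s' [xl hs ->]]]]; first by exists x, s'.
exact: allpairs_f.
Qed.

Lemma words3P (l1 l2 l3 : seq eis) s : s \in words [:: l1; l2; l3] <->
  exists a b c, [/\ a \in l1, b \in l2, c \in l3 & s = [:: a; b; c]].
Proof.
split=> [/words_cons[a [_ [ha /words_cons[b [_ [hb /words_cons[c [s' [hc hs ->]] ->]]] ->]]]]|].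
  by move: hs; rewrite inE => /eqP->; exists a, b, c.
by move=> [a [b [c [ha hb hc ->]]]]; do !apply: allpairs_f.
Qed.

Lemma words4P (l1 l2 l3 l4 : seq eis) s : s \in words [:: l1; l2; l3; l4] <->
  exists a b c d, [/\ a \in l1, b \in l2, c \in l3, d \in l4 & s = [:: a; b; c; d]].
Proof.
split=> [/words_cons[a [_ [ha /words3P[b [c [d [hb hc hd ->]]]] ->]]]|]; first by exists a, b, c, d.
by move=> [a [b [c [d [ha hb hc hd ->]]]]]; do !apply: allpairs_f.
Qed.

Lemma codes_MP c : reflect (exists a b d e, [/\ [/\ a \in rootsE, b \in rootsE, d \in rootsE & e \in unitsE]
   & c = (0%N, [:: a; b; d; e]) \/ c = (1%N, [:: a; b; d; e])]) (c \in codes_M).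
Proof.
apply: (iffP idP) => [/allpairsP[[k s] [hk /words4P[a [b [d [e [ha hb hd he sE]]]]] ->]]|].
  move: hk => /=; rewrite /= in sE; rewrite sE !inE => hk; exists a, b, d, e; split=> //.
  by case/orP: hk => /eqP->; [left | right].
move=> [a [b [d [e [[ha hb hd he] hc]]]]].
have hs : [:: a; b; d; e] \in words [:: rootsE; rootsE; rootsE; unitsE].
  by apply/words4P; exists a, b, d, e.
by case: hc => ->; apply: allpairs_f.
Qed.

Lemma ev_cubic_roots a b c : a \in rootsE -> b \in rootsE -> c \in rootsE ->
  cubic_roots (ev a) (ev b) (ev c) <-> uniq [:: a; b; c].
Proof.
move=> ha hb hc; have r x : x \in rootsE -> ev x ^+ 3 = -1 by move=> hx; apply/ev_rootsP; exists x.
have U : uniq [:: ev a; ev b; ev c] = uniq [:: a; b; c].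
  by rewrite -(map_inj_uniq (ev_inj w2 charK)).
by rewrite /cubic_roots U; split=> [[]//|u]; split=> //; apply: r.
Qed.

Lemma codes_NP c : reflect
  ((exists a b d e, [/\ [/\ a \in rootsE, b \in rootsE, d \in rootsE & e \in unitsE],
      uniq [:: a; b; d] & c = (2%N, [:: a; b; d; e])]) \/
   (exists a b d, [/\ [/\ a \in rootsE, b \in rootsE & d \in rootsE],
      uniq [:: a; b; d] & c = (3%N, [:: a; b; d])])) (c \in codes_N).
Proof.
apply: (iffP idP) => [|[]].
- rewrite mem_cat => /orP[] /mapP[s]; rewrite mem_filter => /andP[us].
    move=> /words4P[a [b [d [e [ha hb hd he sE]]]]] ->; left; exists a, b, d, e.
    by rewrite sE in us *.
  move=> /words3P[a [b [d [ha hb hd sE]]]] ->; right; exists a, b, d.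
  by split=> //; rewrite -?sE.
- move=> [a [b [d [e [[ha hb hd he] u ->]]]]]; rewrite mem_cat; apply/orP; left.
  by apply: map_f; rewrite mem_filter u; apply/words4P; exists a, b, d, e.
move=> [a [b [d [[ha hb hd] u ->]]]]; rewrite mem_cat; apply/orP; right.
by apply: map_f; rewrite mem_filter u; apply/words3P; exists a, b, d.
Qed.

Lemma M_paramsP b c d e : M_params b c d e <-> exists b' c' d' e',
  [/\ b' \in rootsE, c' \in rootsE, d' \in rootsE & e' \in unitsE] /\
  [/\ b = ev b', c = ev c', d = ev d' & e = ev e'].
Proof.
split=> [[/ev_rootsP[b' hb <-] /ev_rootsP[c' hc <-] /ev_rootsP[d' hd <-] e3 e1]|].
  have /ev_unitsP[e' he <-] := conj e3 e1.
  by exists b', c', d', e'.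
move=> [b' [c' [d' [e' [[hb hc hd he] [-> -> -> ->]]]]]].
have r x : x \in rootsE -> ev x ^+ 3 = -1 by move=> hx; apply/ev_rootsP; exists x.
have /ev_unitsP[e3 e1] : exists2 r, r \in unitsE & ev r = ev e' by exists e'.
by split=> //; apply: r.
Qed.

Lemma calMP phi : calM phi <-> exists2 c, c \in codes_M & phi = code_mx c.
Proof.
rewrite /calM; split.
  move=> [b [c [d [e [H hphi]]]]].
  have /M_paramsP[b' [c' [d' [e' [h [bE cE dE eE]]]]]] := H; move: hphi; rewrite bE cE dE eE.
  case=> ->; [exists (0%N, [:: b'; c'; d'; e']) | exists (1%N, [:: b'; c'; d'; e'])] => //;
    apply/codes_MP; exists b', c', d', e'; split=> //; [by left | by right].
move=> [k /codes_MP[b [c [d [e [h E]]]]] ->]; exists (ev b), (ev c), (ev d), (ev e).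
split; first by apply/M_paramsP; exists b, c, d, e.
by case: E => E; rewrite E; [left | right].
Qed.

Lemma calNP phi : calN phi <-> exists2 c, c \in codes_N & phi = code_mx c.
Proof.
split=> [[[a [b [c [e [abc e3 e1 ->]]]]]|[a [b [c [abc ->]]]]]|].
- have [/ev_rootsP[a' ha aE] /ev_rootsP[b' hb bE] /ev_rootsP[c' hc cE] _] := abc.
  have /ev_unitsP[e' he eE] := conj e3 e1.
  exists (2%N, [:: a'; b'; c'; e']); last by rewrite /= /nthE /= aE bE cE eE.
  apply/codes_NP; left; exists a', b', c', e'; split=> //.
  by apply/ev_cubic_roots; rewrite ?aE ?bE ?cE.
- have [/ev_rootsP[a' ha aE] /ev_rootsP[b' hb bE] /ev_rootsP[c' hc cE] _] := abc.
  exists (3%N, [:: a'; b'; c']); last by rewrite /= /nthE /= aE bE cE.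
  apply/codes_NP; right; exists a', b', c'; split=> //.
  by apply/ev_cubic_roots; rewrite ?aE ?bE ?cE.
move=> [k /codes_NP[[a [b [c [e [[ha hb hc he] u kE]]]]]|[a [b [c [[ha hb hc] u kE]]]]] ->]; rewrite kE.
  left; exists (ev a), (ev b), (ev c), (ev e).
  have /ev_unitsP[e3 e1] : exists2 r, r \in unitsE & ev r = ev e by exists e.
  by split=> //; apply/ev_cubic_roots.
right; exists (ev a), (ev b), (ev c); split=> //; exact/ev_cubic_roots.
Qed.

Lemma code_mx_linear c : linear_mx (code_mx c).
Proof.
case: c => k s /=; do 3?case: ifP => _; last exact: vartheta_linear.
- exact: alpha_linear.
- exact/linear_mx_tr/alpha_linear.
exact: eta_linear.
Qed.

Lemma member_det phi : calM phi \/ calN phi -> \det phi = f4 K.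
Proof.
case=> [[b [c [d [e [h []->]]]]]|[[a [b [c [e [abc e3 e1 ->]]]]]|[a [b [c [abc ->]]]]]].
- exact: alpha_det.
- by rewrite det_tr alpha_det.
- exact: eta_det.
exact: vartheta_det.
Qed.

Lemma code_mx_det c : c \in codes -> \det (code_mx c) = f4 K.
Proof.
by rewrite mem_cat => /orP[] hc; apply: member_det; [left; apply/calMP | right; apply/calNP]; exists c.
Qed.

Lemma coefmx_code c t : c \in codes -> coefmx (code_mx c) t = eis_fam w (code_table c) t.
Proof.
rewrite mem_cat => /orP[/codes_MP[b [d [f [e [[_ _ _ he] hc]]]]]|/codes_NP hc].
  have /ev_unitsP[e3 _] : exists2 r, r \in unitsE & ev r = ev e by exists e.
  case: hc => ->; rewrite /= /nthE /=; first exact: coefmx_alpha.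
  by rewrite /beta coefmx_tr coefmx_alpha // -eis_fam_tr.
case: hc => [[a [b [d [e [_ _ ->]]]]]|[a [b [d [_ _ ->]]]]] /=.
  exact: coefmx_eta.
exact: coefmx_vartheta.
Qed.

End Codes.

(** * Isomorphism classes *)

Section Classification.
Variable K : fieldType.
Hypothesis charK : [pchar K] =i pred0.
Variable w : K.
Hypothesis w2 : w ^+ 2 + w + 1 = 0.
Local Notation ev := (ev w).
Local Notation eis_pt := (eis_pt w).
Local Notation eis_fam := (eis_fam w).
Local Notation code_mx := (code_mx w).

Lemma evf_equiv (Phi Psi : 'I_4 -> 'M[K]_3) P Q y :
  (forall t, P *m Phi t = Psi t *m Q) -> P *m evf Phi y = evf Psi y *m Q.
Proof.
move=> E; rewrite mulmx_sumr mulmx_suml; apply: eq_bigr => t _.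
by rewrite -scalemxAr -scalemxAl E.
Qed.

Lemma contracted_equiv (Phi Psi : 'I_4 -> 'M[K]_3) P Q p1 p2 :
    P \in unitmx -> Q \in unitmx -> (forall t, P *m Phi t = Psi t *m Q) ->
  contracted Phi p1 p2 <-> contracted Psi p1 p2.
Proof.
move=> Pu Qu E; have E' y := evf_equiv y E; split=> -[v v0 [v1 v2]].
  exists (Q *m v); last by rewrite !mulmxA -!E' -!mulmxA v1 v2 !mulmx0.
  by apply: contra_neq v0 => Qv; rewrite -[v](mulKmx Qu) Qv mulmx0.
exists (invmx Q *m v).
  by apply: contra_neq v0 => Qv; rewrite -[v](mulKVmx Qu) Qv mulmx0.
have inj (x : 'cV[K]_3) : P *m x = 0 -> x = 0 by move=> Px; rewrite -[x](mulKmx Pu) Px mulmx0.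
by split; apply: inj; rewrite mulmxA E' mulmxA mulmxK.
Qed.

(** An isomorphism preserves the set of contracted lines, hence the signature. *)
Lemma isom_codes (phi psi : detmx K) c c' : c \in codes -> c' \in codes ->
    phi = code_mx c :> 'M_3 -> psi = code_mx c' :> 'M_3 ->
    lmod_isom (Coker phi) (Coker psi) ->
  c = c' \/ (c.1 < 2)%N /\ c = twist c'.
Proof.
move=> hc hc' phiE psiE /isom_lin_equiv; rewrite phiE psiE.
case/(_ _ _)/Wrap; [exact: code_mx_linear | exact: code_mx_linear |].
move=> /lin_equiv_coefmx[P [Q [Pu Qu E]]].
have sig : signature (code_table c) = signature (code_table c').
  apply/eq_in_map => x hx.
  have k0 d : d \in codes -> kvec (line_rows (code_table d) (pts x)) != zero3.
    by move=> hd; have /allP/(_ _ hd)/allP := kvecs_neq0P; apply.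
  have E' t : P *m eis_fam (code_table c) t = eis_fam (code_table c') t *m Q.
    by rewrite -!(coefmx_code charK w2).
  have := contracted_equiv (eis_pt (pts x).1) (eis_pt (pts x).2) Pu Qu E'.
  have := contractedP w2 charK (k0 c hc); have := contractedP w2 charK (k0 c' hc').
  move=> H1 H2 H3; apply/idP/idP => H; first by apply/H1/H3/H2.
  by apply/H2/H3/H1.
have := allP (allP codes_separatedP _ (map_f _ hc)) _ (map_f _ hc').
rewrite -!/(fst _) -!/(snd _).
by rewrite sig eqxx /= => /orP[/eqP|/andP[? /eqP]]; [left | right].
Qed.

Lemma pts_indep2 x : indep2 (eis_pt (pts x).1) (eis_pt (pts x).2).
Proof.
move=> a b /rowP E; have := E o41; have := E o42; have := E o43; rewrite !mxE /pts /line_points.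
case: eqP => [_|_]; last case: eqP => [_|_]; rewrite /nthE /= ?(ev0, ev1) ?(mulr0, mulr1, addr0, add0r);
by [].
Qed.

Lemma mem_matches T p : p \in matches T -> exists u v,
  contracts (eis_fam T) u v (eis_pt (pts p.1).1) (eis_pt (pts p.1).2)
    (eis_pt (pts p.2).1) (eis_pt (pts p.2).2).
Proof.
have contr T' x v : (x, v) \in contracting T' ->
    size v = 3 /\ [/\ v != zero3 & kills (line_rows T' (pts x)) v].
  have some (b : bool) y v' : Some (x, v) = (if b then Some (y, v') else None) ->
      [/\ b, x = y & v = v'] by case: b => // -[-> ->].
  rewrite mem_pmap => /mapP[y _ /some[/andP[v0 k] -> ->]].
  by split; first exact: size_kvec.
move=> /flattenP[s /mapP[[x v] /contr[sv [v0 xv]] ->] /mapP[[x' u]]].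
rewrite mem_filter => /andP[uv /contr[su [u0 xu]]] ->.
exists (eis_row w u), (eis_col w v).
suff : contracts (eis_fam T) (eis_row w u) (eis_col w v) (eis_pt (pts x).1) (eis_pt (pts x).2)
  (eis_pt (pts x').1) (eis_pt (pts x').2) by [].
have [v1 v2] := kills_line w2 xv; have [u1 u2] := kills_line w2 xu.
have rowT z : eis_row w z = (eis_col w z)^T by apply/rowP => i; rewrite !mxE.
have trE y : evf (eis_fam T) y = (evf (eis_fam (trT T)) y)^T.
  rewrite -evfT; congr (evf _ _); apply/funext => t; by rewrite eis_fam_tr trmxK.
split=> //.
- by rewrite rowT trmx_neq0 // eis_col_neq0.
- exact: eis_col_neq0.
- exact: orthE_orth.
by rewrite rowT !trE -!trmx_mul u1 u2 trmx0.
Qed.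

Lemma eis_pt_comb4 x y l : eis_pt (comb4 x y l) = ev x *: eis_pt l.1 + ev y *: eis_pt l.2.
Proof. by apply/rowP; elim/ord4_ind; rewrite !mxE /= /nthE /= evD !evM. Qed.

(** Used to exclude such pairs by orth_skew. *)
Lemma meet_common_point l l' : meet l l' -> exists2 z, z != 0 &
  exists a b c d, z = a *: eis_pt (pts l).1 + b *: eis_pt (pts l).2 /\
    z = c *: eis_pt (pts l').1 + d *: eis_pt (pts l').2.
Proof.
case/hasP => -[[x y] [x' y']] _ /andP[/eqP E n0]; exists (eis_pt (comb4 x y (pts l))).
  apply: contraNneq n0 => /rowP z0.
  have h (i : 'I_4) : nthE (comb4 x y (pts l)) i = eis0.
    by apply: (ev_eq0 w2 charK); have := z0 i; rewrite !mxE.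
  apply/eqP; apply: (@eq_from_nth _ eis0) => // i li; rewrite -/(nthE _ _) (h (Ordinal li)).
  by case: i li => [|[|[|[|]]]].
exists (ev x), (ev y), (ev x'), (ev y'); split; first exact: eis_pt_comb4.
by rewrite E eis_pt_comb4.
Qed.

(** The points killed along v form a line of the surface, because a matrix that kills
    v is singular. *)
Lemma orth_line_code (Phi : 'I_4 -> 'M[K]_3) u v : det_fermat Phi -> u != 0 -> v != 0 ->
  orth Phi u v -> exists2 x, x \in lines &
    evf Phi (eis_pt (pts x).1) *m v = 0 /\ evf Phi (eis_pt (pts x).2) *m v = 0.
Proof.
move=> dPhi u0 v0 uv.
have [k [l [r [s [kl rv sv [rk rl] [sk sl]]]]]] := orth_reduced_line u0 uv.
pose W y := evf Phi y *m v = 0.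
have WZ c y : W y -> W (c *: y) by rewrite /W evfZ -scalemxAl => ->; rewrite scaler0.
have F a b : fermat_form (a *: r + b *: s) = 0.
  rewrite -dPhi -det_tr; apply/eqP/det0P; exists v^T; first by rewrite trmx_neq0.
  by rewrite -trmx_mul evfD !evfZ mulmxDl -!scalemxAl rv sv !scaler0 addr0 trmx0.
have mem f c d : (f < 3)%N -> c \in rootsE -> d \in rootsE -> (f, (c, d)) \in lines.
  move=> f3 hc hd; apply: allpairs_f; last exact: allpairs_f.
  by move: f f3 => [|[|[|]]].
have [] := line_root_points charK kl WZ rv sv rk rl sk sl F;
  move=> [[c /(ev_rootsP w2)[c' hc <-] Wc] [d /(ev_rootsP w2)[d' hd <-] Wd]].
- exists (0%N, (c', d')); first exact: mem.
  by split; [rewrite -[RHS]Wc | rewrite -[RHS]Wd]; congr (evf _ _ *m _); apply/rowP;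
    elim/ord4_ind; rewrite !mxE /nthE /= ?(ev0, ev1) ?(mulr0, mulr1, addr0, add0r).
- exists (1%N, (c', d')); first exact: mem.
  by split; [rewrite -[RHS]Wc | rewrite -[RHS]Wd]; congr (evf _ _ *m _); apply/rowP;
    elim/ord4_ind; rewrite !mxE /nthE /= ?(ev0, ev1) ?(mulr0, mulr1, addr0, add0r).
exists (2%N, (c', d')); first exact: mem.
by split; [rewrite -[RHS]Wc | rewrite -[RHS]Wd]; congr (evf _ _ *m _); apply/rowP;
  elim/ord4_ind; rewrite !mxE /nthE /= ?(ev0, ev1) ?(mulr0, mulr1, addr0, add0r).
Qed.

(** The two lines contracted by v and u do not meet, so they are matched by a member,
    and contracts_unique applies. *)
Lemma det_fermat_code (Phi : 'I_4 -> 'M[K]_3) u v : det_fermat Phi -> u != 0 -> v != 0 ->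
  orth Phi u v -> exists2 c, c \in codes & exists P Q,
    [/\ P \in unitmx, Q \in unitmx & forall t, P *m Phi t = eis_fam (code_table c) t *m Q].
Proof.
move=> dPhi u0 v0 uv.
have [x hx [x1 x2]] := orth_line_code dPhi u0 v0 uv.
have [|||x' hx' [x'1 x'2]] := @orth_line_code (fun t => (Phi t)^T) v^T u^T (det_fermatT dPhi).
- exact: trmx_neq0.
- exact: trmx_neq0.
- exact: orthT.
have trK y : evf (fun t => (Phi t)^T) y *m u^T = 0 -> u *m evf Phi y = 0.
  by rewrite evfT -trmx_mul => /(congr1 trmx); rewrite trmxK trmx0.
have cPhi : contracts Phi u v (eis_pt (pts x).1) (eis_pt (pts x).2) (eis_pt (pts x').1) (eis_pt (pts x').2).
  by split=> //; split; apply: trK.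
have /allP/(_ _ hx)/allP/(_ _ hx')/orP[/meet_common_point[z z0]|] := lines_coveredP.
  move=> [a [b [c [d [z1 z2']]]]]; case/eqP: z0; apply: (orth_skew charK dPhi u0 v0 uv).
    by rewrite z1 evfD !evfZ mulmxDl -!scalemxAl x1 x2 !scaler0 addr0.
  by rewrite z2' evfD !evfZ mulmxDr -!scalemxAr !trK // !scaler0 addr0.
move=> /flattenP[s /mapP[c hc ->]] /mem_matches[u' [v' cPsi]]; exists c => //.
have dPsi : det_fermat (eis_fam (code_table c)).
  have -> : eis_fam (code_table c) = coefmx (code_mx c).
    by apply/funext => t; rewrite (coefmx_code charK w2).
  by apply: coefmx_det_fermat; [exact: code_mx_linear | exact: (code_mx_det charK w2)].
exact: (contracts_unique charK dPhi dPsi (@pts_indep2 x) (@pts_indep2 x') cPhi cPsi).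
Qed.

(** A member and its twist contract a common pair of disjoint lines. *)
Lemma twist_isom (phi psi : detmx K) c : c \in codes_M -> phi = code_mx c :> 'M_3 ->
  psi = code_mx (twist c) :> 'M_3 -> lmod_isom (Coker psi) (Coker phi).
Proof.
move=> hc phiE psiE; apply: lin_equiv_isom.
have hc' := allP twist_codes_M _ hc.
have inM d : d \in codes_M -> d \in codes by move=> hd; rewrite mem_cat; apply/orP; left.
have dF d : d \in codes_M -> det_fermat (eis_fam (code_table d)).
  move=> hd; have -> : eis_fam (code_table d) = coefmx (code_mx d).
    by apply/funext => t; rewrite (coefmx_code charK w2) // inM.
  by apply: coefmx_det_fermat; [exact: code_mx_linear | apply: (code_mx_det charK w2); exact: inM].
have /hasP[p /mem_matches[u [v cPhi]] /mem_matches[u' [v' cPsi]]] := allP twists_matchP _ hc.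
have [P [Q [Pu Qu E]]] := contracts_unique charK (dF _ hc') (dF _ hc)
  (@pts_indep2 p.1) (@pts_indep2 p.2) cPsi cPhi.
apply: (coefmx_lin_equiv (P := P) (Q := Q)) => //.
- by rewrite psiE; exact: code_mx_linear.
- by rewrite phiE; exact: code_mx_linear.
by move=> t; rewrite phiE psiE !(coefmx_code charK w2) ?inM.
Qed.

End Classification.

Theorem theorem3p4 (K : closedFieldType) (charK : [pchar K] =i pred0) :
  [/\ (* the members are rank one, three generated, graded MCM R4-modules *)
      (forall phi : 'M[S4 K]_3, calM phi \/ calN phi ->
         exists detphi : \det phi = f4 K,
         let C := Coker (DetMx detphi) in
         [/\ is_graded C, is_MCM C, has_rank C 1 & min_nb_gens C 3]),
      (* (i) *)
      (forall M : lmodType (R4 K),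
         is_graded M -> is_MCM M -> has_rank M 1 -> min_nb_gens M 3 ->
         ~ fin_free M ->
         exists phi : detmx K,
           (calM phi \/ calN phi) /\ lmod_isom M (Coker phi)),
      (* (ii) *)
      (forall b c d e : K, M_params b c d e ->
         forall phi psi : detmx K, calM psi ->
         (phi = alpha b c d e :> 'M_3 -> psi <> phi :> 'M_3 ->
            (lmod_isom (Coker psi) (Coker phi) <->
             psi = alpha (b * e) (c * e) (d * e) (e ^+ 2) :> 'M_3)) /\
         (phi = beta b c d e :> 'M_3 -> psi <> phi :> 'M_3 ->
            (lmod_isom (Coker psi) (Coker phi) <->
             psi = beta (b * e) (c * e) (d * e) (e ^+ 2) :> 'M_3))),
      (* (iii) *)
      (forall phi psi : detmx K, calN phi -> calN psi -> phi <> psi :> 'M_3 ->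
         ~ lmod_isom (Coker phi) (Coker psi))
    & (* (iv) *)
      (forall phi psi : detmx K, calN phi -> calM psi ->
         ~ lmod_isom (Coker phi) (Coker psi))].
Proof.
have [w w2] := exists_eisenstein K.
have codesP (phi : 'M[S4 K]_3) : calM phi \/ calN phi <-> exists2 c, c \in codes & phi = code_mx w c.
  split=> [[/(calMP charK w2)|/(calNP charK w2)][c hc ->]|[c]].
  - by exists c => //; rewrite mem_cat hc.
  - by exists c => //; rewrite mem_cat hc orbT.
  rewrite mem_cat => /orP[] hc ->; [left; apply/(calMP charK w2) | right; apply/(calNP charK w2)];
  by exists c.
have inM c : c \in codes_M -> c \in codes by move=> hc; rewrite mem_cat; apply/orP; left.
have inN c : c \in codes_N -> c \in codes by move=> hc; rewrite mem_cat; apply/orP; right.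
have codes_N_kind c : c \in codes_N -> (1 < c.1)%N.
  by move=> /codes_NP[[a [b [d [e [_ _ ->]]]]]|[a [b [d [_ _ ->]]]]].
have codes_M_kind c : c \in codes_M -> (c.1 < 2)%N.
  by move=> /codes_MP[a [b [d [e [_ [] ->]]]]].
split.
- move=> phi hphi; have dphi := member_det hphi; exists dphi => C.
  have lphi : linear_mx phi by have /codesP[c _ ->] := hphi; exact: code_mx_linear.
  split; [exact: coker_graded | exact: coker_MCM | exact: coker_rank1 | exact: coker_min_gens].
- move=> M gM mM rM nM _.
  have [phi [lphi Mphi]] := MCM_linear_coker charK gM mM rM nM.
  have dPhi := coefmx_det_fermat lphi (detmxP phi).
  have [u [v [u0 v0 uv]]] := exists_orth charK dPhi.
  have [c hc [P [Q [Pu Qu E]]]] := det_fermat_code charK w2 dPhi u0 v0 uv.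
  exists (DetMx (code_mx_det charK w2 hc)); split; first by apply/codesP; exists c.
  apply: lmod_isom_trans Mphi _; apply: lin_equiv_isom.
  apply: (coefmx_lin_equiv (P := P) (Q := Q)) => //; first exact: code_mx_linear.
  by move=> t; rewrite (coefmx_code charK w2).
- move=> b c d e /(M_paramsP charK w2)[b' [c' [d' [e' [hbcde [-> -> -> ->]]]]]] phi psi.
  move=> /(calMP charK w2)[cpsi hcpsi psiE].
  have key k : (k < 2)%N -> let cphi := (k, [:: b'; c'; d'; e']) in
      phi = code_mx w cphi :> 'M_3 -> psi <> phi :> 'M_3 ->
      lmod_isom (Coker psi) (Coker phi) <-> psi = code_mx w (twist cphi) :> 'M_3.
    move=> k2 cphi phiE psi_phi.
    have hcphi : cphi \in codes_M.
      apply/codes_MP; exists b', c', d', e'; split=> //.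
      by case: k k2 @cphi {phiE} => [|[|//]]; [left | right].
    split=> [/(isom_codes charK w2 (inM _ hcpsi) (inM _ hcphi) psiE phiE)|].
      case=> [E|[_ E]]; last by rewrite psiE E.
      by case: psi_phi; rewrite psiE phiE E.
    exact: (twist_isom charK w2 hcphi phiE).
  have E0 : alpha (ev w b' * ev w e') (ev w c' * ev w e') (ev w d' * ev w e') (ev w e' ^+ 2)
      = code_mx w (twist (0%N, [:: b'; c'; d'; e'])).
    by rewrite /code_mx /twist /nthE /= !(evM w2).
  have E1 : beta (ev w b' * ev w e') (ev w c' * ev w e') (ev w d' * ev w e') (ev w e' ^+ 2)
      = code_mx w (twist (1%N, [:: b'; c'; d'; e'])).
    by rewrite /code_mx /twist /nthE /= !(evM w2).
  by split=> phiE psi_phi; [rewrite E0 | rewrite E1]; apply: key.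
- move=> phi psi /(calNP charK w2)[c hc phiE] /(calNP charK w2)[c' hc' psiE] ne.
  move/(isom_codes charK w2 (inN _ hc) (inN _ hc') phiE psiE) => [E|[c2 _]].
    by case: ne; rewrite phiE psiE E.
  by have := codes_N_kind _ hc; rewrite ltnNge -ltnS c2.
move=> phi psi /(calNP charK w2)[c hc phiE] /(calMP charK w2)[c' hc' psiE].
move/(isom_codes charK w2 (inN _ hc) (inM _ hc') phiE psiE) => [E|[c2 _]].
  by have := codes_N_kind _ hc; rewrite ltnNge -ltnS E codes_M_kind.
by have := codes_N_kind _ hc; rewrite ltnNge -ltnS c2.
Qed.
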